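(* Let $\mathcal Q=\{1,\dots,N\}$, $T>0$, $\eta\ge0$, and let $A_q\in\mathbb R^{n\times n}$ ($q\in\mathcal Q$), $B\in\mathbb R^{n\times n_1}$, $L\in\mathbb R^{p_0\times n}$, $d\in\mathbb R^{p_0}$, $H:=-LB$, let $\phi_x:\mathbb R^{n_1}\to\mathbb R$ and $\phi_y:\mathbb R^{p_0}\to\mathbb R$ be continuously differentiable, and let $\lambda_q\ge0$ ($q\in\mathcal Q$) with $\sum_{q\in\mathcal Q}\lambda_q=1$. For $\varepsilon>0$ consider the stochastic hybrid system $\mathcal H_\varepsilon$ with state $(x,z)$, $x\in\mathbb R^{n_1}$, $z=(\xi,q,\tau)\in\mathbb R^n\times\mathcal Q\times[0,T]$: $$(x,z)\in C:\quad\dot x=-\nabla\phi_x(x)-H^\top\nabla\phi_y(L\xi+d),\quad\varepsilon\dot\xi=A_q(\xi+Bx),\quad\varepsilon\dot q=0,\quad\varepsilon\dot\tau\in[-\eta,0],$$ $$(x,z)\in D:\quad x^+=x,\quad\xi^+=\xi,\quad q^+=v_1,\quad\tau^+=v_2,\qquad v=(v_1,v_2)\sim\mu=\mu_1\times\mu_2,$$ where $C=\mathbb R^{n_1}\times\mathbb R^n\times\mathcal Q\times[0,T]$, $D=\mathbb R^{n_1}\times\mathbb R^n\times\mathcal Q\times\{0\}$, $\mu_1=\sum_{q\in\mathcal Q}\lambda_q\delta_q$, and $\mu_2$ is the uniform distribution on $[0,T]$. Assume that there exist $\sigma>0$ and symmetric positive definite matrices $\{P_q\}_{q\in\mathcal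 Q}$ such that, with $P:=\sum_{q\in\mathcal Q}\lambda_qP_q$, for all $q\in\mathcal Q$ $$A_q^\top P_q+P_qA_q+\sigma\eta T^{-1}P_q\prec0,\qquad\sigma^{-1}\log(1+\sigma)P-P_q\prec0.$$ Assume also that there exist $m_\phi,L_\phi,L_{\phi_y}>0$ such that the function $\phi(x):=\phi_x(x)+\phi_y(Hx+d)$ is $L_\phi$-smooth and $m_\phi$-strongly convex, and $\phi_y$ is $L_{\phi_y}$-smooth. Let $x^\star$ be the unique minimizer of $\phi$, $\mathcal A:=\{x^\star\}$, and $\tilde{\mathcal A}:=\mathcal A\times(\{-Bx^\star\}\times\mathcal Q\times[0,T])$. Then there exists $\varepsilon^*\in(0,\infty)$ such that for all $\varepsilon\in(0,\varepsilon^* )$ the system $\mathcal H_\varepsilon$ renders the set $\tilde{\mathcal A}$ Uniformly Globally Asymptotically Stable in Probability (UGASp).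
   Context: $M\prec0$ means that the symmetric matrix $M$ is negative definite; $\delta_q$ is the Dirac measure at $q$. A differentiable function is $\ell$-smooth if its gradient is $\ell$-Lipschitz. $|y|_S:=\inf_{s\in S}\|y-s\|$; $\mathbb B^\circ$ is the open unit ball. Random solutions. Write the system as: $y\in C$, $\dot y\in F_\varepsilon(y)$; $y\in D$, $y^+\in G(y,v)$, $v\sim\mu$, with $y=(x,z)$. The random input is an i.i.d. sequence $\mathbf v_k$, $k\ge1$, on a probability space $(\Omega,\mathcal F,\mathbb P)$ with distribution $\mu$. A hybrid time domain is a subset of $\mathbb R_{\ge0}\times\mathbb Z_{\ge0}$ that is a (finite or infinite) union of consecutive intervals $[t_j,t_{j+1}]\times\{j\}$, $0=t_0\le t_1\le\dots$, the last one (if any) possibly of the form $[t_j,\bar t)\times\{j\}$ with $\bar t\le\infty$; a hybrid arc is a function $\psi$ on a hybrid time domain $\mathrm{dom}(\psi)$ with $t\mapsto\psi(t,j)$ locally absolutely continuous for each $j$. Let $\mathcal F_0$ be trivial and $\mathcal F_\ell=\sigma(\mathbf v_1,\dots,\mathbf v_\ell)$. A stochastic hybrid arc is a map $\omega\mapsto\mathbf y_\omega$ to hybrid arcs such that $\omega\mapsto\mathrm{graph}(\mathbf y_\omega)=\{(t,j,s):(t,j)\in\mathrm{dom}(\mathbf y_\omega),s=\mathbf y_\omega(t,j)\}$ is $\mathcal F$-measurable with closed values; it is adapted if the restriction of this graph to $j\in\{0,\dots,\ell\}$ is $\mathcal F_\ell$-measurable in $\omega$ for each $\ell$. (A set-valued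 map $\Phi$ on $\Omega$ is $\mathcal F$-measurable if $\{\omega:\Phi(\omega)\cap O\ne\emptyset\}\in\mathcal F$ for every open $O$.) A random solution from $y_0$ is an adapted stochastic hybrid arc with $\mathbf y_\omega(0,0)=y_0$ such that: if $(t_1,j),(t_2,j)\in\mathrm{dom}(\mathbf y_\omega)$, $t_1<t_2$, then for almost all $t\in[t_1,t_2]$, $\mathbf y_\omega(t,j)\in C$ and $\dot{\mathbf y}_\omega(t,j)\in F_\varepsilon(\mathbf y_\omega(t,j))$; and if $(t,j),(t,j+1)\in\mathrm{dom}(\mathbf y_\omega)$, then $\mathbf y_\omega(t,j)\in D$ and $\mathbf y_\omega(t,j+1)\in G(\mathbf y_\omega(t,j),\mathbf v_{j+1}(\omega))$. It is maximal if it cannot be extended to a random solution whose sample paths are strictly longer with positive probability. UGASp of a compact set $\tilde{\mathcal A}$ means that all of the following hold, with $\varpi(y):=|y|_{\tilde{\mathcal A}}$ for $y\in C\cup D$. (C1) For each $\epsilon>0,\rho>0$ there is $\delta>0$ such that every maximal random solution with $\varpi(\mathbf y_\omega(0,0))\le\delta$ satisfies $\mathbb P(\mathbf y_\omega(t,j)\in\tilde{\mathcal A}+\epsilon\mathbb B^\circ\ \forall(t,j)\in\mathrm{dom}(\mathbf y_\omega))\ge1-\rho$. (C2) For each $\delta>0,\rho>0$ there is $\epsilon>0$ such that the same inequality holds for every maximal random solution with $\varpi(\mathbf y_\omega(0,0))\le\delta$. (C3) For each $\epsilon,\rho,R>0$ there is $\bar T\ge0$ such that every random solution with $\varpi(\mathbf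 y_\omega(0,0))\le R$ satisfies $\mathbb P(\mathbf y_\omega(t,j)\in\tilde{\mathcal A}+\epsilon\mathbb B^\circ\ \forall (t,j)\in\mathrm{dom}(\mathbf y_\omega)\text{ with }t+j\ge\bar T)\ge1-\rho$. *)

(* Defs.v *)
(* MathComp-Analysis, over an arbitrary [R : realType]. *)
From HB Require Import structures.
From mathcomp Require Import all_boot all_order all_algebra.
From mathcomp Require Import all_classical all_reals all_analysis.

Set Implicit Arguments.
Unset Strict Implicit.
Unset Printing Implicit Defensive.

Import Order.TTheory GRing.Theory Num.Theory.
Import numFieldNormedType.Exports.

Local Open Scope classical_set_scope.
Local Open Scope ring_scope.

Section euclidean.
Context {R : realType}.

Definition sqnorm2 n (v : 'cV[R]_n) : R := \sum_(i < n) v i 0 ^+ 2.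

(* The canonical norm of ['cV[R]_n] is the sup norm. *)
Definition norm2 n (v : 'cV[R]_n) : R := Num.sqrt (sqnorm2 v).

(* Strict definiteness of a symmetric matrix. *)
Definition posdefmx n (M : 'M[R]_n) : Prop :=
  M^T = M /\ forall v : 'cV[R]_n, v != 0 -> 0 < (v^T *m M *m v) 0 0.
Definition negdefmx n (M : 'M[R]_n) : Prop :=
  M^T = M /\ forall v : 'cV[R]_n, v != 0 -> (v^T *m M *m v) 0 0 < 0.

(* Vector of partial derivatives; only used for differentiable functions. *)
Definition grad n (f : 'cV[R]_n -> R) (x : 'cV[R]_n) : 'cV[R]_n :=
  \col_(i < n) 'D_(delta_mx i 0) f x.

Definition C1fun n (f : 'cV[R]_n -> R) : Prop :=
  (forall x, differentiable f x) /\ continuous (grad f).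

Definition smooth_with n (l : R) (f : 'cV[R]_n -> R) : Prop :=
  (forall x, differentiable f x) /\
  (forall x y, norm2 (grad f x - grad f y) <= l * norm2 (x - y)).

Definition strongly_convex n (m : R) (f : 'cV[R]_n -> R) : Prop :=
  forall (x y : 'cV[R]_n) (s : R), 0 <= s <= 1 ->
    f (s *: x + (1 - s) *: y) <=
    s * f x + (1 - s) * f y - m / 2 * s * (1 - s) * norm2 (x - y) ^+ 2.

Definition minimizer n (f : 'cV[R]_n -> R) (x : 'cV[R]_n) : Prop :=
  forall y, f x <= f y.

End euclidean.

Section hybrid_arcs.
Context {R : realType} (S : normedModType R).

(* Absolute continuity on [[a, b]]; all norms of a finite-dimensional space [S]
   give the same notion. *)
Definition abs_continuous (a b : R) (f : R -> S) : Prop :=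
  forall e : R, 0 < e -> exists2 r : R, 0 < r &
    forall s : seq (R * R),
      all (fun p => (a <= p.1) && (p.1 <= p.2) && (p.2 <= b)) s ->
      pairwise (fun p q => (p.2 <= q.1) || (q.2 <= p.1)) s ->
      \sum_(p <- s) (p.2 - p.1) < r ->
      \sum_(p <- s) `|f p.2 - f p.1| < e.

Definition loc_abs_continuous (I : set R) (f : R -> S) : Prop :=
  forall a b : R, a <= b -> `[a, b] `<=` I -> abs_continuous a b f.

(* The three cases: infinitely many intervals; [J] compact intervals; [J]
   compact intervals followed by [[t_J, tbar)], [tbar <= +oo].  In the last two
   cases the values of the sequence beyond the last interval are irrelevant. *)
Definition hybrid_time_domain (E : set (R * nat)) : Prop :=
  exists t : nat -> R, [/\ t 0%N = 0, forall j, t j <= t j.+1 &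
    [\/ E = [set p | t p.2 <= p.1 <= t p.2.+1],
        exists J : nat, E = [set p | (p.2 < J)%N /\ t p.2 <= p.1 <= t p.2.+1] |
        exists (J : nat) (tbar : \bar R),
          E = [set p | (p.2 < J)%N /\ t p.2 <= p.1 <= t p.2.+1 \/
                       p.2 = J /\ t J <= p.1 /\ (p.1%:E < tbar)%E] ]].

(* [arc_val] is total; its values outside [arc_dom] carry no meaning. *)
Record hybrid_arc := HybridArc {
  arc_dom : set (R * nat);
  arc_val : R -> nat -> S;
  arc_domP : hybrid_time_domain arc_dom;
  arc_valP : forall j : nat,
    loc_abs_continuous [set t | arc_dom (t, j)] (fun t => arc_val t j) }.

Definition arc_graph (psi : hybrid_arc) : set (R * nat * S) :=
  [set p | arc_dom psi p.1 /\ p.2 = arc_val psi p.1.1 p.1.2].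

End hybrid_arcs.

Record hybrid_system {R : realType} (S : normedModType R)
    (dV : measure_display) (V : measurableType dV) := HybridSystem {
  flow_set : set S;
  flow_map : S -> set S;
  jump_set : set S;
  jump_map : S -> V -> set S;
  input_law : {measure set V -> \bar R} }.

Section random_inputs.
Context {R : realType} {dV : measure_display} {V : measurableType dV}
  {d : measure_display} {Om : measurableType d}.

(* The input sequence is indexed from 1: [v 0] is never used. *)
Definition mutually_independent (P : probability Om R) (v : nat -> Om -> V) :
    Prop :=
  forall (s : seq nat) (E : nat -> set V),
    uniq s -> all (fun k => (0 < k)%N) s -> (forall k, measurable (E k)) ->
    P (\bigcap_(k in [set` s]) (v k @^-1` E k)) =
    (\prod_(k <- s) P (v k @^-1` E k))%E.

Definition iid_input (P : probability Om R) (mu : {measure set V -> \bar R})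
    (v : nat -> Om -> V) : Prop :=
  [/\ forall k, (0 < k)%N -> measurable_fun setT (v k),
      forall k, (0 < k)%N ->
        forall E : set V, measurable E -> P (v k @^-1` E) = mu E &
      mutually_independent P v].

(* sigma(v_1, .., v_l); the trivial sigma-algebra for l = 0. *)
Definition input_filtration (v : nat -> Om -> V) (l : nat) : set (set Om) :=
  <<s [set A | exists k (E : set V),
         [/\ (0 < k <= l)%N, measurable E & A = v k @^-1` E] ]>>.

End random_inputs.

Definition measurable_multifun {Om : Type} (F : set (set Om))
    {X : topologicalType} (Phi : Om -> set X) : Prop :=
  forall O : set X, open O -> F [set w | Phi w `&` O !=set0].

Section random_solutions.
Context {R : realType} {S : normedModType R}
  {dV : measure_display} {V : measurableType dV}
  {d : measure_display} {Om : measurableType d}.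
Implicit Types (H : hybrid_system S V) (y : Om -> hybrid_arc S).

Definition stochastic_hybrid_arc y : Prop :=
  (forall w, closed (arc_graph (y w))) /\
  measurable_multifun measurable (fun w => arc_graph (y w)).

Definition adapted (v : nat -> Om -> V) y : Prop :=
  forall l : nat, measurable_multifun (input_filtration v l)
    (fun w => arc_graph (y w) `&` [set p | (p.1.2 <= l)%N]).

(* The flow condition is only tested at almost every t, so that the endpoints
   of the interval, where the derivative would involve meaningless values of
   [arc_val], do not matter. *)
Definition flows_along H (psi : hybrid_arc S) : Prop :=
  forall (t1 t2 : R) (j : nat),
    arc_dom psi (t1, j) -> arc_dom psi (t2, j) -> t1 < t2 ->
    {ae lebesgue_measure, forall t : R, t1 <= t <= t2 ->
      [/\ flow_set H (arc_val psi t j),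
          derivable (fun s : R => arc_val psi s j) t 1 &
          flow_map H (arc_val psi t j)
            (derive1 (fun s : R => arc_val psi s j) t)]}.

Definition jumps_along H (u : nat -> V) (psi : hybrid_arc S) : Prop :=
  forall (t : R) (j : nat),
    arc_dom psi (t, j) -> arc_dom psi (t, j.+1) ->
    jump_set H (arc_val psi t j) /\
    jump_map H (arc_val psi t j) (u j.+1) (arc_val psi t j.+1).

Definition random_solution H (v : nat -> Om -> V) (y0 : S) y : Prop :=
  [/\ stochastic_hybrid_arc y, adapted v y,
      forall w, arc_dom (y w) (0, 0%N) /\ arc_val (y w) 0 0%N = y0,
      forall w, flows_along H (y w) &
      forall w, jumps_along H (fun k => v k w) (y w)].

Definition extends y' y : Prop :=
  forall w, arc_graph (y w) `<=` arc_graph (y' w).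

Definition maximal_random_solution H (P : probability Om R)
    (v : nat -> Om -> V) (y0 : S) y : Prop :=
  random_solution H v y0 y /\
  ~ exists y', [/\ random_solution H v y0 y', extends y' y &
      (0 < P [set w | arc_dom (y w) `<` arc_dom (y' w)])%E].

End random_solutions.

Section stability.
Context {R : realType} {S : normedModType R}
  {dV : measure_display} {V : measurableType dV}.

(* The norm is a parameter, to be instantiated with the Euclidean one. *)
Variable nrm : S -> R.

Definition set_dist (A : set S) (y : S) : R :=
  inf [set nrm (y - s) | s in A].

(* A + eps B°, where B° is the open unit ball. *)
Definition enlarge (A : set S) (eps : R) : set S :=
  [set y | exists2 a, A a & nrm (y - a) < eps].

Variables (H : hybrid_system S V) (A : set S).

Section fixed_input.
Context {d : measure_display} {Om : measurableType d}.
Variables (P : probability Om R) (v : nat -> Om -> V).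

Definition stay_in (y : Om -> hybrid_arc S) (eps : R) : set Om :=
  [set w | forall t j, arc_dom (y w) (t, j) ->
             enlarge A eps (arc_val (y w) t j)].

Definition stay_in_after (Tb : R) (y : Om -> hybrid_arc S) (eps : R) : set Om :=
  [set w | forall t j, arc_dom (y w) (t, j) -> Tb <= t + j%:R ->
             enlarge A eps (arc_val (y w) t j)].

(* The distance to A is only considered on C `|` D, whence the constraint on
   the initial points. *)
Definition initial_in (r : R) : set S :=
  [set y0 | (flow_set H `|` jump_set H) y0 /\ set_dist A y0 <= r].

Definition stable_in_probability : Prop :=
  forall eps rho : R, 0 < eps -> 0 < rho -> exists2 del : R, 0 < del &
    forall y0 y, initial_in del y0 -> maximal_random_solution H P v y0 y ->
      ((1 - rho)%:E <= P (stay_in y eps))%E.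

Definition bounded_in_probability : Prop :=
  forall del rho : R, 0 < del -> 0 < rho -> exists2 eps : R, 0 < eps &
    forall y0 y, initial_in del y0 -> maximal_random_solution H P v y0 y ->
      ((1 - rho)%:E <= P (stay_in y eps))%E.

Definition attractive_in_probability : Prop :=
  forall eps rho r : R, 0 < eps -> 0 < rho -> 0 < r ->
  exists2 Tb : R, 0 <= Tb &
    forall y0 y, initial_in r y0 -> random_solution H v y0 y ->
      ((1 - rho)%:E <= P (stay_in_after Tb y eps))%E.

End fixed_input.

(* The probability space and the i.i.d. input carried by it are not data of the
   system: the property is required for all of them. *)
Definition UGASp : Prop :=
  forall (d : measure_display) (Om : measurableType d) (P : probability Om R)
    (v : nat -> Om -> V),
  iid_input P (input_law H) v ->
  [/\ stable_in_probability P v, bounded_in_probability P v &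
      attractive_in_probability P v].

End stability.

Section switched_gradient_flow.
Context {R : realType} (N n n1 p0 : nat).

(* The modes 1, .., N as reals; the index [i : 'I_N] stands for mode i + 1. *)
Definition mode (i : 'I_N) : R := i.+1%:R.

Definition modes : set R := range mode.

(* The law \sum_q lam_q delta_q. *)
Definition mode_law (lam : 'I_N -> {nonneg R}) (E : set (measurableTypeR R)) : \bar R :=
  (\sum_(q < N) (lam q)%:num%:E * \d_(mode q) E)%E.

Section mode_law_measure.
Variable lam : 'I_N -> {nonneg R}.

Let mode_law0 : mode_law lam set0 = 0%E.
Proof. by rewrite /mode_law big1// => q _; rewrite measure0 mule0. Qed.

Let mode_law_ge0 (E : set (measurableTypeR R)) : (0 <= mode_law lam E)%E.
Proof. by apply: sume_ge0 => q _; rewrite mule_ge0. Qed.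

Let mode_law_sigma_additive : semi_sigma_additive (mode_law lam).
Proof.
pose w (k : nat) : {nonneg R} :=
  if (insub k : option 'I_N) is Some q then lam q else NngNum (lexx (0 : R)).
pose m (k : nat) : {measure set (measurableTypeR R) -> \bar R} := mscale (w k) \d_(k.+1%:R : measurableTypeR R).
have -> : mode_law lam = msum m N.
  apply/funext => E; rewrite /mode_law /msum; apply: eq_bigr => q _.
  by rewrite /m /mscale/= /w valK.
exact: measure_semi_sigma_additive.
Qed.

HB.instance Definition _ := isMeasure.Build _ _ _ (mode_law lam)
  mode_law0 mode_law_ge0 mode_law_sigma_additive.

End mode_law_measure.

(* y = (x, z) with z = (xi, q, tau). *)
Definition state : normedModType R :=
  ('cV[R]_n1 * ('cV[R]_n * R * R))%type.

Definition state_norm (y : state) : R :=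
  let: (x, (xi, q, tau)) := y in
  Num.sqrt (sqnorm2 x + sqnorm2 xi + q ^+ 2 + tau ^+ 2).

Definition input_space : measurableType _ :=
  (measurableTypeR R * measurableTypeR R)%type.

Definition switched_gradient_flow (T eta : R) (T_gt0 : 0 < T)
    (A : 'I_N -> 'M[R]_n) (B : 'M[R]_(n, n1))
    (L : 'M[R]_(p0, n)) (dist : 'cV[R]_p0)
    (phix : 'cV[R]_n1 -> R) (phiy : 'cV[R]_p0 -> R)
    (lam : 'I_N -> {nonneg R}) (eps : R) :
    hybrid_system state input_space :=
  let H := - (L *m B) in
  {| flow_set := [set y : state |
       let: (x, (xi, q, tau)) := y in modes q /\ 0 <= tau <= T];
     flow_map := fun y => [set dy : state |
       let: (x, (xi, q, tau)) := y in
       let: (dx, (dxi, dq, dtau)) := dy in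
       [/\ dx = - grad phix x - H^T *m grad phiy (L *m xi + dist),
           exists2 i : 'I_N, q = mode i & eps *: dxi = A i *m (xi + B *m x),
           eps * dq = 0 &
           - eta <= eps * dtau <= 0] ];
     jump_set := [set y : state |
       let: (x, (xi, q, tau)) := y in modes q /\ tau = 0];
     jump_map := fun y (u : input_space) => [set y' : state |
       let: (x, (xi, q, tau)) := y in y' = (x, (xi, u.1, u.2))];
     input_law := (mode_law lam \x uniform_prob T_gt0)%E |}.

Definition total_cost (B : 'M[R]_(n, n1)) (L : 'M[R]_(p0, n))
    (dist : 'cV[R]_p0) (phix : 'cV[R]_n1 -> R) (phiy : 'cV[R]_p0 -> R)
    (x : 'cV[R]_n1) : R :=
  let H := - (L *m B) in phix x + phiy (H *m x + dist).

Definition target_set (T : R) (B : 'M[R]_(n, n1)) (xs : 'cV[R]_n1) :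
    set state :=
  [set y : state | let: (x, (xi, q, tau)) := y in
     [/\ x = xs, xi = - (B *m xs), modes q & 0 <= tau <= T]].

End switched_gradient_flow.

(* Main.v *)
Require Import Defs.
From HB Require Import structures.
From mathcomp Require Import all_boot all_order all_algebra.
From mathcomp Require Import all_classical all_reals all_analysis.
From mathcomp Require Import measurable_realfun.
From mathcomp Require Import ring lra.
Import Order.TTheory GRing.Theory Num.Theory.
Import numFieldNormedType.Exports.
Local Open Scope classical_set_scope.
Local Open Scope ring_scope.

(** Write [xt = x - xs] and [zeta = xi + B *m x].  The slow variable follows
    the gradient flow of the total cost up to an error of size [|zeta|], and
    [zeta] is the fast variable, stable on average thanks to the two matrix
    inequalities.  Both are measured by one function,
      [V = (1 - kap * tau) |xt|^2 + zeta^T P_q zeta / (1 + sigma * tau / T)],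
    with [kap] proportional to [eps].

    The clock weight of the second term increases along flows at a relative
    rate at most [sigma * eta / T] in the fast time, which is what the first
    matrix inequality leaves room for.  At a jump [tau] goes from 0 to a uniform value
    in [[0, T]], and the mean of the weight under that law is
    [ln (1 + sigma) / sigma]: the second inequality says that the second term
    contracts on average.  The factor [1 - kap * tau] makes the first term
    contract on average too, for otherwise jumps alone would not decrease
    [|xt|]; while the clock runs down the factor grows, but at a rate
    [kap * eta / eps] small enough to be absorbed by the strong convexity of
    the cost.  For small [eps] this gives [V' <= - c V] along flows
    ([lyapunov_flow_rate]) and a mean factor [rho < 1] at jumps
    ([lyapunov_jump_rate]).

    Along a solution [e^(c t) V] is absolutely continuous on each level with a
    nonpositive derivative almost everywhere, hence nonincreasing
    ([abs_continuous_nonincr], [lyap_st_decrease]).  Let [M_(j+1)] be the value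
    of [e^(c t) V] obtained by feeding the input [v_(j+1)] to the last point of
    level [j], when there is one in the jump set, and 0 otherwise.  Whether the
    solution really jumps may depend on [v_(j+1)] itself, as it may stop
    instead; the existence and the position of the last point of level [j] do
    not, as they are measurable with respect to the first [j] inputs
    ([measurable_last_value]).  Thus [v_(j+1)] is independent of them and
    [E M_(j+1) <= rho * E M_j] ([expectation_step]), while [M_j] bounds
    [e^(c t) V] on level [j] almost surely ([path_bound]).

    With [r] the square root of [rho], Markov's inequality for [M_j] at the
    threshold [K * r^j] and a union bound over [j] show that, with probability
    at least [1 - V_0 / (K * (1 - r))], the bound [V <= K * r^j * e^(- c t)]
    holds on the whole time domain ([exponential_bound]).  As [V] is comparable
    with the squared distance to the target, the three properties are three
    choices of [K]. *)

Set Implicit Arguments.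
Unset Strict Implicit.
Unset Printing Implicit Defensive.

(** * Absolutely continuous functions *)

Section abs_cont.
Context {R : realType}.
Implicit Types (a b : R).

Lemma abs_continuous_comb (S1 S2 S3 : normedModType R) a b (M : R)
    (f : R -> S1) (g : R -> S2) (k : R -> S3) :
  (forall u v, a <= u <= b -> a <= v <= b ->
    `|k v - k u| <= M * (`|f v - f u| + `|g v - g u|)) ->
  abs_continuous a b f -> abs_continuous a b g -> abs_continuous a b k.
Proof.
move=> H acf acg e e0.
have M0 : 0 < `|M| + 1 by rewrite ltr_wpDl.
have e'0 : 0 < e / (`|M| + 1) / 2 by rewrite !divr_gt0.
have [r1 r10 F] := acf _ e'0.
have [r2 r20 G] := acg _ e'0.
exists (Num.min r1 r2); first by rewrite lt_min r10.
move=> s sab sd; rewrite lt_min => /andP[s1 s2].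
have {F} F := F _ sab sd s1.
have {G} G := G _ sab sd s2.
apply: (@le_lt_trans _ _ (\sum_(p <- s)
    (`|M| + 1) * (`|f p.2 - f p.1| + `|g p.2 - g p.1|))).
  rewrite big_seq [leRHS]big_seq; apply: ler_sum => p ps.
  have /allP/(_ _ ps)/andP[/andP[p1 p2] p3] := sab.
  apply: le_trans (H _ _ _ _) _.
  - by rewrite p1 (le_trans p2).
  - by rewrite p3 (le_trans p1).
  - apply: ler_wpM2r; first by rewrite addr_ge0.
    by rewrite (le_trans (ler_norm _))// lerDl.
rewrite -mulr_sumr big_split/= mulrDr.
have -> : e = (`|M| + 1) * (e / (`|M| + 1) / 2) + (`|M| + 1) * (e / (`|M| + 1) / 2).
  by field; rewrite gt_eqF.
by apply: ltrD; rewrite ltr_pM2l.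
Qed.

Lemma abs_continuous_cst (S : normedModType R) a b (c : S) :
  abs_continuous a b (fun=> c).
Proof.
move=> e e0; exists 1 => // s _ _ _.
by rewrite big1// => p _; rewrite subrr normr0.
Qed.

Lemma abs_continuous_lipschitz (S1 S2 : normedModType R) a b (M : R)
    (f : R -> S1) (k : R -> S2) :
  (forall u v, a <= u <= b -> a <= v <= b ->
    `|k v - k u| <= M * `|f v - f u|) ->
  abs_continuous a b f -> abs_continuous a b k.
Proof.
move=> H acf; apply: (@abs_continuous_comb S1 S1 S2 a b M f (fun=> 0) k _ acf).
  by move=> u v hu hv; rewrite subrr normr0 addr0; exact: H.
exact: abs_continuous_cst.
Qed.

Lemma abs_continuous_sub (S : normedModType R) a b a' b' (f : R -> S) :
  a <= a' -> b' <= b -> abs_continuous a b f -> abs_continuous a' b' f.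
Proof.
move=> aa bb acf e e0; have [r r0 F] := acf e e0; exists r => // s sab.
apply: F; apply: sub_all sab => p /andP[/andP[p1 p2] p3].
by rewrite p2 (le_trans aa)// (le_trans p3).
Qed.

Lemma abs_continuous_small (S : normedModType R) a b (f : R -> S) (e : R) :
  abs_continuous a b f -> 0 < e -> exists2 r : R, 0 < r &
   forall u v, a <= u -> u <= v -> v <= b -> v - u < r -> `|f v - f u| < e.
Proof.
move=> acf e0; have [r r0 F] := acf e e0; exists r => // u v au uv vb uvr.
have := F [:: (u, v)]; rewrite /= !big_seq1/=; apply => //.
by rewrite au uv vb.
Qed.

(** A step of length less than [r / 2] changes the function by at most 1, and
    finitely many such steps cross the interval. *)
Lemma abs_continuous_bounded (S : normedModType R) a b (f : R -> S) :
  abs_continuous a b f ->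
  exists2 M : R, 0 <= M & forall t, a <= t <= b -> `|f t| <= M.
Proof.
move=> acf; have [r r0 F] := abs_continuous_small acf (@ltr01 R).
have chain (k : nat) t : a <= t <= b -> t <= a + k%:R * (r / 2) ->
    `|f t - f a| <= k%:R.
  elim: k t => [|k IH] t /andP[at_ tb].
    rewrite mul0r addr0 => ta; have -> : t = a by apply/le_anti/andP.
    by rewrite subrr normr0.
  move=> tk; have [tk'|kt] := leP t (a + k%:R * (r / 2)).
    by apply: le_trans (IH t _ tk') _; rewrite ?at_// ler_nat.
  set u := a + k%:R * (r / 2).
  have au : a <= u by rewrite lerDl mulr_ge0// divr_ge0// ltW.
  rewrite -(subrK (f u) (f t)) -addrA (le_trans (ler_normD _ _))//.
  rewrite -natr1 [leRHS]addrC lerD//; last first.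
    by apply: IH; rewrite // au (le_trans (ltW kt)).
  apply: ltW; apply: F => //; first exact: ltW.
  rewrite -natr1 in tk; rewrite /u; lra.
have [n Hn] : exists n : nat, b <= a + n%:R * (r / 2).
  exists (Num.truncn (`|b - a| / (r / 2))).+1.
  have /ltW := truncnS_gt (`|b - a| / (r / 2)).
  rewrite ler_pdivrMr ?divr_gt0// => h.
  by rewrite -lerBlDl (le_trans _ h)// ler_norm.
exists (n%:R + `|f a|); first by rewrite addr_ge0.
move=> t /andP[at_ tb].
rewrite -(subrK (f a) (f t)) (le_trans (ler_normD _ _))// lerD2r.
by apply: chain; rewrite ?at_ ?tb// (le_trans tb).
Qed.

Lemma abs_continuousD a b (f g : R -> R^o) :
  abs_continuous a b f -> abs_continuous a b g ->
  abs_continuous a b (fun t => f t + g t : R^o).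
Proof.
apply: (@abs_continuous_comb R^o R^o R^o _ _ 1) => u v _ _.
by rewrite mul1r opprD addrACA ler_normD.
Qed.

Lemma abs_continuousM a b (f g : R -> R^o) :
  abs_continuous a b f -> abs_continuous a b g ->
  abs_continuous a b (fun t => f t * g t : R^o).
Proof.
move=> acf acg.
have [M1 M10 B1] := abs_continuous_bounded acf.
have [M2 M20 B2] := abs_continuous_bounded acg.
apply: (@abs_continuous_comb R^o R^o R^o _ _ (M1 + M2) _ _ _ _ acf acg).
move=> u v hu hv.
have -> : f v * g v - f u * g u = f v * (g v - g u) + (f v - f u) * g u by ring.
rewrite (le_trans (ler_normD _ _))// !normrM.
have h1 := B1 _ hv; have h2 := B2 _ hu.
have := normr_ge0 (g v - g u); have := normr_ge0 (f v - f u); nra.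
Qed.

Lemma abs_continuous_sum a b I (s : seq I) (f : I -> R -> R^o) :
  (forall i, abs_continuous a b (f i)) ->
  abs_continuous a b (fun t => \sum_(i <- s) f i t : R^o).
Proof.
move=> H; elim: s => [|i s IH].
  rewrite (_ : (fun t => _) = (fun=> 0)); first exact: abs_continuous_cst.
  by apply/funext => t; rewrite big_nil.
rewrite (_ : (fun t => _) = (fun t => f i t + \sum_(j <- s) f j t : R^o)).
  exact: abs_continuousD.
by apply/funext => t; rewrite big_cons.
Qed.

Local Notation mu := (@lebesgue_measure R).

Lemma negligible_open_cover (N : set (measurableTypeR R)) (r : R) :
  mu.-negligible N -> 0 < r ->
  exists U : set R, [/\ open U, N `<=` U & (mu U < r%:E)%E].
Proof.
move=> [M [mM M0 NM]] r0.
have [U [Uo MU UM]] : exists U : set R,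
    [/\ open U, M `<=` U & (mu (U `\` M) < r%:E)%E].
  by apply: lebesgue_regularity_outer => //=; rewrite M0.
exists U; split => //; first exact: subset_trans MU.
have mU := open_measurable Uo.
apply: le_lt_trans UM; rewrite -[leRHS]adde0 -[X in (_ + X)%E]M0.
have mD : measurable (U `\` M) by exact: measurableD.
rewrite -measureU//.
- apply: le_measure; rewrite ?inE//; first exact: measurableU.
  by move=> x Ux; have [Mx|Mx] := pselect (M x); [right|left].
- by rewrite setDE -setIA setICl setI0.
Qed.

(** The increment over an interval straddling [c] is estimated from [c] on both
    sides, so that no continuity of the derivative is needed. *)
Lemma derive1_le0_step (f : R -> R) (c e : R) : 0 < e ->
  derivable f c 1 -> derive1 f c <= 0 ->
  exists2 dl : R, 0 < dl & forall u v, c - dl < u -> u <= c -> c <= v ->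
    v < c + dl -> f v - f u <= e * (v - u).
Proof.
move=> e0 df f'0.
have cv : h^-1 *: (f (h *: (1:R) + c) - f c) @[h --> 0^'] --> derive1 f c.
  by rewrite derive1E; exact: df.
have : \forall h \near 0^', h^-1 *: (f (h *: (1:R) + c) - f c) < e.
  by apply: (cvgr_lt _ cv); apply: le_lt_trans e0.
rewrite near_withinE => /nbhs_ballP[dl /= dl0 H].
exists dl => // u v u1 u2 v1 v2.
have fv : f v - f c <= e * (v - c).
  have [->|vc] := eqVneq v c; first by rewrite !subrr mulr0.
  have vc0 : 0 < v - c by rewrite subr_gt0 lt_neqAle eq_sym vc.
  have := H (v - c).
  rewrite /ball/= sub0r normrN (gtr0_norm vc0) => /(_ _ (lt0r_neq0 vc0)).
  rewrite ltrBlDl => /(_ v2); rewrite /GRing.scale/= mulr1 subrK mulrC ltr_pdivrMr//.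
  exact: ltW.
have fu : f c - f u <= e * (c - u).
  have [->|uc] := eqVneq u c; first by rewrite !subrr mulr0.
  have vc0 : u - c < 0 by rewrite subr_lt0 lt_neqAle uc.
  have := H (u - c).
  rewrite /ball/= sub0r normrN (ltr0_norm vc0) => /(_ _ (ltr0_neq0 vc0)).
  have h : - (u - c) < dl by lra.
  move=> /(_ h); rewrite /GRing.scale/= mulr1 subrK mulrC ltr_ndivrMr//.
  lra.
lra.
Qed.

(** Cousin's covering argument.  Around a point where the derivative exists, short
    increments have slope at most [e].  The other points lie in an open set of
    small measure, and absolute continuity makes the total increment over
    disjoint intervals of that set small.  The supremum of the points that can
    be reached from [a] by such steps is [b]. *)
Lemma abs_continuous_nonincr (f : R -> R^o) a b : a <= b ->
  abs_continuous a b f ->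
  {ae mu, forall t, a <= t <= b -> derivable (f : R -> R) t 1 /\ derive1 f t <= 0} ->
  f b <= f a.
Proof.
move=> ab acf Nn'.
pose N : set (measurableTypeR R) := ~` [set t | a <= t <= b ->
  derivable (f : R -> R) t 1 /\ derive1 f t <= 0].
have {Nn'} Nn : mu.-negligible N := Nn'.
apply/ler_addgt0Pl => e0' e0'0.
pose e := e0' / (b - a + 1).
have ba : 0 < b - a + 1 by rewrite ltr_wpDl ?subr_ge0.
have e_gt0 : 0 < e by rewrite divr_gt0.
have [r r0 AC] := acf _ e_gt0.
have [U [Uo NO Or]] := negligible_open_cover Nn r0.
have mO := open_measurable Uo.
(* [S] is the set of points reached by good steps and by the intervals [s],
   which lie in [U]. *)
pose S := [set x : R | a <= x <= b /\ exists s : seq (R * R),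
  [/\ all (fun p => (a <= p.1) && (p.1 <= p.2) && (p.2 <= x)) s,
      pairwise (fun p q => (p.2 <= q.1) || (q.2 <= p.1)) s,
      ((\sum_(p <- s) (p.2 - p.1))%:E <= mu (U `&` `]a, x]))%E &
      f x - f a <= e * (x - a) + \sum_(p <- s) `|f p.2 - f p.1| ]].
have Sa : S a.
  split; first by rewrite lexx.
  by exists [::]; split => //; rewrite !big_nil ?measure_ge0// !subrr mulr0 addr0.
have supS : has_sup S by split; [exists a|exists b => x [/andP[]]].
pose c := sup S.
have ac : a <= c by apply: ub_le_sup => //; exact: supS.2.
have cb : c <= b by apply: sup_le_ub; [exists a | move=> x [/andP[]]].
have [dl dl0 step] : exists2 dl : R, 0 < dl &
    forall u v, a <= u -> v <= b -> c - dl < u -> u <= c -> c <= v ->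
    v < c + dl -> S u -> S v.
  have [cN|cN] := pselect (N c).
    have /nbhs_ballP[dl /= dl0 dlO] := open_nbhs_nbhs (conj Uo (NO _ cN)).
    exists dl => // u v au vb u1 u2 v1 v2 [_ [s [s1 s2 s3 s4]]].
    have uv : u <= v by exact: le_trans v1.
    split; first by rewrite (le_trans au).
    exists ((u, v) :: s); split.
    - rewrite /= au uv lexx/=; apply: sub_all s1 => p /andP[/andP[-> ->]]/=.
      by move=> /le_trans; exact.
    - rewrite /= s2 andbT; apply: sub_all s1 => p /andP[_ ->].
      by rewrite orbT.
    - rewrite big_cons/=.
      have -> : U `&` `]a, v] = (U `&` `]a, u]) `|` `]u, v].
        apply/seteqP; split => x /=; rewrite !in_itv/=.
          move=> [Ox /andP[ax xv]]; have [ux|xu] := ltP u x.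
            by right; rewrite xv.
          by left; split; rewrite ?ax.
        move=> [[Ox /andP[ax xu]]|/andP[ux xv]].
          by split; rewrite // ax (le_trans xu).
        split; last by rewrite xv (le_lt_trans au).
        apply: dlO; rewrite /ball/= ltr_norml; apply/andP; split; lra.
      rewrite measureU//=.
      + rewrite lebesgue_measure_itv/= lte_fin; case: ltP => [uv'|vu].
          by rewrite EFinD EFinB addeC; apply: leeD.
        have -> : v - u = 0 by apply/eqP; rewrite subr_eq0 eq_le uv vu.
        by rewrite add0r adde0.
      + exact: measurableI.
      + rewrite -subset0 => x [[_ ]] /=; rewrite !in_itv/= => /andP[_ xu] /andP[ux _].
        by move: (lt_le_trans ux xu); rewrite ltxx.
    - rewrite big_cons/=.
      have := ler_norm (f v - f u); nra.
  have [df f'0] : derivable (f : R -> R) c 1 /\ derive1 f c <= 0.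
    apply: contrapT => h; apply: cN; move=> /=; apply: contra_not h; apply.
    by rewrite ac.
  have [dl dl0 H] := derive1_le0_step e_gt0 df f'0.
  exists dl => // u v au vb u1 u2 v1 v2 [_ [s [s1 s2 s3 s4]]].
  have uv : u <= v by exact: le_trans v1.
  split; first by rewrite (le_trans au).
  exists s; split => //.
  - apply: sub_all s1 => p /andP[/andP[-> ->]]/= /le_trans; exact.
  - apply: (le_trans s3); apply: le_measure; rewrite ?inE; try exact: measurableI.
    by apply: setIS => x /=; rewrite !in_itv/= => /andP[-> /le_trans]; exact.
  - have := H _ _ u1 u2 v1 v2; nra.
have [u Su cu] : exists2 u, S u & c - dl < u by exact: sup_adherent.
have uc : u <= c by apply: ub_le_sup => //; exact: supS.2.
have au : a <= u by case: Su => /andP[].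
have Sb : S b.
  have [bc|bc] := ltP b (c + dl); first by apply: (step u).
  have Sv : S (c + dl / 2) by apply: (step u) => //; lra.
  have : c + dl / 2 <= c by apply: ub_le_sup => //; exact: supS.2.
  lra.
case: Sb => _ [s [s1 s2 s3 s4]].
have h : \sum_(p <- s) (p.2 - p.1) < r.
  rewrite -lte_fin; apply: le_lt_trans s3 _; apply: le_lt_trans Or.
  by apply: le_measure; rewrite ?inE//; exact: measurableI.
have {h} h := AC s s1 s2 h.
have -> : e0' = e * (b - a) + e by rewrite /e; field; rewrite gt_eqF.
rewrite -lerBlDr; apply: (le_trans s4); rewrite lerD2l; exact: ltW.
Qed.

End abs_cont.

(** * Measurable closed-valued maps and their last points *)

Section closed_multifun.
Context {R : realType}.

(** The points [p n] accumulate where the points [k n] do. *)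
Lemma cluster_near_compact (X : pseudoMetricType R) (K Phi : set X)
    (k p : nat -> X) :
  compact K -> closed Phi -> (forall n, Phi (p n)) -> (forall n, K (k n)) ->
  (forall n, ball (k n) n.+1%:R^-1 (p n)) ->
  exists x, [/\ K x, Phi x & forall e : R, 0 < e -> forall N, exists2 n,
    (N <= n)%N & ball x e (p n)].
Proof.
move=> Kc Pc Pp Kk kp.
have [|x [Kx xcl]] := Kc (k @ \oo) _; first by exists 0%N => // n _; exact: Kk.
have H (e : R) : 0 < e -> forall N, exists2 n, (N <= n)%N & ball x e (p n).
  move=> e0 N.
  have e20 : 0 < e / 2 by rewrite divr_gt0.
  have [M Me] : exists M, forall n, (M <= n)%N -> (n.+1%:R^-1 : R) < e / 2.
    exists (Num.truncn (e / 2)^-1) => n Mn.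
    rewrite invf_plt ?posrE//.
    by rewrite (lt_le_trans (truncnS_gt _))// ler_nat ltnS.
  have [||_ [[n /= Hn <-] xk]] := xcl (k @` [set n | (maxn M N <= n)%N]) (ball x (e / 2)).
  - by exists (maxn M N) => // n ?; exists n.
  - exact: nbhsx_ballx.
  rewrite geq_max in Hn; case/andP: Hn => Hn1 Hn2.
  exists n => //; rewrite (splitr e); apply: ball_triangle xk _.
  by apply: le_ball (kp n); exact/ltW/Me.
exists x; split => //.
apply: Pc => B /nbhs_ballP[e /= e0 eB].
have [n _ xn] := H e e0 0%N.
by exists (p n); split => //; exact: eB.
Qed.

Section X.
Variable X : pseudoMetricType R.
Variable cover : nat -> set X.
Hypothesis cover_compact : forall n, compact (cover n).
Hypothesis coverT : forall x, exists n, cover n x.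

Definition thicken (K : set X) (e : R) : set X := \bigcup_(x in K) (ball x e)^°.

Lemma open_thicken K e : open (thicken K e).
Proof. by apply: bigcup_open => x _; exact: open_interior. Qed.

Lemma sub_thicken K e : 0 < e -> K `<=` thicken K e.
Proof. by move=> e0 x Kx; exists x => //; exact: nbhsx_ballx. Qed.

Lemma thickenP K e y : thicken K e y -> exists2 x, K x & ball x e y.
Proof. by move=> [x Kx /interior_subset]; exists x. Qed.

(** Measurability is given for hitting open sets only.  A compact set is hit by a
    closed set when all its open neighborhoods are, and a closed set is a
    countable union of compact ones. *)
Lemma hits_closed d (Om : measurableType d) (Phi : Om -> set X) (K : set X) :
  measurable_multifun measurable Phi -> (forall w, closed (Phi w)) ->
  closed K -> measurable [set w | Phi w `&` K !=set0].
Proof.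
move=> mPhi cPhi cK.
suff H L : compact L -> measurable [set w | Phi w `&` L !=set0].
  rewrite (_ : [set _ | _] = \bigcup_n [set w | Phi w `&` (K `&` cover n) !=set0]).
    apply: bigcupT_measurable => n; apply: H; rewrite setIC.
    by apply: compact_closedI.
  apply/seteqP; split => w /=.
    move=> [p [Pp Kp]]; have [n np] := coverT p.
    by exists n => //; exists p; split.
  by move=> [n _ [p [Pp [Kp _]]]]; exists p.
move=> cL.
rewrite (_ : [set _ | _] = \bigcap_n [set w | Phi w `&` thicken L n.+1%:R^-1 !=set0]).
  by apply: bigcapT_measurable => n; apply: mPhi; exact: open_thicken.
apply/seteqP; split => w /=.
  move=> [p [Pp Kp]] n _; exists p; split => //.
  by apply: sub_thicken Kp; rewrite invr_gt0.
move=> H.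
have /choice[p Hp] : forall n, exists p, Phi w p /\ thicken L n.+1%:R^-1 p.
  by move=> n; have [p []] := H n I; exists p.
have /choice[k Hk] : forall n, exists k, L k /\ ball k n.+1%:R^-1 (p n).
  by move=> n; have /thickenP[k] := (Hp n).2; exists k.
have [x [Lx Px _]] := cluster_near_compact cL (cPhi w) (fun n => (Hp n).1)
  (fun n => (Hk n).1) (fun n => (Hk n).2).
by exists x.
Qed.

End X.

Section last_point.
Variable S : pseudoMetricType R.
Let X := (R * S)%type.
Variable cover : nat -> set X.
Hypothesis cover_compact : forall n, compact (cover n).
Hypothesis coverT : forall x, exists n, cover n x.

(** The last point of a level is where a jump may occur. *)
Definition last_point (Phi : set X) (p : X) : Prop :=
  Phi p /\ forall q, Phi q -> q.1 <= p.1.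

(** The last point is in the compact [L] when, for each [n], some rational [r] has
    points of the set after [r] that are close to [L], and none after
    [r + 1 / n]: such points converge to the last one. *)
Lemma last_point_hits_closed d (Om : measurableType d) (Phi : Om -> set X) (K : set X) :
  measurable_multifun measurable Phi -> (forall w, closed (Phi w)) ->
  closed K -> measurable [set w | last_point (Phi w) `&` K !=set0].
Proof.
move=> mPhi cPhi cK.
suff H L : compact L -> measurable [set w | last_point (Phi w) `&` L !=set0].
  rewrite (_ : [set _ | _] = \bigcup_n [set w | last_point (Phi w) `&` (K `&` cover n) !=set0]).
    apply: bigcupT_measurable => n; apply: H; rewrite setIC.
    by apply: compact_closedI.
  apply/seteqP; split => w /=.
    move=> [p [Pp Kp]]; have [n np] := coverT p.
    by exists n => //; exists p; split.
  by move=> [n _ [p [Pp [Kp _]]]]; exists p.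
move=> cL.
pose after (r : R) : set X := [set p | r < p.1].
have o_after r : open (after r).
  rewrite (_ : after r = fst @^-1` [set t | r < t]) //.
  apply: open_comp; last exact: open_gt.
  by move=> x _; exact: cvg_fst.
rewrite (_ : [set _ | _] = \bigcap_n \bigcup_(r : rat)
   ([set w | Phi w `&` (after (ratr r) `&` thicken L n.+1%:R^-1) !=set0] `&`
    ~` [set w | Phi w `&` after (ratr r + n.+1%:R^-1) !=set0])).
  apply: bigcapT_measurable => n; apply: bigcupT_measurable_rat => r.
  apply: measurableI.
    by apply: mPhi; apply: openI => //; exact: open_thicken.
  by apply: measurableC; exact: mPhi.
apply/seteqP; split => w /=.
  move=> [p [[Pp pl] Kp]] n _.
  have n0 : (0 : R) < n.+1%:R^-1 by rewrite invr_gt0.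
  have pn : p.1 - n.+1%:R^-1 < p.1 by rewrite ltrBlDr ltrDl.
  have [r] := rat_in_itvoo pn.
  rewrite in_itv/= => /andP[r1 r2].
  exists r => //; split.
    by exists p; do !split => //; exact: sub_thicken Kp.
  move=> [q [Pq]]; rewrite /after/= => h.
  have := pl _ Pq; move: n.+1%:R^-1 (ratr r) r1 r2 h {n0 pn} => a b; lra.
move=> H.
have /choice[p Hp] : forall n, exists p, [/\ Phi w p, thicken L n.+1%:R^-1 p &
    forall q, Phi w q -> q.1 <= p.1 + n.+1%:R^-1].
  move=> n; have [r _ [[p [Pp [rp Lp]]] Hq]] := H n I; exists p; split => //.
  move=> q Pq; rewrite leNgt; apply/negP => h; apply: Hq; exists q; split => //.
  move: rp h; rewrite /after/=; move: n.+1%:R^-1 (ratr r) => a b; lra.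
have /choice[k Hk] : forall n, exists k, L k /\ ball k n.+1%:R^-1 (p n).
  by move=> n; have [_ /thickenP[k] ] := Hp n; exists k.
have Pp n : Phi w (p n) by case: (Hp n).
have [x [Lx Px Hx]] := cluster_near_compact cL (cPhi w) Pp
  (fun n => (Hk n).1) (fun n => (Hk n).2).
exists x; split => //; split => // q Pq.
apply/ler_addgt0Pl => e e0.
have e20 : 0 < e / 2 by rewrite divr_gt0.
have [n Mn [/= xn _]] := Hx (e / 2) e20 (Num.truncn (e / 2)^-1).
have ne : (n.+1%:R^-1 : R) < e / 2.
  by rewrite invf_plt ?posrE// (lt_le_trans (truncnS_gt _))// ler_nat ltnS.
have [_ _ /(_ _ Pq)] := Hp n.
move: xn ne; rewrite /ball/= ltr_norml => /andP[xn1 xn2].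
move: n.+1%:R^-1 => a; lra.
Qed.

(** The value 0 stands for a level without last point in [D]. *)
Definition last_value (D : set S) (F : X -> R) (Phi : set X) : R :=
  let E := last_point Phi `&` [set p | D p.2] in
  if pselect (E !=set0) is left h then F (sval (cid h)) else 0.

Lemma last_valueE D F Phi p :
  (forall t s1 s2, Phi (t, s1) -> Phi (t, s2) -> s1 = s2) ->
  last_point Phi p -> D p.2 -> last_value D F Phi = F p.
Proof.
move=> fPhi [Pp lp] Dp; rewrite /last_value.
case: pselect => [h|[]]; last by exists p.
case: cid => q /= [[Pq lq] Dq]; congr F.
have h1 : q.1 = p.1 by apply/le_anti; rewrite lp// lq.
move: h1 Pp Pq; case: (p) => t1 s1; case: (q) => t2 s2 /= -> h2 h3.
by rewrite (fPhi _ _ _ h2 h3).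
Qed.

Lemma last_value_out D F Phi :
  ~ (exists2 p, last_point Phi p & D p.2) -> last_value D F Phi = 0.
Proof.
move=> H; rewrite /last_value; case: pselect => // h; exfalso; apply: H.
by case: h => p [? ?]; exists p.
Qed.

Lemma last_value_ge0 D F Phi : (forall p, 0 <= F p) -> 0 <= last_value D F Phi.
Proof. by move=> F0; rewrite /last_value; case: pselect. Qed.

(** For [r > 0] the event that the value is at least [r] says that the last point
    lies in a closed set. *)
Lemma measurable_last_value (D : set S) (F : X -> R) d (Om : measurableType d)
    (Phi : Om -> set X) :
  closed D -> continuous F -> (forall p, 0 <= F p) ->
  (forall w t s1 s2, Phi w (t, s1) -> Phi w (t, s2) -> s1 = s2) ->
  measurable_multifun measurable Phi -> (forall w, closed (Phi w)) ->
  measurable_fun setT (fun w => last_value D F (Phi w)).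
Proof.
move=> cD cF F0 fPhi mPhi cPhi.
move=> _; apply: (measurability _ (RGenCInfty.measurableE R)) => //.
move=> _ [_ [r ->] <-]; rewrite setTI.
have [r0|r0] := leP r 0.
  rewrite (_ : _ @^-1` _ = setT); first exact: measurableT.
  apply/seteqP; split => // w _ /=; rewrite in_itv/= andbT.
  by rewrite (le_trans r0)// last_value_ge0.
rewrite (_ : _ @^-1` _ = [set w | last_point (Phi w) `&`
   ([set p | D p.2] `&` [set p | r <= F p]) !=set0]).
  apply: last_point_hits_closed => //; apply: closedI.
    rewrite (_ : [set p | D p.2] = snd @^-1` D)//.
    by apply: closed_comp => // x _; exact: cvg_snd.
  rewrite (_ : [set p | r <= F p] = F @^-1` [set t | r <= t])//.
  by apply: closed_comp => [x _|]; [exact: cF|exact: closed_ge].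
apply/seteqP; split => w /=; rewrite in_itv/= andbT.
  have [[p pl Dp]|no] := pselect (exists2 p, last_point (Phi w) p & D p.2).
    by rewrite (last_valueE F (fPhi w) pl Dp) => Fp; exists p.
  by rewrite last_value_out// => /(lt_le_trans r0); rewrite ltxx.
by move=> [p [pl [Dp Fp]]]; rewrite (last_valueE F (fPhi w) pl Dp).
Qed.

End last_point.
End closed_multifun.

(** * Independence of an input from the past *)

Section independence.
Context {R : realType} {d : measure_display} {Om : measurableType d}
  (P : probability Om R).

(** Independence says that the joint law is the product of the two laws; then
    Tonelli's theorem applies. *)
Lemma integral_indep d1 d2 (T1 : measurableType d1) (T2 : measurableType d2)
    (X : Om -> T1) (Y : Om -> T2) (f : T1 -> \bar R) (g : T2 -> \bar R) :
  measurable_fun setT X -> measurable_fun setT Y ->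
  (forall A E, measurable A -> measurable E ->
    P (X @^-1` A `&` Y @^-1` E) = (P (X @^-1` A) * P (Y @^-1` E))%E) ->
  measurable_fun setT f -> measurable_fun setT g ->
  (forall x, (0 <= f x)%E) -> (forall y, (0 <= g y)%E) ->
  (\int[P]_w (f (X w) * g (Y w)) = \int[P]_w f (X w) * \int[P]_w g (Y w))%E.
Proof.
move=> mX mY ind mf mg f0 g0.
pose X' : {mfun Om >-> T1} := HB.pack X (isMeasurableFun.Build _ _ _ _ _ mX).
pose Y' : {mfun Om >-> T2} := HB.pack Y (isMeasurableFun.Build _ _ _ _ _ mY).
have mXY : measurable_fun setT (fun w => (X w, Y w)).
  exact: measurable_fun_pair.
pose XY : {mfun Om >-> (T1 * T2)%type} :=
  HB.pack (fun w => (X w, Y w)) (isMeasurableFun.Build _ _ _ _ _ mXY).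
have joint C : measurable C ->
    (distribution P X' \x distribution P Y')%E C = distribution P XY C.
  apply: product_measure_unique => A E mA mE.
  exact: ind.
pose h (p : T1 * T2) := (f p.1 * g p.2)%E.
have mh : measurable_fun setT h.
  apply: emeasurable_funM.
    exact: (measurableT_comp mf measurable_fst).
  exact: (measurableT_comp mg measurable_snd).
have h0 p : (0 <= h p)%E by rewrite mule_ge0.
have -> : (\int[P]_w (f (X w) * g (Y w)) = \int[distribution P XY]_p h p)%E.
  by rewrite ge0_integral_distribution.
rewrite (eq_measure_integral (distribution P X' \x distribution P Y')%E); last first.
  by move=> A mA _; exact: (esym (joint A mA)).
rewrite fubini_tonelli1//.
under eq_integral do rewrite /fubini_F/h/= ge0_integralZl//.
have g1 : (0 <= \int[distribution P Y']_y g y)%E by exact: integral_ge0.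
rewrite ge0_integralZr//.
by rewrite !ge0_integral_distribution.
Qed.

Context {dV : measure_display} {V : measurableType dV}.
Variables (mu : {measure set V -> \bar R}) (v : nat -> Om -> V).
Hypothesis iid : iid_input P mu v.

Lemma measurable_preimage_input k E : (0 < k)%N -> measurable E ->
  measurable (v k @^-1` E).
Proof.
by case: iid => mv _ _ k0 mE; rewrite -[X in measurable X]setTI; exact: mv.
Qed.

Lemma filtration_measurable l : input_filtration v l `<=` measurable.
Proof.
apply: smallest_sub; first exact: sigma_algebra_measurable.
move=> _ [k [E [/andP[k0 _] mE ->]]]; exact: measurable_preimage_input.
Qed.

(** Both sides are finite measures in [A], and they agree on the finite
    intersections of events given by the inputs 1, .., l, which are stable
    under intersection. *)
Lemma filtration_independent l A E : input_filtration v l A -> measurable E ->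
  P (A `&` v l.+1 @^-1` E) = (P A * P (v l.+1 @^-1` E))%E.
Proof.
case: (iid) => mv _ ind FA mE.
(* the class of finite intersections that generates the sigma-algebra *)
pose G := [set A | exists2 F : nat -> set V, forall k, measurable (F k) &
   A = \bigcap_(k in [set` iota 1 l]) (v k @^-1` F k)].
have Gm : G `<=` measurable.
  move=> _ [F mF ->]; apply: fin_bigcap_measurable.
    exact: finite_seq.
  move=> k /=; rewrite mem_iota => /andP[k1 _]; exact: measurable_preimage_input.
have GI : setI_closed G.
  move=> _ _ [F mF ->] [F' mF' ->]; exists (fun k => F k `&` F' k).
    by move=> k; exact: measurableI.
  by rewrite -bigcapI.
have GT : G setT.
  exists (fun=> setT) => //; apply/esym; rewrite -subTset => w _ k _ //.
have FG : input_filtration v l `<=` <<s G >>.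
  apply: smallest_sub; first exact: smallest_sigma_algebra.
  move=> _ [k [F [/andP[k0 kl] mF ->]]]; apply: sub_sigma_algebra.
  exists (fun i => if i == k then F else setT) => [i|].
    by case: ifP.
  apply/seteqP; split => w /=.
    by move=> vF i _; case: eqP => [->|].
  by move=> /(_ k); rewrite /= eqxx; apply; rewrite /= mem_iota k0 add1n ltnS.
have mvE := measurable_preimage_input (ltn0Sn l) mE.
pose a := fine (P (v l.+1 @^-1` E)).
have a0 : 0 <= a by rewrite fine_ge0.
have aE : a%:E = P (v l.+1 @^-1` E) by rewrite fineK// fin_num_measure.
suff key : forall B, <<s G >> B -> mrestr P mvE B = mscale (NngNum a0) P B.
  have := key _ (FG _ FA); rewrite /mrestr/mscale/= => ->.
  by rewrite muleC; congr (_ * _)%E; exact: aE.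
apply: (g_sigma_algebra_measure_unique G Gm (fun=> setT)) => //.
- by rewrite bigcup_const.
- move=> _ [F mF ->].
  pose F' k := if k == l.+1 then E else F k.
  have mF' k : measurable (F' k) by rewrite /F'; case: ifP.
  have al m : all (fun k => (0 < k)%N) (iota 1 m).
    by apply/allP => k; rewrite mem_iota => /andP[].
  have e1 := ind (iota 1 l.+1) F' (iota_uniq _ _) (al _) mF'.
  have e2 := ind (iota 1 l) F (iota_uniq _ _) (al _) mF.
  have F'F k : k \in iota 1 l -> F' k = F k.
    rewrite mem_iota add1n ltnS /F' => /andP[_ kl].
    by case: eqP => // kE; move: kl; rewrite kE ltnn.
  have F'l : F' l.+1 = E by rewrite /F' eqxx.
  have iotaS : iota 1 l.+1 = iota 1 l ++ [:: l.+1].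
    by rewrite -[in LHS](addn1 l) iotaD add1n.
  transitivity (P (\bigcap_(k in [set` iota 1 l.+1]) v k @^-1` F' k)).
    congr (P _); apply/seteqP; split => w /=.
      move=> [H1 H2] k kS; have : k \in iota 1 l.+1 by exact: kS.
      rewrite iotaS mem_cat => /orP[kl|].
        by rewrite F'F//; exact: H1.
      by rewrite mem_seq1 => /eqP ->; rewrite F'l.
    move=> H; have {}H k : k \in iota 1 l.+1 -> F' k (v k w) by exact: H.
    split.
      move=> k /= kl; rewrite -F'F//; apply: H.
      by rewrite iotaS mem_cat kl.
    by rewrite -F'l; apply: H; rewrite iotaS mem_cat/= mem_seq1 eqxx orbT.
  apply: (etrans e1).
  transitivity
      (P (v l.+1 @^-1` E) * P (\bigcap_(k in [set` iota 1 l]) v k @^-1` F k))%E; last first.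
    by congr (_ * _)%E; exact: esym aE.
  rewrite iotaS big_cat/= big_seq1 F'l muleC; congr (_ * _)%E.
  apply: etrans (esym e2).
  by rewrite big_seq [RHS]big_seq; apply: eq_bigr => k kl; rewrite F'F.
- move=> _; have h : (P ([set: Om] `&` v l.+1 @^-1` E) < +oo)%E.
    by rewrite setTI (le_lt_trans (probability_le1 P mvE))// ltry.
  exact: h.
Qed.

End independence.

(** * Quadratic forms and compactness *)

Section forms.
Context {R : realType}.

Definition bform m n (M : 'M[R]_(m, n)) (u : 'cV[R]_m) (v : 'cV[R]_n) : R :=
  (u^T *m M *m v) 0 0.

Lemma bformE m n (M : 'M[R]_(m, n)) u v :
  bform M u v = \sum_i \sum_j u i 0 * M i j * v j 0.
Proof.
rewrite /bform mxE exchange_big/=; apply: eq_bigr => j _.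
rewrite mxE mulr_suml; apply: eq_bigr => i _.
by rewrite mxE.
Qed.

Lemma bform_mull m n p (M : 'M[R]_(m, n)) (K : 'M[R]_(m, p)) u v :
  bform M (K *m u) v = bform (K^T *m M) u v.
Proof. by rewrite /bform trmx_mul !mulmxA. Qed.

Lemma bform_mulr m n p (M : 'M[R]_(m, n)) (K : 'M[R]_(n, p)) u v :
  bform M u (K *m v) = bform (M *m K) u v.
Proof. by rewrite /bform !mulmxA. Qed.

Lemma bformDl m n (M : 'M[R]_(m, n)) u u' v :
  bform M (u + u') v = bform M u v + bform M u' v.
Proof. by rewrite /bform linearD/= !mulmxDl mxE. Qed.

Lemma bformDr m n (M : 'M[R]_(m, n)) u v v' :
  bform M u (v + v') = bform M u v + bform M u v'.
Proof. by rewrite /bform !mulmxDr mxE. Qed.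

Lemma bformZl m n (M : 'M[R]_(m, n)) a u v :
  bform M (a *: u) v = a * bform M u v.
Proof. by rewrite /bform linearZ/= -!scalemxAl mxE. Qed.

Lemma bformZr m n (M : 'M[R]_(m, n)) a u v :
  bform M u (a *: v) = a * bform M u v.
Proof. by rewrite /bform -!scalemxAr mxE. Qed.

Lemma bformNr m n (M : 'M[R]_(m, n)) u v : bform M u (- v) = - bform M u v.
Proof. by rewrite -scaleN1r bformZr mulN1r. Qed.

Lemma bformDm m n (M M' : 'M[R]_(m, n)) u v :
  bform (M + M') u v = bform M u v + bform M' u v.
Proof. by rewrite /bform mulmxDr mulmxDl mxE. Qed.

Lemma bformZm m n (M : 'M[R]_(m, n)) a u v :
  bform (a *: M) u v = a * bform M u v.
Proof. by rewrite /bform -scalemxAr -scalemxAl mxE. Qed.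

Lemma bform_tr m n (M : 'M[R]_(m, n)) u v : bform M u v = bform M^T v u.
Proof.
rewrite !bformE exchange_big/=; apply: eq_bigr => j _; apply: eq_bigr => i _.
by rewrite mxE mulrC mulrA mulrAC mulrC mulrA mulrAC; ring.
Qed.

Lemma bform_summ I (s : seq I) m n (M : I -> 'M[R]_(m, n)) u v :
  bform (\sum_(i <- s) M i) u v = \sum_(i <- s) bform (M i) u v.
Proof. by rewrite /bform mulmx_sumr mulmx_suml summxE. Qed.

Lemma sqnorm2E n (v : 'cV[R]_n) : sqnorm2 v = bform 1%:M v v.
Proof.
rewrite /bform mulmx1 mxE; apply: eq_bigr => i _.
by rewrite mxE expr2.
Qed.

Lemma sqnorm2_ge0 n (v : 'cV[R]_n) : 0 <= sqnorm2 v.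
Proof. by apply: sumr_ge0 => i _; exact: sqr_ge0. Qed.

Lemma norm2_ge0 n (v : 'cV[R]_n) : 0 <= norm2 v.
Proof. exact: sqrtr_ge0. Qed.

Lemma norm2_sqr n (v : 'cV[R]_n) : norm2 v ^+ 2 = sqnorm2 v.
Proof. by rewrite sqr_sqrtr// sqnorm2_ge0. Qed.

Lemma coord_le_norm2 n (v : 'cV[R]_n) i : `|v i 0| <= norm2 v.
Proof.
rewrite -sqrtr_sqr ler_wsqrtr// /sqnorm2 (bigD1 i)//= lerDl.
by apply: sumr_ge0 => j _; exact: sqr_ge0.
Qed.

Lemma norm2_le_sum n (v : 'cV[R]_n) : norm2 v <= \sum_i `|v i 0|.
Proof.
have S0 : 0 <= \sum_i `|v i 0| by apply: sumr_ge0.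
rewrite -(ger0_norm S0) -sqrtr_sqr ler_wsqrtr// expr2 mulr_suml.
apply: ler_sum => i _; rewrite -normr_id -[leLHS]real_normK ?num_real// normr_id expr2.
rewrite ler_wpM2l// (bigD1 i)//= lerDl.
by apply: sumr_ge0.
Qed.

Definition entry_sum m n (M : 'M[R]_(m, n)) : R := \sum_i \sum_j `|M i j|.

Lemma entry_sum_ge0 m n (M : 'M[R]_(m, n)) : 0 <= entry_sum M.
Proof. by apply: sumr_ge0 => i _; apply: sumr_ge0. Qed.

(** Every coordinate is at most the norm, which gives a constant depending on [M]
    only. *)
Lemma bform_le m n (M : 'M[R]_(m, n)) u v :
  `|bform M u v| <= entry_sum M * (norm2 u * norm2 v).
Proof.
rewrite bformE mulr_suml; apply: le_trans (ler_norm_sum _ _ _) _.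
apply: ler_sum => i _; rewrite mulr_suml.
apply: le_trans (ler_norm_sum _ _ _) _; apply: ler_sum => j _.
rewrite !normrM mulrAC mulrC; apply: ler_wpM2l => //.
by apply: ler_pM => //; exact: coord_le_norm2.
Qed.

Lemma norm2_mulmx m n (M : 'M[R]_(m, n)) v :
  norm2 (M *m v) <= entry_sum M * norm2 v.
Proof.
apply: le_trans (norm2_le_sum _) _; rewrite mulr_suml.
apply: ler_sum => i _; rewrite mxE mulr_suml.
apply: le_trans (ler_norm_sum _ _ _) _; apply: ler_sum => j _.
rewrite normrM; apply: ler_wpM2l => //; exact: coord_le_norm2.
Qed.

Lemma sqnorm2_eq0 n (v : 'cV[R]_n) : (sqnorm2 v == 0) = (v == 0).
Proof.
apply/eqP/eqP => [v0|->]; last first.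
  by rewrite /sqnorm2 big1// => i _; rewrite mxE expr0n.
apply/colP => i; rewrite mxE; apply/eqP; rewrite -normr_eq0 eq_le normr_ge0 andbT.
by apply: le_trans (coord_le_norm2 _ _) _; rewrite /norm2 v0 sqrtr0.
Qed.

Lemma norm2N n (v : 'cV[R]_n) : norm2 (- v) = norm2 v.
Proof. by congr Num.sqrt; apply: eq_bigr => i _; rewrite mxE sqrrN. Qed.

Lemma sqnorm2D n (u v : 'cV[R]_n) : sqnorm2 (u + v) <= 2 * sqnorm2 u + 2 * sqnorm2 v.
Proof.
rewrite /sqnorm2 !mulr_sumr -big_split/=; apply: ler_sum => i _.
rewrite mxE; have := sqr_ge0 (u i 0 - v i 0); nra.
Qed.

Lemma continuous_sum (T : topologicalType) I (s : seq I) (f : I -> T -> R) :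
  (forall i, continuous (f i)) -> continuous (fun x => \sum_(i <- s) f i x).
Proof.
move=> cf x; elim: s => [|i s IH].
  rewrite (_ : (fun _ => _) = (fun=> 0)); first exact: cvg_cst.
  by apply/funext => y; rewrite big_nil.
rewrite (_ : (fun _ => _) = (fun y => f i y + \sum_(j <- s) f j y)).
  by apply: cvgD; [exact: cf|exact: IH].
by apply/funext => y; rewrite big_cons.
Qed.

Lemma continuous_bform (T : topologicalType) m n (M : 'M[R]_(m, n))
    (u : T -> 'cV[R]_m) (v : T -> 'cV[R]_n) :
  continuous u -> continuous v -> continuous (fun x => bform M (u x) (v x)).
Proof.
move=> cu cv; rewrite (_ : (fun x => _) =
  (fun x => \sum_i \sum_j u x i 0 * M i j * v x j 0)); last first.
  by apply/funext => x; rewrite bformE.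
apply: continuous_sum => i; apply: continuous_sum => j x.
apply: cvgM; last exact: (cvg_comp _ _ (cv x) (@coord_continuous _ _ _ j 0 _)).
apply: cvgM; last exact: cvg_cst.
exact: (cvg_comp _ _ (cu x) (@coord_continuous _ _ _ i 0 _)).
Qed.

Lemma cV_box_compact n (m : R) : compact [set v : 'cV[R]_n | forall i, `|v i 0| <= m].
Proof.
have c1 : compact [set v : 'rV[R]_n | forall i, `[(- m), m]%classic (v ord0 i)].
  by apply: (@rV_compact R n (fun=> `[(- m), m]%classic)) => _; exact: segment_compact.
have ct : continuous (trmx : 'rV[R]_n -> 'cV[R]_n).
  move=> /= v A /nbhs_ballP[e /= e0 eA]; apply/nbhs_ballP; exists e => //= w [_ vw].
  by apply: eA; split => // i j; rewrite !mxE; exact: vw.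
have := continuous_compact (continuous_subspaceT ct) c1.
congr compact; apply/seteqP; split => v /=.
  by move=> [w H <-] i; have := H i; rewrite /= in_itv/= mxE ler_norml (ord1 0).
move=> H; exists v^T; last by rewrite trmxK.
by move=> i; rewrite /= in_itv/= mxE -ler_norml.
Qed.

(** The form has a positive minimum on the compact unit sphere. *)
Lemma posdef_coercive n (M : 'M[R]_n) : posdefmx M ->
  exists2 a : R, 0 < a & forall v, a * sqnorm2 v <= bform M v v.
Proof.
move=> [_ pM].
pose sphere := [set v : 'cV[R]_n | sqnorm2 v = 1].
have csq : continuous (fun v : 'cV[R]_n => sqnorm2 v).
  rewrite (_ : (fun v => _) = (fun v : 'cV[R]_n => bform 1%:M v v)).
    by apply: (@continuous_bform 'cV[R]_n) => v; exact: cvg_id.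
  by apply/funext => v; rewrite sqnorm2E.
have sc : compact sphere.
  apply: subclosed_compact (@cV_box_compact n 1) _.
    rewrite (_ : sphere = (fun v : 'cV[R]_n => sqnorm2 v) @^-1` [set 1])//.
    by apply: closed_comp => [v _|]; [exact: csq|exact: closed_eq].
  move=> v v1 i /=; apply: le_trans (coord_le_norm2 _ _) _.
  by rewrite /norm2 v1 sqrtr1.
have scale v : v != 0 -> exists2 u, sphere u & bform M v v = sqnorm2 v * bform M u u.
  move=> v0; have n0 : 0 < norm2 v.
    by rewrite sqrtr_gt0 lt_neqAle sqnorm2_ge0 eq_sym sqnorm2_eq0 v0.
  exists ((norm2 v)^-1 *: v).
    rewrite /sphere/= sqnorm2E bformZl bformZr -sqnorm2E -norm2_sqr.
    by field; rewrite gt_eqF.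
  rewrite bformZl bformZr -norm2_sqr; field; rewrite gt_eqF//.
have [s0|s0] := pselect (sphere !=set0).
  have cM : continuous (fun v : 'cV[R]_n => bform M v v).
    by apply: (@continuous_bform 'cV[R]_n) => v; exact: cvg_id.
  have [c cS cmin] := compact_EVT_min s0 sc (continuous_subspaceT cM).
  exists (bform M c c).
    apply: pM; apply/eqP => c0; move: cS; rewrite inE /sphere/= => /eqP.
    by rewrite c0 (_ : sqnorm2 0 = 0) ?(eq_sym _ 1) ?oner_eq0//; apply/eqP; rewrite sqnorm2_eq0.
  move=> v; have [->|v0] := eqVneq v 0.
    rewrite (_ : sqnorm2 0 = 0); last by apply/eqP; rewrite sqnorm2_eq0.
    by rewrite mulr0 /bform mulmx0 mxE.
  have [u Su ->] := scale v v0.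
  rewrite mulrC ler_wpM2l ?sqnorm2_ge0//.
  by apply: cmin; rewrite inE.
exists 1 => // v; have [->|v0] := eqVneq v 0.
  rewrite (_ : sqnorm2 0 = 0); last by apply/eqP; rewrite sqnorm2_eq0.
  by rewrite mulr0 /bform mulmx0 mxE.
by have [u Su _] := scale v v0; exfalso; apply: s0; exists u.
Qed.

Lemma negdef_coercive n (M : 'M[R]_n) : negdefmx M ->
  exists2 a : R, 0 < a & forall v, bform M v v <= - (a * sqnorm2 v).
Proof.
move=> [sM nM].
have [|a a0 H] := @posdef_coercive n (- M).
  split; first by rewrite linearN/= sM.
  move=> v /nM h; rewrite -[- M]scaleN1r.
  by have := bformZm M (-1) v v; rewrite /bform => ->; rewrite mulN1r oppr_gt0.
exists a => // v; have := H v.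
rewrite -[- M]scaleN1r bformZm; lra.
Qed.

(** Constants that may be decreased can be chosen uniformly over finitely many
    modes. *)
Lemma finite_uniform_bound N (Q : 'I_N -> R -> Prop) :
  (forall i a b, a <= b -> Q i b -> Q i a) ->
  (forall i, exists2 a, 0 < a & Q i a) ->
  exists2 a, 0 < a & forall i, Q i a.
Proof.
move=> Qm QE.
have /choice[f Hf] : forall i, exists a, 0 < a /\ Q i a.
  by move=> i; have [a] := QE i; exists a.
exists (\big[Order.min/1]_(i < N) f i).
  by apply: lt_bigmin => // i _; exact: (Hf i).1.
move=> i; apply: Qm (Hf i).2; exact: bigmin_le_cond.
Qed.

End forms.

Section state_topology.
Context {R : realType} (n n1 : nat).

Definition state_cover (m : nat) : set (R * @state R n n1) :=
  [set t : R | `|t| <= m%:R] `*`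
   ([set v : 'cV[R]_n1 | forall i, `|v i 0| <= m%:R] `*`
    (([set v : 'cV[R]_n | forall i, `|v i 0| <= m%:R] `*` [set t | `|t| <= m%:R])
      `*` [set t | `|t| <= m%:R])).

Lemma state_cover_compact m : compact (state_cover m).
Proof.
have c1 : compact [set t : R | `|t| <= m%:R].
  rewrite (_ : [set _ | _] = `[(- m%:R), m%:R]%classic); first exact: segment_compact.
  by apply/seteqP; split => t /=; rewrite in_itv/= ler_norml.
do ![apply: compact_setX => //]; exact: cV_box_compact.
Qed.

Lemma cV_coord_le (k : nat) (v : 'cV[R]_k) i : `|v i 0| <= `|v|.
Proof. by rewrite [leRHS]/Num.Def.normr/= mx_normrE; apply/bigmax_geP; right; exists (i, 0). Qed.

Lemma state_coverT p : exists m, state_cover m p.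
Proof.
exists (Num.truncn `|p|).+1.
have H (x : R) : x <= `|p| -> x <= (Num.truncn `|p|).+1%:R.
  by move=> /le_trans; apply; exact/ltW/truncnS_gt.
case: p H => t [x [[xi q] tau]] H.
split => /=; first by apply: H; rewrite prod_normE/= le_max lexx.
split => /=; first by move=> i; apply: H; rewrite !prod_normE/= !le_max cV_coord_le orbT.
split => /=; last by apply: H; rewrite !prod_normE/= !le_max lexx !orbT.
split => /=; last by apply: H; rewrite !prod_normE/= !le_max lexx !orbT.
by move=> i; apply: H; rewrite !prod_normE/= !le_max cV_coord_le !orbT.
Qed.

End state_topology.

(** * Gradients *)

Section gradient.
Context {R : realType}.

Definition dot n (u v : 'cV[R]_n) : R := bform 1%:M u v.

Lemma dotC n (u v : 'cV[R]_n) : dot u v = dot v u.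
Proof. by rewrite /dot bform_tr trmx1. Qed.

Lemma dotE n (u v : 'cV[R]_n) : dot u v = \sum_i u i 0 * v i 0.
Proof. by rewrite /dot /bform mulmx1 mxE; apply: eq_bigr => i _; rewrite mxE. Qed.

Lemma dot_delta n i (v : 'cV[R]_n) : dot (delta_mx i 0) v = v i 0.
Proof.
rewrite dotE (bigD1 i)//= mxE !eqxx mul1r big1 ?addr0// => j ji.
by rewrite mxE (negbTE ji) mul0r.
Qed.

(** Differentiability makes the directional derivatives linear in the direction. *)
Lemma derive_grad n (f : 'cV[R]_n -> R) x v : differentiable f x ->
  'D_v f x = dot v (grad f x).
Proof.
move=> df; rewrite deriveE// dotE.
rewrite {1}(matrix_sum_delta v).
rewrite (eq_bigr (fun i => v i 0 *: delta_mx i 0)); last first.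
  by move=> i _; rewrite big_ord_recl big_ord0 addr0.
rewrite linear_sum; apply: eq_bigr => i _.
by rewrite linearZ/= /grad mxE deriveE.
Qed.

Lemma grad_compose_affine m n (f : 'cV[R]_m -> R) (H : 'M[R]_(m, n)) b x :
  differentiable f (H *m x + b) ->
  grad (fun x => f (H *m x + b)) x = H^T *m grad f (H *m x + b).
Proof.
move=> df; apply/colP => i; rewrite mxE.
transitivity ('D_(H *m delta_mx i 0) f (H *m x + b)).
  rewrite /derive; f_equal; f_equal; apply/funext => h /=.
  by rewrite mulmxDr -scalemxAr addrA.
rewrite derive_grad// /dot bform_mull mulmx1.
by rewrite -[in LHS](mul1mx H^T) -bform_mulr -/(dot _ _) dot_delta.
Qed.

Lemma grad_total_cost n n1 p0 (B : 'M[R]_(n, n1)) (L : 'M[R]_(p0, n)) d phix phiy x :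
  C1fun phix -> C1fun phiy ->
  grad (total_cost B L d phix phiy) x =
  grad phix x + (- (L *m B))^T *m grad phiy (- (L *m B) *m x + d).
Proof.
move=> [dx _] [dy _]; rewrite -grad_compose_affine//.
apply/colP => i; rewrite !mxE.
apply: deriveD; first exact: diff_derivable.
have := @diff_derivable _ _ _ phiy (- (L *m B) *m x + d) (- (L *m B) *m delta_mx i 0) (dy _).
rewrite /derivable; set g1 := fun h => _; set g2 := fun h => _.
suff -> : g1 = g2 by [].
by rewrite /g1 /g2; apply/funext => h /=; rewrite mulmxDr -scalemxAr addrA.
Qed.

(** Only the right derivative matters, which is the limit of quotients at most
    [a + s * b]. *)
Lemma derive_le n (f : 'cV[R]_n -> R) x v (a b : R) : differentiable f x ->
  (forall s, 0 < s -> s < 1 -> f (s *: v + x) - f x <= s * (a + s * b)) ->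
  'D_v f x <= a.
Proof.
move=> df H.
have c1 : h^-1 *: (f (h *: v + x) - f x) @[h --> 0^'+] --> 'D_v f x.
  have : h^-1 *: (f (h *: v + x) - f x) @[h --> 0^'] --> 'D_v f x.
    exact: diff_derivable.
  exact: cvg_dnbhs_at_right.
have c2 : a + h * b @[h --> (0:R)^'+] --> a.
  rewrite -[X in _ --> X]addr0 -[X in a + X](mul0r b).
  apply: cvgD; first exact: cvg_cst.
  by apply: cvgM; [exact: cvg_at_right_filter|exact: cvg_cst].
apply: ler_cvg_to c1 c2 _.
near=> s.
have s0 : 0 < s by near: s; exact: nbhs_right_gt.
have s1 : s < 1 by near: s; exact: nbhs_right_lt.
by rewrite /GRing.scale/= ler_pdivrMl//; exact: H.
Unshelve. all: by end_near. Qed.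

Lemma grad_minimizer n (f : 'cV[R]_n -> R) xs :
  (forall x, differentiable f x) -> minimizer f xs -> grad f xs = 0.
Proof.
move=> df fm.
have H v : 0 <= dot v (grad f xs).
  rewrite -derive_grad// -oppr_le0 -deriveN; last exact: diff_derivable.
  apply: (@derive_le _ _ _ _ 0 0); first exact: differentiableN.
  move=> s s0 s1; rewrite mulr0 addr0 mulr0 /= opprK addrC subr_le0.
  exact: fm.
apply/colP => i; rewrite !mxE; apply/eqP; rewrite eq_le; apply/andP; split.
  have := H (- delta_mx i 0).
  rewrite /dot -scaleN1r bformZl -/(dot _ _) dot_delta mxE mulN1r oppr_ge0.
  exact.
by have := H (delta_mx i 0); rewrite dot_delta mxE.
Qed.

(** Strong convexity on the segment from [x] to the minimizer, divided by its
    parameter [s] and taken as [s] goes to 0; the term in [s] is the [b] of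
    [derive_le]. *)
Lemma strongly_convex_grad n (f : 'cV[R]_n -> R) m xs x : 0 < m ->
  (forall x, differentiable f x) -> strongly_convex m f -> minimizer f xs ->
  m / 2 * sqnorm2 (x - xs) <= dot (x - xs) (grad f x).
Proof.
move=> m0 df cf fm.
have : 'D_(xs - x) f x <= f xs - f x - m / 2 * sqnorm2 (x - xs).
  apply: (@derive_le _ _ _ _ _ (m / 2 * sqnorm2 (x - xs))) => // s s0 s1.
  have -> : s *: (xs - x) + x = s *: xs + (1 - s) *: x.
    by rewrite scalerBr scalerBl scale1r addrAC addrA.
  have s01 : 0 <= s <= 1 by rewrite !ltW.
  have := cf xs x s s01; rewrite -norm2N opprB norm2_sqr; lra.
rewrite derive_grad// -opprB /dot -scaleN1r bformZl -/(dot _ _).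
have := fm x; lra.
Qed.

End gradient.

(** * The Lyapunov function: algebraic estimates *)

Section lyapunov.
Context {R : realType}.

Definition lyapunov n n1 (kap gam : R) (B : 'M[R]_(n, n1)) (P : 'M[R]_n)
    (xs : 'cV[R]_n1) (x : 'cV[R]_n1) (xi : 'cV[R]_n) (tau : R) : R :=
  (1 - kap * tau) * sqnorm2 (x - xs) +
  (1 + gam * tau)^-1 * bform P (xi + B *m x) (xi + B *m x).

(** The derivative of [lyapunov] when [x], [xi] and [tau] move at the rates
    [dx], [dxi] and [dtau]. *)
Definition lyapunov_dot n n1 (kap gam : R) (B : 'M[R]_(n, n1)) (P : 'M[R]_n)
    (xs : 'cV[R]_n1) (x : 'cV[R]_n1) (xi : 'cV[R]_n) (tau : R)
    (dx : 'cV[R]_n1) (dxi : 'cV[R]_n) (dtau : R) : R :=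
  - (kap * dtau) * sqnorm2 (x - xs) +
  (1 - kap * tau) * (2 * dot (x - xs) dx) +
  - (gam * dtau) * (1 + gam * tau)^-1 ^+ 2 * bform P (xi + B *m x) (xi + B *m x) +
  (1 + gam * tau)^-1 * (bform P (dxi + B *m dx) (xi + B *m x) +
     bform P (xi + B *m x) (dxi + B *m dx)).

Lemma young_ineq (m k X Z : R) : 0 < m ->
  m / 8 * X ^+ 2 <= m / 4 * X ^+ 2 - 2 * k * (X * Z) + (8 * k ^+ 2 / m) * Z ^+ 2.
Proof.
move=> m0.
have -> : m / 4 * X ^+ 2 - 2 * k * (X * Z) + (8 * k ^+ 2 / m) * Z ^+ 2 =
   m / 8 * X ^+ 2 + (m / 8) * (X - 8 * k / m * Z) ^+ 2.
  by field; rewrite gt_eqF.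
by rewrite lerDl mulr_ge0 ?sqr_ge0// divr_ge0// ltW.
Qed.

(** Here [X = |xt|] and [Z = |zeta|], [h] and [w] are the two clock weights, [D1] and
    [D2] the derivatives of the unweighted terms and [S] the contribution of the
    growth of [h].  The term [a0 / eps] dominates all cross terms when [eps] is
    small. *)
Lemma rate_estimate (m k1 k2 k3 a0 w0 eps X Z h w D1 D2 S : R) :
  0 < m -> 0 <= k1 -> 0 <= k2 -> 0 <= k3 -> 0 < a0 -> 0 < w0 -> 0 < eps ->
  0 <= X -> 0 <= Z -> 1 / 2 <= h <= 1 -> w0 <= w <= 1 ->
  S <= m / 4 * X ^+ 2 ->
  D1 <= - m / 2 * X ^+ 2 + k1 * (X * Z) ->
  D2 <= - (a0 / eps) * Z ^+ 2 + 2 * (k2 * (X * Z) + k3 * Z ^+ 2) ->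
  2 * k3 + 8 * (k1 + k2) ^+ 2 / m + 1 <= w0 * a0 / eps ->
  S + h * (2 * D1) + w * D2 <= - (m / 8 * X ^+ 2 + Z ^+ 2).
Proof.
move=> m0 k10 k20 k30 a00 w00 e0 X0 Z0 /andP[h1 h2] /andP[w1 w2] HS H1 H2 He.
have XZ0 : 0 <= X * Z by rewrite mulr_ge0.
have X20 : 0 <= X ^+ 2 by rewrite sqr_ge0.
have Z20 : 0 <= Z ^+ 2 by rewrite sqr_ge0.
have h0 : 0 <= h by lra.
have w0' : 0 <= w by lra.
have ae0 : 0 <= a0 / eps by rewrite divr_ge0// ltW.
have E1 : h * (2 * D1) <= - (m / 2) * X ^+ 2 + 2 * k1 * (X * Z).
  have : h * (2 * D1) <= h * (- m * X ^+ 2 + 2 * k1 * (X * Z)).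
    by apply: ler_wpM2l => //; lra.
  move/le_trans; apply.
  have : 0 <= (h - 1 / 2) * (m * X ^+ 2) by do ![apply: mulr_ge0]; rewrite ?subr_ge0// ltW.
  have : 0 <= (1 - h) * (2 * k1 * (X * Z)) by do ![apply: mulr_ge0]; rewrite ?subr_ge0.
  nra.
have E2 : w * D2 <= - (w0 * a0 / eps) * Z ^+ 2 + 2 * (k2 * (X * Z) + k3 * Z ^+ 2).
  apply: le_trans (ler_wpM2l w0' H2) _.
  have : 0 <= (w - w0) * (a0 / eps * Z ^+ 2).
    by apply: mulr_ge0 (mulr_ge0 ae0 Z20); rewrite subr_ge0.
  have : 0 <= (1 - w) * (2 * (k2 * (X * Z) + k3 * Z ^+ 2)).
    have q0 : 0 <= k2 * (X * Z) + k3 * Z ^+ 2 by rewrite addr_ge0// mulr_ge0.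
    by apply: mulr_ge0; [rewrite subr_ge0|rewrite mulr_ge0].
  rewrite (_ : w0 * a0 / eps = w0 * (a0 / eps)) ?mulrA//.
  rewrite -subr_ge0 => p1 p2; move: (addr_ge0 p2 p1); congr (_ <= _).
  by ring.
have E3 := young_ineq (k1 + k2) X Z m0.
have E4 := ler_wpM2r Z20 He.
move: (w0 * a0 / eps) (8 * (k1 + k2) ^+ 2 / m) E2 E3 E4 => q1 q2 E2 E3 E4.
lra.
Qed.

Lemma bform_sym_dot n (P : 'M[R]_n) u v : P^T = P -> bform P u v = bform P v u.
Proof. by move=> sP; rewrite bform_tr sP. Qed.

Section data.
Context (N n n1 p0 : nat) (T eta : R) (T_gt0 : 0 < T) (eta_ge0 : 0 <= eta)
    (A : 'I_N -> 'M[R]_n) (B : 'M[R]_(n, n1))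
    (L : 'M[R]_(p0, n)) (d : 'cV[R]_p0)
    (phix : 'cV[R]_n1 -> R) (phiy : 'cV[R]_p0 -> R)
    (phix_C1 : C1fun phix) (phiy_C1 : C1fun phiy)
    (lam : 'I_N -> {nonneg R})
    (sigma : R) (sigma_gt0 : 0 < sigma)
    (P : 'I_N -> 'M[R]_n) (P_posdef : forall q, posdefmx (P q))
    (flow_lmi : forall q, negdefmx
       ((A q)^T *m P q + P q *m A q + (sigma * eta * T^-1) *: P q))
    (jump_lmi : forall q, negdefmx
       ((sigma^-1 * ln (1 + sigma)) *: (\sum_(i < N) (lam i)%:num *: P i) - P q))
    (m_phi L_phi L_phiy : R)
    (m_phi_gt0 : 0 < m_phi) (L_phi_gt0 : 0 < L_phi) (L_phiy_gt0 : 0 < L_phiy)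
    (phi_smooth : smooth_with L_phi (total_cost B L d phix phiy))
    (phi_convex : strongly_convex m_phi (total_cost B L d phix phiy))
    (phiy_smooth : smooth_with L_phiy phiy)
    (xs : 'cV[R]_n1)
    (xs_min : unique (minimizer (total_cost B L d phix phiy)) xs).

Let gphi := grad (total_cost B L d phix phiy).
Let H := - (L *m B).

Lemma P_bounds : exists2 pm : R, 0 < pm & exists2 pM : R, 0 < pM & forall i v,
  pm * sqnorm2 v <= bform (P i) v v <= pM * sqnorm2 v.
Proof.
have [pm pm0 Hm] : exists2 a : R, 0 < a &
    forall i v, a * sqnorm2 v <= bform (P i) v v.
  apply: finite_uniform_bound => [i a b ab Hb v|i]; last exact: posdef_coercive.
  by apply: le_trans (Hb v); exact: ler_wpM2r (sqnorm2_ge0 v) _ _ ab.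
exists pm => //; exists (1 + \sum_i entry_sum (P i)).
  by rewrite ltr_pwDl// sumr_ge0// => i _; exact: entry_sum_ge0.
move=> i v; rewrite Hm/=.
apply: le_trans (ler_norm _) _; apply: le_trans (bform_le _ _ _) _.
rewrite -expr2 norm2_sqr ler_wpM2r ?sqnorm2_ge0//.
rewrite (bigD1 i)//= addrCA lerDl addr_ge0// sumr_ge0// => j _.
exact: entry_sum_ge0.
Qed.

(** The map [L *m xi + d] differs from [H *m x + d] by [L *m zeta], and [phiy] is
    smooth. *)
Lemma flow_perturbation : exists2 k : R, 0 <= k & forall x xi dx,
  dx = - grad phix x - H^T *m grad phiy (L *m xi + d) ->
  exists2 p, dx = - gphi x - p & norm2 p <= k * norm2 (xi + B *m x).
Proof.
exists (entry_sum H^T * (L_phiy * entry_sum L)).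
  by rewrite !mulr_ge0 ?entry_sum_ge0// ltW.
move=> x xi dx ->.
exists (H^T *m (grad phiy (L *m xi + d) - grad phiy (H *m x + d))).
  by rewrite /gphi grad_total_cost// -/H mulmxBr opprD opprB addrA subrK.
apply: le_trans (norm2_mulmx _ _) _; rewrite -!mulrA.
apply: ler_wpM2l; first exact: entry_sum_ge0.
apply: le_trans (phiy_smooth.2 _ _) _; apply: ler_wpM2l; first exact: ltW.
apply: le_trans (norm2_mulmx _ _); rewrite le_eqVlt; apply/orP; left; apply/eqP.
congr norm2; rewrite /H mulmxDr mulmxA mulNmx opprD opprK addrACA subrr addr0.
by [].
Qed.

Lemma gphi_bound x : norm2 (gphi x) <= L_phi * norm2 (x - xs).
Proof.
have g0 : gphi xs = 0 by apply: grad_minimizer phi_smooth.1 xs_min.1.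
by have := phi_smooth.2 x xs; rewrite -/gphi g0 subr0.
Qed.

Lemma gphi_monotone x : m_phi / 2 * sqnorm2 (x - xs) <= dot (x - xs) (gphi x).
Proof. exact: strongly_convex_grad m_phi_gt0 phi_smooth.1 phi_convex xs_min.1. Qed.

Let gam := sigma / T.

Lemma clock_weight tau : 0 <= tau <= T ->
  (1 + sigma)^-1 <= (1 + gam * tau)^-1 <= 1.
Proof.
move=> /andP[t0 tT].
have g0 : 0 <= gam * tau by rewrite mulr_ge0// divr_ge0// ltW.
have g1 : gam * tau <= sigma.
  by rewrite /gam mulrAC ler_pdivrMr// ler_wpM2l// ltW.
have s1 : 0 < 1 + gam * tau by rewrite ltr_pwDl.
have s2 : 0 < 1 + sigma by rewrite addr_gt0.
apply/andP; split; first by rewrite lef_pV2 ?posrE// lerD2l.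
by rewrite invf_le1// lerDl.
Qed.

Lemma flow_lmi_coercive : exists2 a : R, 0 < a & forall i v,
  bform ((A i)^T *m P i + P i *m A i) v v + gam * eta * bform (P i) v v <=
    - (a * sqnorm2 v).
Proof.
have [a a0 Ha] : exists2 a : R, 0 < a & forall i v,
    bform ((A i)^T *m P i + P i *m A i + (sigma * eta * T^-1) *: P i) v v
      <= - (a * sqnorm2 v).
  apply: finite_uniform_bound => [i a b ab Hb v|i]; last exact: negdef_coercive.
  apply: le_trans (Hb v) _; rewrite lerN2.
  exact: ler_wpM2r (sqnorm2_ge0 v) _ _ ab.
exists a => // i v; apply: le_trans (Ha i v).
by rewrite [leRHS]bformDm bformZm /gam (mulrAC sigma).
Qed.

(** The factor [kap0 = m_phi / (4 * (eta + 1))] keeps the growth rate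
    [kap0 * eta] of the slow weight below [m_phi / 4]. *)
Lemma lyapunov_flow_rate : exists kap0 c eps0 : R,
  [/\ 0 < kap0, 0 < c, 0 < eps0,
    (forall eps, 0 < eps < eps0 -> kap0 * eps * T <= 1 / 2) &
    forall eps i x xi tau dx dxi dtau, 0 < eps < eps0 -> 0 <= tau <= T ->
      dx = - grad phix x - H^T *m grad phiy (L *m xi + d) ->
      eps *: dxi = A i *m (xi + B *m x) ->
      - eta <= eps * dtau <= 0 ->
      lyapunov_dot (kap0 * eps) gam B (P i) xs x xi tau dx dxi dtau <=
        - (c * lyapunov (kap0 * eps) gam B (P i) xs x xi tau)].
Proof.
have [pm pm0 [pM pM0 HP]] := P_bounds.
have [k k0 Hk] := flow_perturbation.
have [a0 a00 Ha] := flow_lmi_coercive.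
pose kap0 := m_phi / (4 * (eta + 1)).
have kap00 : 0 < kap0 by rewrite divr_gt0// mulr_gt0// ltr_wpDl.
pose k1 := entry_sum (1%:M : 'M[R]_n1) * k.
have k10 : 0 <= k1 by rewrite mulr_ge0// entry_sum_ge0.
pose kPB := \sum_i entry_sum (P i *m B).
have kPB0 : 0 <= kPB by rewrite sumr_ge0// => i _; exact: entry_sum_ge0.
pose k2 := kPB * L_phi; pose k3 := kPB * k.
have k20 : 0 <= k2 by rewrite mulr_ge0// ltW.
have k30 : 0 <= k3 by rewrite mulr_ge0.
pose w0 := (1 + sigma)^-1.
have w00 : 0 < w0 by rewrite invr_gt0 addr_gt0.
(* [K] is what the fast rate [w0 * a0 / eps] has to dominate. *)
pose K := 2 * k3 + 8 * (k1 + k2) ^+ 2 / m_phi + 1.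
have K0 : 0 < K.
  have q0 : 0 <= 8 * (k1 + k2) ^+ 2 / m_phi.
    by apply: divr_ge0; [rewrite mulr_ge0 ?sqr_ge0|exact: ltW].
  by rewrite ltr_wpDl// addr_ge0// mulr_ge0.
(* [c] compares [m_phi / 8 * X ^+ 2 + Z ^+ 2] with [X ^+ 2 + pM * Z ^+ 2],
   which bounds the function. *)
pose c := Num.min (m_phi / 8) pM^-1.
have kT0 : 0 < 2 * kap0 * T by apply: mulr_gt0 => //; exact: mulr_gt0.
have HkT eps : eps < (2 * kap0 * T)^-1 -> kap0 * eps * T <= 1 / 2.
  rewrite -(ltr_pM2r kT0) mulVf ?gt_eqF// => h1.
  rewrite (_ : kap0 * eps * T = eps * (2 * kap0 * T) / 2); last by field.
  by rewrite ler_pM2r// ltW.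
exists kap0, c, (Num.min ((2 * kap0 * T)^-1) (w0 * a0 / K)).
split => //.
- by rewrite lt_min divr_gt0// invr_gt0.
- rewrite lt_min; apply/andP; split.
    by rewrite invr_gt0.
  by rewrite divr_gt0// mulr_gt0.
- by move=> eps /andP[e0]; rewrite lt_min => /andP[e1 _]; exact: HkT.
move=> eps i x xi tau dx dxi dtau /andP[e0]; rewrite lt_min => /andP[e1 e2].
move=> tauT dxE dxiE /andP[dt1 dt2].
have /andP[tau0 tau1] := tauT.
have kT := HkT _ e1.
set zeta := xi + B *m x.
set X := norm2 (x - xs); set Z := norm2 zeta.
have X0 : 0 <= X by exact: norm2_ge0.
have Z0 : 0 <= Z by exact: norm2_ge0.
have XE : X ^+ 2 = sqnorm2 (x - xs) by exact: norm2_sqr.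
have ZE : Z ^+ 2 = sqnorm2 zeta by exact: norm2_sqr.
set w := (1 + gam * tau)^-1.
have /andP[w1 w2] : w0 <= w <= 1 by exact: clock_weight.
have w_ge0 : 0 <= w by exact: le_trans (ltW w00) w1.
set h := 1 - kap0 * eps * tau.
have ke0 : 0 <= kap0 * eps by rewrite mulr_ge0 ?ltW.
have h12 : 1 / 2 <= h <= 1.
  have := ler_wpM2l ke0 tau1; have := mulr_ge0 ke0 tau0; rewrite /h.
  by move=> q1 q2; apply/andP; split; lra.
have [p dxp pk] := Hk _ _ _ dxE.
set bP := bform (P i) zeta zeta.
have /andP[bP1 bP2] := HP i zeta; rewrite -/bP -ZE in bP1 bP2.
have bP0 : 0 <= bP by apply: le_trans bP1; rewrite mulr_ge0 ?sqr_ge0// ltW.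
have gam0 : 0 <= gam by rewrite divr_ge0// ltW.
(* The gradient is strongly monotone, up to the perturbation [p]. *)
have HD1 : dot (x - xs) dx <= - m_phi / 2 * X ^+ 2 + k1 * (X * Z).
  rewrite dxp {1}/dot bformDr !bformNr -!/(dot _ _).
  have m1 := gphi_monotone x; rewrite -XE in m1.
  have m2 := bform_le 1%:M (x - xs) p; rewrite -/(dot _ _) -/X in m2.
  have m3 : entry_sum (1%:M : 'M[R]_n1) * (X * norm2 p) <= k1 * (X * Z).
    rewrite /k1 -!mulrA ler_wpM2l ?entry_sum_ge0// mulrCA.
    by rewrite ler_wpM2l.
  have := ler_norm (- dot (x - xs) p); rewrite normrN.
  lra.
(* The stable terms are of order [1 / eps], the cross term with [dx] of order 1. *)
have dxiE' : dxi = eps^-1 *: (A i *m zeta).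
  by rewrite -dxiE scalerA mulVf ?scale1r// gt_eqF.
have sP : (P i)^T = P i by case: (P_posdef i).
pose D2 := - (gam * dtau) * w * bP +
  (bform (P i) (dxi + B *m dx) zeta + bform (P i) zeta (dxi + B *m dx)).
have bxE : `|bform (P i) zeta (B *m dx)| <= k2 * (X * Z) + k3 * Z ^+ 2.
  rewrite bform_mulr dxp bformDr !bformNr -opprD normrN.
  apply: le_trans (ler_normD _ _) _.
  have PBi : entry_sum (P i *m B) <= kPB.
    rewrite /kPB (bigD1 i)//= lerDl sumr_ge0// => j _; exact: entry_sum_ge0.
  have b1 := le_trans (bform_le (P i *m B) zeta (gphi x)) (ler_pM (entry_sum_ge0 _)
     (mulr_ge0 Z0 (norm2_ge0 _)) PBi (ler_wpM2l Z0 (gphi_bound x))).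
  have b2 := le_trans (bform_le (P i *m B) zeta p) (ler_pM (entry_sum_ge0 _)
     (mulr_ge0 Z0 (norm2_ge0 _)) PBi (ler_wpM2l Z0 pk)).
  rewrite -/X -/zeta -/Z in b1 b2.
  have -> : k2 * (X * Z) = kPB * (Z * (L_phi * X)) by rewrite /k2; ring.
  have -> : k3 * Z ^+ 2 = kPB * (Z * (k * Z)) by rewrite /k3; ring.
  exact: lerD b1 b2.
have HD2 : D2 <= - (a0 / eps) * Z ^+ 2 + 2 * (k2 * (X * Z) + k3 * Z ^+ 2).
  rewrite /D2 (bform_sym_dot (dxi + _) _ sP) bformDr.
  have -> : bform (P i) zeta dxi = eps^-1 / 2 *
      bform ((A i)^T *m P i + P i *m A i) zeta zeta.
    rewrite dxiE' bformZr bformDm -bform_mull -bform_mulr.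
    by rewrite (bform_sym_dot (A i *m _) _ sP); field; rewrite gt_eqF.
  have g1 : - (gam * dtau) * w * bP <= gam * (eta / eps) * bP.
    rewrite ler_wpM2r// -mulrN -mulrA ler_wpM2l//.
    have dt0 : 0 <= - dtau.
      by rewrite oppr_ge0 -(pmulr_rle0 _ e0).
    have dte : - dtau <= eta / eps by rewrite ler_pdivlMr//; lra.
    by apply: le_trans dte; rewrite ler_piMr.
  have g2 := ler_wpM2l (ltW (ltac:(by rewrite invr_gt0) : 0 < eps^-1)) (Ha i zeta).
  rewrite -/bP -ZE in g2.
  have := ler_norm (bform (P i) zeta (B *m dx)).
  move: g1 g2; rewrite (_ : gam * (eta / eps) * bP = eps^-1 * (gam * eta * bP)); last by ring.
  rewrite (_ : - (a0 / eps) * Z ^+ 2 = eps^-1 * - (a0 * Z ^+ 2)); last by ring.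
  rewrite mulrDr; move: (eps^-1 * - _) (eps^-1 * (_ * bP)) => u1 u2.
  lra.
have HS : - (kap0 * eps * dtau) * sqnorm2 (x - xs) <= m_phi / 4 * X ^+ 2.
  rewrite -XE ler_wpM2r ?sqr_ge0//.
  apply: (@le_trans _ _ (kap0 * eta)).
    by rewrite -mulrA -mulrN; apply: ler_wpM2l; [exact: ltW|lra].
  rewrite /kap0 mulrAC ler_pdivrMr ?mulr_gt0 ?ltr_wpDl//.
  rewrite (_ : m_phi / 4 * (4 * (eta + 1)) = m_phi * eta + m_phi); last by field.
  by rewrite lerDl ltW.
have He : 2 * k3 + 8 * (k1 + k2) ^+ 2 / m_phi + 1 <= w0 * a0 / eps.
  rewrite -/K ler_pdivlMr// mulrC -ler_pdivlMr//; exact: ltW.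
have w12 : w0 <= w <= 1 by rewrite w1.
have := rate_estimate m_phi_gt0 k10 k20 k30 a00 w00 e0 X0 Z0 h12 w12 HS HD1 HD2 He.
have -> : lyapunov_dot (kap0 * eps) gam B (P i) xs x xi tau dx dxi dtau =
  - (kap0 * eps * dtau) * sqnorm2 (x - xs) + h * (2 * dot (x - xs) dx) + w * D2.
  by rewrite /lyapunov_dot -/zeta -/w -/h -/bP /D2; ring.
move/le_trans; apply; rewrite lerN2 /lyapunov -/h -/w -/zeta -/bP -XE.
have c1 : c <= m_phi / 8 by rewrite ge_min lexx.
have c2 : c <= pM^-1 by rewrite ge_min lexx orbT.
have c0 : 0 <= c by rewrite le_min divr_ge0 ?invr_ge0 ?ltW.
rewrite mulrDr; apply: lerD.
  apply: ler_pM => //; first by rewrite mulr_ge0 ?sqr_ge0//; case/andP: h12; lra.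
  by rewrite ler_piMl ?sqr_ge0//; case/andP: h12.
apply: le_trans (_ : pM^-1 * (1 * (pM * Z ^+ 2)) <= _).
  by apply: ler_pM => //; [rewrite mulr_ge0|rewrite ler_pM].
by rewrite mul1r mulKf// gt_eqF.
Qed.

Lemma jump_lmi_coercive : exists2 a : R, 0 < a & forall i v,
  sigma^-1 * ln (1 + sigma) * (\sum_q (lam q)%:num * bform (P q) v v) <=
    bform (P i) v v - a * sqnorm2 v.
Proof.
have [a a0 Ha] : exists2 a : R, 0 < a & forall i v,
    bform ((sigma^-1 * ln (1 + sigma)) *: (\sum_(i < N) (lam i)%:num *: P i) - P i) v v
      <= - (a * sqnorm2 v).
  apply: finite_uniform_bound => [i a b ab Hb v|i]; last exact: negdef_coercive.
  apply: le_trans (Hb v) _; rewrite lerN2.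
  exact: ler_wpM2r (sqnorm2_ge0 v) _ _ ab.
exists a => // i v; have := Ha i v.
rewrite bformDm -scaleN1r !bformZm bform_summ.
under eq_bigr do rewrite bformZm.
lra.
Qed.

(** A jump occurs at [tau = 0], where both clock weights are 1; the left side is the
    mean of the function after the jump. *)
Lemma lyapunov_jump_rate (kap : R) : 0 < kap ->
  exists2 rho : R, 0 < rho < 1 & forall i x xi,
    (1 - kap * T / 2) * sqnorm2 (x - xs) +
    sigma^-1 * ln (1 + sigma) *
      (\sum_q (lam q)%:num * bform (P q) (xi + B *m x) (xi + B *m x)) <=
    rho * lyapunov kap gam B (P i) xs x xi 0.
Proof.
move=> kap0.
have [pm pm0 [pM pM0 HP]] := P_bounds.
have [a a0 Ha] := jump_lmi_coercive.
pose rho := Num.max (1 / 2) (Num.max (1 - kap * T / 2) (1 - a / pM)).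
exists rho.
  rewrite lt_max divr_gt0//=; rewrite !gt_max; apply/and3P; split.
  - lra.
  - by rewrite ltrBlDr ltrDl divr_gt0// mulr_gt0.
  - by rewrite ltrBlDr ltrDl divr_gt0.
move=> i x xi; rewrite /lyapunov !mulr0 subr0 addr0 invr1 !mul1r mulrDr.
have r1 : 1 - kap * T / 2 <= rho by rewrite !le_max lexx orbT.
have r2 : 1 - a / pM <= rho by rewrite !le_max lexx !orbT.
apply: lerD; first by rewrite ler_wpM2r ?sqnorm2_ge0.
apply: le_trans (Ha i _) _.
set bP := bform _ _ _.
have /andP[bP1 bP2] := HP i (xi + B *m x); rewrite -/bP in bP1 bP2.
have bP0 : 0 <= bP by apply: le_trans bP1; rewrite mulr_ge0 ?sqnorm2_ge0// ltW.
apply: le_trans (ler_wpM2r bP0 r2).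
rewrite mulrBl mul1r lerD2l lerN2 mulrAC ler_pdivrMr// -mulrA ler_pM2l//.
by rewrite mulrC.
Qed.

(** The quantity [xi + B *m xs] is [zeta - B *m (x - xs)], so that the squared norms
    of [(x - xs, zeta)] and of [(x - xs, xi + B *m xs)] are comparable. *)
Lemma lyapunov_bounds (kap : R) : 0 <= kap -> kap * T <= 1 / 2 ->
  exists al be : R, [/\ 0 < al, 0 < be & forall i x xi tau, 0 <= tau <= T ->
    al * (sqnorm2 (x - xs) + sqnorm2 (xi + B *m xs)) <=
      lyapunov kap gam B (P i) xs x xi tau <=
    be * (sqnorm2 (x - xs) + sqnorm2 (xi + B *m xs))].
Proof.
move=> kap0 kT.
have [pm pm0 [pM pM0 HP]] := P_bounds.
pose b := entry_sum B.
pose w0 := (1 + sigma)^-1.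
have w00 : 0 < w0 by rewrite invr_gt0 addr_gt0.
have b20 : 0 <= b ^+ 2 by exact: sqr_ge0.
have b1 : 0 < 1 + 2 * b ^+ 2 by rewrite ltr_pwDl// mulr_ge0.
pose al := Num.min (1 / 2 / (1 + 2 * b ^+ 2)) (w0 * pm / 2).
exists al, (1 + 2 * pM * (1 + b ^+ 2)).
have al0 : 0 < al by rewrite lt_min !divr_gt0 ?mulr_gt0.
split => //.
  by rewrite addr_gt0// !mulr_gt0// ltr_pwDl.
move=> i x xi tau tauT; have /andP[tau0 tau1] := tauT.
have /andP[w1 w2] := clock_weight tauT.
rewrite /lyapunov; set w := (1 + gam * tau)^-1 in w1 w2 *.
set zeta := xi + B *m x; set X2 := sqnorm2 (x - xs); set U := sqnorm2 (xi + _).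
have X20 : 0 <= X2 by exact: sqnorm2_ge0.
have U0 : 0 <= U by exact: sqnorm2_ge0.
have Z0 : 0 <= sqnorm2 zeta by exact: sqnorm2_ge0.
have h1 : 1 / 2 <= 1 - kap * tau by have := ler_wpM2l kap0 tau1; lra.
have h2 : 1 - kap * tau <= 1 by have := mulr_ge0 kap0 tau0; lra.
have /andP[bP1 bP2] := HP i zeta.
set bP := bform _ _ _ in bP1 bP2 *.
have bP0 : 0 <= bP by apply: le_trans bP1; rewrite mulr_ge0// ltW.
have Bx : sqnorm2 (B *m (x - xs)) <= b ^+ 2 * X2.
  rewrite /X2 -!norm2_sqr -exprMn ler_sqr ?nnegrE ?norm2_ge0//.
    exact: norm2_mulmx.
  by rewrite mulr_ge0 ?norm2_ge0 ?entry_sum_ge0.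
have BxN : sqnorm2 (- (B *m (x - xs))) <= b ^+ 2 * X2.
  by rewrite -norm2_sqr norm2N norm2_sqr.
have Zb : sqnorm2 zeta <= 2 * U + 2 * (b ^+ 2 * X2).
  have -> : zeta = (xi + B *m xs) + B *m (x - xs).
    by rewrite mulmxBr -addrA; congr (_ + _); rewrite addrC subrK.
  by apply: le_trans (sqnorm2D _ _) _; rewrite lerD2l ler_pM2l.
have Ub : U <= 2 * sqnorm2 zeta + 2 * (b ^+ 2 * X2).
  have {1}-> : U = sqnorm2 (zeta + - (B *m (x - xs))).
    by congr sqnorm2; rewrite mulmxBr opprB -addrA; congr (_ + _); rewrite addrC subrK.
  by apply: le_trans (sqnorm2D _ _) _; rewrite lerD2l ler_pM2l.
have a1 : al * (1 + 2 * b ^+ 2) <= 1 / 2.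
  by rewrite -ler_pdivlMr// ge_min lexx.
have a2 : al * 2 <= w0 * pm by rewrite -ler_pdivlMr// ge_min lexx orbT.
apply/andP; split.
  apply: (@le_trans _ _ ((1 / 2) * X2 + w0 * (pm * sqnorm2 zeta))); last first.
    apply: lerD; first exact: ler_wpM2r.
    by apply: ler_pM; [exact: ltW|exact: mulr_ge0 (ltW pm0) Z0|exact: w1|exact: bP1].
  apply: (@le_trans _ _ (al * (1 + 2 * b ^+ 2) * X2 + al * 2 * sqnorm2 zeta)).
    by have := ler_wpM2l (ltW al0) Ub; lra.
  by apply: lerD; [|rewrite (mulrA w0)]; exact: ler_wpM2r.
apply: (@le_trans _ _ (X2 + pM * sqnorm2 zeta)).
  apply: lerD; first by rewrite ler_piMl.
  apply: le_trans bP2; rewrite ler_piMl//.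
have := ler_wpM2l (ltW pM0) Zb.
have := mulr_ge0 (ltW pM0) X20.
have := mulr_ge0 (ltW pM0) (mulr_ge0 b20 U0).
lra.
Qed.

End data.
End lyapunov.

(** * The Lyapunov function along flows *)

Section calculus.
Context {R : realType}.
Implicit Types (f g : R -> R) (t : R).

Lemma is_derive1D f g t a b : is_derive t 1 f a -> is_derive t 1 g b ->
  is_derive t 1 (fun s => f s + g s) (a + b).
Proof. exact: is_deriveD. Qed.

Lemma is_derive1M f g t a b : is_derive t 1 f a -> is_derive t 1 g b ->
  is_derive t 1 (fun s => f s * g s) (a * g t + f t * b).
Proof.
move=> df dg; have h := is_deriveM df dg.
by apply: (is_derive_eq h); rewrite /GRing.scale/= addrC mulrC.
Qed.

Lemma is_derive1_sum (n : nat) (f : 'I_n -> R -> R) t (a : 'I_n -> R) :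
  (forall i, is_derive t 1 (f i) (a i)) ->
  is_derive t 1 (fun s => \sum_i f i s) (\sum_i a i).
Proof.
move=> df; have := is_derive_sum df; congr (is_derive _ _ _ _).
by apply/funext => s; rewrite fct_sumE.
Qed.

Lemma is_derive1_cst t (c : R) : is_derive t 1 (fun=> c) 0.
Proof. exact: is_derive_cst. Qed.

Lemma is_derive1_inv f t a : f t != 0 -> is_derive t 1 f a ->
  is_derive t 1 (fun s => (f s)^-1) (- a * (f t)^-1 ^+ 2).
Proof.
move=> f0 df; have h := is_deriveV f0 df.
by apply: (is_derive_eq h); rewrite /GRing.scale/= exprVn mulrC mulrN mulNr.
Qed.

Lemma is_derive1_linear (S : normedModType R) (l : S -> R) (y : R -> S) t :
  (forall a u v, l (a *: u + v) = a * l u + l v) -> continuous l ->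
  derivable y t 1 -> is_derive t 1 (fun s => l (y s)) (l (derive1 y t)).
Proof.
move=> lin cl dy.
have lB u v : l (u - v) = l u - l v.
  by rewrite -[u - v]addrC -scaleN1r lin mulN1r addrC.
have l0 : l 0 = 0 by rewrite -(subrr 0) lB subrr.
have lZ a u : l (a *: u) = a * l u by rewrite -[a *: u]addr0 lin l0 addr0.
have cv : (h^-1 *: (l (y (h *: (1 : R) + t)) - l (y t)) @[h --> 0^']) --> l (derive1 y t).
  rewrite (_ : (fun h => _) = l \o (fun h => h^-1 *: (y (h *: (1 : R) + t) - y t))).
    have c1 : (h^-1 *: (y (h *: (1 : R) + t) - y t) @[h --> 0^']) --> derive1 y t.
      by rewrite derive1E; exact: dy.
    exact: (cvg_comp _ _ c1 (cl _)).
  by apply/funext => h /=; rewrite lZ lB.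
apply: DeriveDef; first by apply/cvg_ex; exists (l (derive1 y t)).
exact: cvg_lim cv.
Qed.

(** Vector functions are handled through their coordinates, so that everything
    reduces to sums and products of real functions. *)
Definition is_derive_cV n (u : R -> 'cV[R]_n) t (du : 'cV[R]_n) :=
  forall k, is_derive t 1 (fun s => u s k 0) (du k 0).

Definition abs_continuous_cV n a b (u : R -> 'cV[R]_n) :=
  forall k, @abs_continuous R R^o a b (fun s => u s k 0).

Lemma is_derive_bform m n (M : 'M[R]_(m, n)) u v t du dv :
  is_derive_cV u t du -> is_derive_cV v t dv ->
  is_derive t 1 (fun s => bform M (u s) (v s)) (bform M du (v t) + bform M (u t) dv).
Proof.
move=> hu hv.
rewrite (_ : (fun s => _) = (fun s => \sum_i \sum_j u s i 0 * M i j * v s j 0)); last first.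
  by apply/funext => s; rewrite bformE.
rewrite !bformE -big_split/=; apply: is_derive1_sum => i.
rewrite -big_split/=; apply: is_derive1_sum => j.
have h1 := is_derive1M (is_derive1M (hu i) (is_derive1_cst t (M i j))) (hv j).
by apply: is_derive_eq h1 _; rewrite mulr0 addr0.
Qed.

Lemma abs_continuous_bform m n (M : 'M[R]_(m, n)) a b u v :
  abs_continuous_cV a b u -> abs_continuous_cV a b v ->
  @abs_continuous R R^o a b (fun s => bform M (u s) (v s)).
Proof.
move=> hu hv.
rewrite (_ : (fun s => _) = (fun s => \sum_i \sum_j u s i 0 * M i j * v s j 0)); last first.
  by apply/funext => s; rewrite bformE.
apply: abs_continuous_sum => i; apply: abs_continuous_sum => j.
apply: abs_continuousM (hv j); apply: abs_continuousM (hu i) _.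
exact: abs_continuous_cst.
Qed.

Lemma is_derive_cVD n (u v : R -> 'cV[R]_n) t du dv :
  is_derive_cV u t du -> is_derive_cV v t dv ->
  is_derive_cV (fun s => u s + v s) t (du + dv).
Proof.
move=> hu hv k; have := is_derive1D (hu k) (hv k).
rewrite mxE; congr (is_derive _ _ _ _); apply/funext => s; by rewrite mxE.
Qed.

Lemma abs_continuous_cVD n (u v : R -> 'cV[R]_n) a b :
  abs_continuous_cV a b u -> abs_continuous_cV a b v ->
  abs_continuous_cV a b (fun s => u s + v s).
Proof.
move=> hu hv k; have := abs_continuousD (hu k) (hv k).
congr (abs_continuous _ _ _); apply/funext => s; by rewrite mxE.
Qed.

Lemma is_derive_cVM m n (M : 'M[R]_(m, n)) u t du :
  is_derive_cV u t du -> is_derive_cV (fun s => M *m u s) t (M *m du).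
Proof.
move=> hu k; rewrite mxE.
rewrite (_ : (fun s => _) = (fun s => \sum_j M k j * u s j 0)); last first.
  by apply/funext => s; rewrite mxE.
apply: is_derive1_sum => j.
apply: is_derive_eq (is_derive1M (is_derive1_cst t (M k j)) (hu j)) _.
by rewrite mul0r add0r.
Qed.

Lemma abs_continuous_cVM m n (M : 'M[R]_(m, n)) u a b :
  abs_continuous_cV a b u -> abs_continuous_cV a b (fun s => M *m u s).
Proof.
move=> hu k.
rewrite (_ : (fun s => _) = (fun s => \sum_j M k j * u s j 0)); last first.
  by apply/funext => s; rewrite mxE.
apply: abs_continuous_sum => j; apply: abs_continuousM (hu j).
exact: abs_continuous_cst.
Qed.

Lemma is_derive_cV_cst n (c : 'cV[R]_n) t : is_derive_cV (fun=> c) t 0.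
Proof. by move=> k; rewrite mxE; exact: is_derive1_cst. Qed.

Lemma abs_continuous_cV_cst n (c : 'cV[R]_n) a b : abs_continuous_cV a b (fun=> c).
Proof. by move=> k; exact: abs_continuous_cst. Qed.

(** The exponential is Lipschitz on a bounded interval, by its tangent line
    inequality. *)
Lemma abs_continuous_expR (c a b : R) : 0 <= c ->
  @abs_continuous R R^o a b (fun t => expR (c * t)).
Proof.
move=> c0.
have step u v : u <= v -> v <= b ->
    `|expR (c * v) - expR (c * u)| <= expR (c * b) * c * `|v - u|.
  move=> uv vb; rewrite !ger0_norm ?subr_ge0//; last first.
    by rewrite ler_expR ler_wpM2l.
  have -> : c * u = c * v + c * (u - v) by ring.
  rewrite expRD -[X in X - _]mulr1 -mulrBr.
  apply: (@le_trans _ _ (expR (c * v) * (c * (v - u)))).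
    rewrite ler_wpM2l ?expR_ge0//.
    have := expR_ge1Dx (c * (u - v)); lra.
  rewrite -mulrA ler_wpM2r ?mulr_ge0 ?subr_ge0// ler_expR ler_wpM2l//.
apply: (@abs_continuous_lipschitz _ R^o R^o a b (expR (c * b) * c) id).
  move=> u v /andP[_ ub] /andP[_ vb]; have [uv|/ltW vu] := leP u v.
    exact: step.
  by rewrite [in leLHS]distrC [in leRHS]distrC; exact: step.
move=> e e0; exists e => // s sab _; apply: le_lt_trans.
rewrite big_seq [leRHS]big_seq; apply: ler_sum => p ps.
by have /allP/(_ _ ps)/andP[/andP[_ p2] _] := sab; rewrite ger0_norm// subr_ge0.
Qed.

Lemma negligible_itv (p q : R) (N : set (measurableTypeR R)) :
  p < q -> (@lebesgue_measure R).-negligible N -> exists2 t, p < t < q & ~ N t.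
Proof.
move=> pq [M [mM M0 NM]].
apply: contrapT => H.
have : (lebesgue_measure (`]p, q[%classic : set R) <= lebesgue_measure M)%E.
  apply: le_measure; rewrite ?inE// => t /=; rewrite in_itv/= => ptq.
  by apply: NM; apply: contrapT => Nt; apply: H; exists t.
rewrite lebesgue_measure_itv/= lte_fin pq.
move=> h; have {h} : ((q - p)%:E <= 0)%E by rewrite -M0 EFinB.
by rewrite lee_fin subr_le0 leNgt pq.
Qed.

Lemma lebesgue_aeS (Q1 Q2 : R -> Prop) : (forall t, Q1 t -> Q2 t) ->
  {ae (@lebesgue_measure R), forall t : R, Q1 t} ->
  {ae (@lebesgue_measure R), forall t : R, Q2 t}.
Proof.
move=> Q12; apply: negligibleS => t /=; apply: contra_not; exact: Q12.
Qed.

End calculus.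

Section state_components.
Context {R : realType} (n n1 : nat).
Notation st := (@state R n n1).

Definition st_x (y : st) : 'cV[R]_n1 := y.1.
Definition st_xi (y : st) : 'cV[R]_n := y.2.1.1.
Definition st_q (y : st) : R := y.2.1.2.
Definition st_tau (y : st) : R := y.2.2.

Lemma st_x_continuous : continuous st_x.
Proof. by move=> y; exact: cvg_fst. Qed.

Lemma st_tau_continuous : continuous st_tau.
Proof. by move=> y; apply: (cvg_comp snd snd); exact: cvg_snd. Qed.

Lemma st_xiq_continuous : continuous (fun y : st => y.2.1).
Proof.
by move=> y; apply: (cvg_comp snd fst); [exact: cvg_snd|exact: cvg_fst].
Qed.

Lemma st_q_continuous : continuous st_q.
Proof. by move=> y; exact: (cvg_comp _ _ (@st_xiq_continuous y) cvg_snd). Qed.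

Lemma st_xi_continuous : continuous st_xi.
Proof. by move=> y; exact: (cvg_comp _ _ (@st_xiq_continuous y) cvg_fst). Qed.

Variables (y : R -> st) (a b : R).
Hypothesis acy : abs_continuous a b y.

Lemma abs_continuous_st_x : abs_continuous_cV a b (st_x \o y).
Proof.
move=> k; apply: (abs_continuous_lipschitz (M := 1) _ acy) => u v _ _.
have -> : st_x (y v) k 0 - st_x (y u) k 0 = (y v - y u).1 k 0 by rewrite !mxE.
by rewrite mul1r prod_normE/= le_max cV_coord_le.
Qed.

Lemma abs_continuous_st_xi : abs_continuous_cV a b (st_xi \o y).
Proof.
move=> k; apply: (abs_continuous_lipschitz (M := 1) _ acy) => u v _ _.
have -> : st_xi (y v) k 0 - st_xi (y u) k 0 = (y v - y u).2.1.1 k 0 by rewrite !mxE.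
by rewrite mul1r !prod_normE/= !le_max cV_coord_le !orbT.
Qed.

Lemma abs_continuous_st_q : @abs_continuous R R^o a b (st_q \o y).
Proof.
apply: (abs_continuous_lipschitz (M := 1) _ acy) => u v _ _.
by rewrite mul1r !prod_normE/= !le_max lexx !orbT.
Qed.

Lemma abs_continuous_st_tau : @abs_continuous R R^o a b (st_tau \o y).
Proof.
apply: (abs_continuous_lipschitz (M := 1) _ acy) => u v _ _.
by rewrite mul1r !prod_normE/= !le_max lexx !orbT.
Qed.

Variable t : R.
Hypothesis dy : derivable y t 1.

Lemma is_derive_st_x : is_derive_cV (st_x \o y) t (st_x (derive1 y t)).
Proof.
move=> k; apply: (@is_derive1_linear R st (fun s => st_x s k 0) y t) => //.
  by move=> e u v; rewrite !mxE.
move=> s; exact: (cvg_comp _ _ (@st_x_continuous s) (@coord_continuous _ _ _ k 0 _)).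
Qed.

Lemma is_derive_st_xi : is_derive_cV (st_xi \o y) t (st_xi (derive1 y t)).
Proof.
move=> k; apply: (@is_derive1_linear R st (fun s => st_xi s k 0) y t) => //.
  by move=> e u v; rewrite !mxE.
move=> s; exact: (cvg_comp _ _ (@st_xi_continuous s) (@coord_continuous _ _ _ k 0 _)).
Qed.

Lemma is_derive_st_q : is_derive t 1 (st_q \o y) (st_q (derive1 y t)).
Proof. by apply: (@is_derive1_linear R st st_q) => //; exact: st_q_continuous. Qed.

Lemma is_derive_st_tau : is_derive t 1 (st_tau \o y) (st_tau (derive1 y t)).
Proof. by apply: (@is_derive1_linear R st st_tau) => //; exact: st_tau_continuous. Qed.

End state_components.
Arguments st_x {R n n1} y.
Arguments st_xi {R n n1} y.
Arguments st_q {R n n1} y.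
Arguments st_tau {R n n1} y.

Section flow.
Context {R : realType} (N n n1 p0 : nat) (T eta : R) (T_gt0 : 0 < T)
    (A : 'I_N -> 'M[R]_n) (B : 'M[R]_(n, n1))
    (L : 'M[R]_(p0, n)) (d : 'cV[R]_p0)
    (phix : 'cV[R]_n1 -> R) (phiy : 'cV[R]_p0 -> R) (lam : 'I_N -> {nonneg R})
    (P : 'I_N -> 'M[R]_n) (xs : 'cV[R]_n1) (kap gam c eps : R).
Hypotheses (gam_ge0 : 0 <= gam) (eps_gt0 : 0 < eps) (c_ge0 : 0 <= c).
Hypothesis rate : forall i x xi tau dx dxi dtau, 0 <= tau <= T ->
      dx = - grad phix x - (- (L *m B))^T *m grad phiy (L *m xi + d) ->
      eps *: dxi = A i *m (xi + B *m x) ->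
      - eta <= eps * dtau <= 0 ->
      lyapunov_dot kap gam B (P i) xs x xi tau dx dxi dtau <=
        - (c * lyapunov kap gam B (P i) xs x xi tau).
Let sys := switched_gradient_flow eta T_gt0 A B L d phix phiy lam eps.

Definition lyap_st i (y : @state R n n1) :=
  lyapunov kap gam B (P i) xs (st_x y) (st_xi y) (st_tau y).

Lemma flow_setP (y : @state R n n1) : flow_set sys y ->
  modes N (st_q y) /\ 0 <= st_tau y <= T.
Proof. by case: y => x [[xi q] tau]. Qed.

Lemma flow_mapP (y dy : @state R n n1) : flow_map sys y dy ->
  [/\ st_x dy = - grad phix (st_x y) - (- (L *m B))^T *m grad phiy (L *m st_xi y + d),
     exists2 i : 'I_N, st_q y = mode i & eps *: st_xi dy = A i *m (st_xi y + B *m st_x y),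
     st_q dy = 0 & - eta <= eps * st_tau dy <= 0].
Proof.
case: y => x [[xi q] tau]; case: dy => dx [[dxi dq] dtau] /= [-> H2 H3 H4].
split => //; apply/eqP; move/eqP: H3; rewrite mulf_eq0 gt_eqF//=.
Qed.

Lemma mode_inj : injective (@mode R N).
Proof.
move=> i j; rewrite /mode => /eqP; rewrite eqr_nat eqSS => /eqP ij; exact: val_inj.
Qed.

Variables (y : R -> @state R n n1) (a b : R) (i : 'I_N).
Hypotheses (ab : a <= b) (acy : abs_continuous a b y).
Hypothesis aey : {ae (@lebesgue_measure R), forall t : R, a <= t <= b ->
      [/\ flow_set sys (y t), derivable y t 1 & flow_map sys (y t) (derive1 y t)]}.
Hypotheses (ya : st_q (y a) = mode i) (taua : 0 <= st_tau (y a) <= T).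

Lemma flow_q t : a <= t <= b -> st_q (y t) = mode i.
Proof.
move=> /andP[at_ tb]; rewrite -ya; apply/le_anti/andP; split.
  apply: (@abs_continuous_nonincr R (st_q \o y) a t at_).
    exact: abs_continuous_sub (lexx a) tb (abs_continuous_st_q acy).
  apply: lebesgue_aeS aey => s H /andP[s1 s2].
  have [|_ dys /flow_mapP[_ _ dq _]] := H; first by rewrite s1 (le_trans s2).
  have h := is_derive_st_q dys.
  by split; [exact: ex_derive|rewrite derive1E derive_val dq].
rewrite -lerN2; apply: (@abs_continuous_nonincr R (fun t => - st_q (y t)) a t at_).
  apply: (abs_continuous_lipschitz (M := 1) _ (abs_continuous_sub (lexx a) tb (abs_continuous_st_q acy))).
  by move=> u v _ _; rewrite /= -opprD normrN mul1r.
apply: lebesgue_aeS aey => s H /andP[s1 s2].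
have [|_ dys /flow_mapP[_ _ dq _]] := H; first by rewrite s1 (le_trans s2).
have h := is_deriveN (is_derive_st_q dys).
have -> : (fun t => - st_q (y t)) = - (st_q \o y) by [].
by split; [exact: ex_derive|rewrite derive1E derive_val dq oppr0].
Qed.

(** The clock does not increase, which gives the upper bound.  It is nonnegative at
    almost every time; a negative value would persist on an interval, by
    continuity. *)
Lemma flow_tau t : a <= t <= b -> 0 <= st_tau (y t) <= T.
Proof.
move=> /andP[at_ tb]; apply/andP; split; last first.
  case/andP: taua => _; apply: le_trans.
  apply: (@abs_continuous_nonincr R (st_tau \o y) a t at_).
    exact: abs_continuous_sub (lexx a) tb (abs_continuous_st_tau acy).
  apply: lebesgue_aeS aey => s H /andP[s1 s2].
  have [|_ dys /flow_mapP[_ _ _ /andP[_ dt]]] := H; first by rewrite s1 (le_trans s2).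
  have h := is_derive_st_tau dys.
  split; first exact: ex_derive.
  by rewrite derive1E derive_val -(pmulr_rle0 _ eps_gt0).
rewrite leNgt; apply/negP => tt.
have at' : a < t.
  rewrite lt_neqAle at_ andbT; apply: contraTneq tt => <-.
  by rewrite -leNgt; case/andP: taua.
have e0 : 0 < - st_tau (y t) by rewrite oppr_gt0.
have [r r0 Hr] := abs_continuous_small (abs_continuous_st_tau acy) e0.
have pq : Num.max a (t - r) < t by rewrite gt_max at' ltrBlDr ltrDl.
have [s /andP[s1 s2]] := negligible_itv pq aey.
move: s1; rewrite gt_max => /andP[s1 s3]; apply => /= H.
have [|/flow_setP[_ /andP[ts _]] _ _] := H.
  by rewrite !ltW//= (lt_le_trans s2).
have := Hr s t (ltW s1) (ltW s2) tb.
rewrite ltrBlDr addrC -ltrBlDr => /(_ s3) /=.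
by rewrite distrC ger0_norm ?subr_ge0 ?(le_trans (ltW tt))//; lra.
Qed.

Lemma is_derive_lyap t : 1 + gam * st_tau (y t) != 0 -> derivable y t 1 ->
  is_derive t 1 (fun s => lyap_st i (y s))
    (lyapunov_dot kap gam B (P i) xs (st_x (y t)) (st_xi (y t)) (st_tau (y t))
      (st_x (derive1 y t)) (st_xi (derive1 y t)) (st_tau (derive1 y t))).
Proof.
move=> g0 dy.
have dx := is_derive_st_x dy.
have dz := is_derive_cVD (is_derive_st_xi dy) (is_derive_cVM B dx).
have dxt := is_derive_cVD dx (is_derive_cV_cst (- xs) t).
have dtau := is_derive_st_tau dy.
have dlin (k : R) := is_derive1D (is_derive1_cst t 1) (is_derive1M (is_derive1_cst t k) dtau).
have dq := is_derive_bform 1%:M dxt dxt.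
have := is_derive1D
  (is_derive1M (dlin (- kap)) dq)
  (is_derive1M (is_derive1_inv (f := fun s => 1 + gam * st_tau (y s)) g0 (dlin gam)) (is_derive_bform (P i) dz dz)).
rewrite (_ : (fun s => _) = (fun s => lyap_st i (y s))); last first.
  apply/funext => s /=; rewrite /lyap_st /lyapunov -sqnorm2E.
  by rewrite mulNr.
move=> h; apply: (is_derive_eq h).
rewrite /lyapunov_dot /= !addr0 -sqnorm2E -[bform 1%:M (st_x (y t) - xs) _]/(dot _ _).
rewrite -[bform 1%:M _ (st_x (y t) - xs)]/(dot _ _) (dotC (st_x (derive1 y t))).
ring.
Qed.

Lemma lyap_st_decrease :
  expR (c * b) * lyap_st i (y b) <= expR (c * a) * lyap_st i (y a).
Proof.
pose V t := expR (c * t) * lyap_st i (y t).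
apply: (@abs_continuous_nonincr R V a b ab).
  apply: abs_continuousM; first exact: abs_continuous_expR.
  have ax := abs_continuous_st_x acy.
  have az := abs_continuous_cVD (abs_continuous_st_xi acy) (abs_continuous_cVM B ax).
  have axt := abs_continuous_cVD ax (abs_continuous_cV_cst (- xs) a b).
  have at_ := abs_continuous_st_tau acy.
  have alin (k : R) : @abs_continuous R R^o a b (fun t => 1 + k * st_tau (y t)).
    apply: abs_continuousD; first exact: abs_continuous_cst.
    by apply: abs_continuousM at_; exact: abs_continuous_cst.
  rewrite (_ : (fun t => _) = fun t => (1 + - kap * st_tau (y t)) *
      bform 1%:M (st_x (y t) + - xs) (st_x (y t) + - xs) +
      (1 + gam * st_tau (y t))^-1 * bform (P i) (st_xi (y t) + B *m st_x (y t))
       (st_xi (y t) + B *m st_x (y t))); last first.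
    by apply/funext => t; rewrite /lyap_st /lyapunov -sqnorm2E mulNr.
  apply: abs_continuousD.
    apply: abs_continuousM (alin _) _; exact: (abs_continuous_bform 1%:M axt axt).
  apply: abs_continuousM; last exact: (abs_continuous_bform (P i) az az).
  apply: (abs_continuous_lipschitz (M := 1) _ (alin gam)) => u v ut vt /=.
  have /andP[tu _] := flow_tau ut; have /andP[tv _] := flow_tau vt.
  set p := 1 + gam * st_tau (y v); set q := 1 + gam * st_tau (y u).
  have p1 : 1 <= p by rewrite lerDl mulr_ge0.
  have q1 : 1 <= q by rewrite lerDl mulr_ge0.
  have p0' : p != 0 by rewrite gt_eqF// (lt_le_trans ltr01).
  have q0' : q != 0 by rewrite gt_eqF// (lt_le_trans ltr01).
  have -> : p^-1 - q^-1 = (p * q)^-1 * (q - p) by field; rewrite p0' q0'.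
  rewrite normrM [`|q - p|]distrC ler_wpM2r//.
  have pq1 : 1 <= p * q by exact: mulr_ege1.
  have pq0 : 0 < p * q by exact: lt_le_trans ltr01 pq1.
  by rewrite ger0_norm ?invr_ge0 ?(ltW pq0)// invf_le1.
apply: lebesgue_aeS aey => t H tab.
have [_ dy dF] := H tab.
have [dx [i' qi' dxi] _ dtau] := flow_mapP dF.
have ii' : i' = i by apply: mode_inj; rewrite -qi' flow_q.
rewrite {i' qi'}ii' in dxi.
have tauT := flow_tau tab.
have g0 : 1 + gam * st_tau (y t) != 0.
  by rewrite gt_eqF// ltr_pwDl// mulr_ge0//; case/andP: tauT.
have dl := is_derive_lyap g0 dy.
have de : is_derive t 1 (fun s => expR (c * s)) (c * expR (c * t)).
  have := is_derive1_comp (is_derive_expR (c * t)) (is_derive1M (is_derive1_cst t c) (is_derive_id t 1)).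
  by move=> h; apply: (is_derive_eq h); rewrite mul0r add0r mulr1 /GRing.scale/= mulrC.
have dV := is_derive1M de dl.
split; first exact: ex_derive.
rewrite derive1E derive_val.
have := rate tauT dx dxi dtau; rewrite -/(lyap_st i (y t)).
move: (lyapunov_dot _ _ _ _ _ _ _ _ _ _ _) => r Hr.
have := ler_wpM2l (expR_ge0 (c * t)) Hr; lra.
Qed.

End flow.

(** * Hybrid arcs, level by level *)

Section time_domain.
Context {R : realType}.

Lemma hybrid_time_domain_level0 (E : set (R * nat)) t : hybrid_time_domain E ->
  E (t, 0%N) -> 0 <= t /\ forall s, 0 <= s <= t -> E (s, 0%N).
Proof.
move=> [u [u0 umono]] [->|[J ->]|[J [tbar ->]]] /=.
- rewrite u0 => /andP[t0 t1]; split => // s /andP[-> st].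
  by rewrite (le_trans st).
- rewrite u0 => -[J0 /andP[t0 t1]]; split => // s /andP[-> st].
  by rewrite (le_trans st).
- move=> [[J0 /andP[]]|[J0 []]].
    rewrite u0 => t0 t1; split => // s /andP[s0 st]; left; split => //.
    by rewrite s0 (le_trans st).
  rewrite -J0 u0 => t0 tb; split => // s /andP[s0 st]; right; do !split => //.
  by apply: le_lt_trans tb; rewrite lee_fin.
Qed.

Lemma hybrid_time_domain_levelS (E : set (R * nat)) t j : hybrid_time_domain E ->
  E (t, j.+1) -> exists s, [/\ s <= t, E (s, j), E (s, j.+1),
    forall s', s <= s' <= t -> E (s', j.+1) & forall s', E (s', j) -> s' <= s].
Proof.
move=> [u [u0 umono]] [->|[J ->]|[J [tbar ->]]] /=.
- move=> /andP[t0 t1]; exists (u j.+1); split => //.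
  + by rewrite umono lexx.
  + by rewrite lexx umono.
  + by move=> s /andP[-> st]; rewrite (le_trans st).
  + by move=> s /andP[].
- move=> [jJ /andP[t0 t1]]; exists (u j.+1); split => //.
  + by rewrite umono lexx (ltnW jJ).
  + by rewrite lexx umono.
  + by move=> s /andP[-> st]; rewrite (le_trans st).
  + by move=> s [_ /andP[]].
- move=> [[jJ /andP[t0 t1]]|[jJ [t0 t1]]]; exists (u j.+1); split => //.
  + by left; rewrite umono lexx (ltnW jJ).
  + by left; rewrite lexx umono.
  + by move=> s /andP[s0 st]; left; rewrite s0 (le_trans st).
  + move=> s [[_ /andP[]]//|[jE _]].
    by move: jJ; rewrite jE ltnNge leqnSn.
  + by rewrite jJ.
  + by left; rewrite -jJ ltnSn umono lexx.
  + right; rewrite jJ lexx; do !split => //; apply: le_lt_trans t1.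
    by rewrite lee_fin -jJ in t0 *.
  + move=> s /andP[s0 st]; right; rewrite -jJ s0; do !split => //.
    by apply: le_lt_trans t1; rewrite lee_fin.
  + move=> s [[_ /andP[]]//|[jE _]].
    by exfalso; move: jJ; rewrite jE => /eqP; rewrite eqn_leq ltnn.
Qed.

End time_domain.

Section levels.
Context {R : realType} {S : normedModType R}.

Definition level (psi : hybrid_arc S) (j : nat) : set (R * S) :=
  [set p | arc_dom psi (p.1, j) /\ p.2 = arc_val psi p.1 j].

Lemma level_functional (psi : hybrid_arc S) j t s1 s2 :
  level psi j (t, s1) -> level psi j (t, s2) -> s1 = s2.
Proof. by move=> [_ /= ->] [_ /= ->]. Qed.

Lemma embed_level_continuous j :
  continuous (fun p : R * S => ((p.1, j), p.2) : R * nat * S).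
Proof.
move=> p.
have c1 : (fun p : R * S => p.1) @ p --> p.1 by exact: cvg_fst.
have c2 : (fun p : R * S => p.2) @ p --> p.2 by exact: cvg_snd.
have c3 : (fun p : R * S => j) @ p --> j by exact: cvg_cst.
exact: (cvg_pair (cvg_pair c1 c3) c2).
Qed.

Lemma level_closed (psi : hybrid_arc S) j : closed (arc_graph psi) ->
  closed (level psi j).
Proof.
move=> cg; rewrite (_ : level psi j =
  (fun p : R * S => ((p.1, j), p.2) : R * nat * S) @^-1` arc_graph psi)//.
by apply: closed_comp => // p _; exact: embed_level_continuous.
Qed.

Definition at_level j (O : set (R * S)) : set (R * nat * S) :=
  [set p | p.1.2 = j /\ O (p.1.1, p.2)].

(** Levels are discrete. *)
Lemma at_level_open j O : open O -> open (at_level j O).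
Proof.
move=> oO; rewrite (_ : at_level j O =
  ((fun p : R * nat * S => p.1.2) @^-1` [set j]) `&`
  ((fun p : R * nat * S => (p.1.1, p.2)) @^-1` O)); last by [].
apply: openI.
  apply: open_comp => [p _|]; last exact: discrete_open.
  have c1 : (fun p : R * nat * S => p.1) @ p --> p.1 by exact: cvg_fst.
  exact: (cvg_comp _ _ c1 cvg_snd).
apply: open_comp => // p _.
have c1 : (fun p : R * nat * S => p.1) @ p --> p.1 by exact: cvg_fst.
have c2 : (fun p : R * nat * S => p.2) @ p --> p.2 by exact: cvg_snd.
exact: (cvg_pair (cvg_comp _ _ c1 cvg_fst) c2).
Qed.

Lemma level_hits (psi : hybrid_arc S) j O :
  (level psi j `&` O !=set0) <->
  (arc_graph psi `&` at_level j O !=set0).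
Proof.
split => [[[t s] [[/= dt sE] Ots]]|[[[t k] s] [[/= dt sE] [/= kE Ots]]]].
  by exists ((t, j), s); split.
by subst k; exists (t, s); split.
Qed.

Lemma level_hits_le (psi : hybrid_arc S) j l O : (j <= l)%N ->
  (level psi j `&` O !=set0) <->
  (arc_graph psi `&` [set p | (p.1.2 <= l)%N] `&` at_level j O !=set0).
Proof.
move=> jl; split => [[[t s] [[/= dt sE] Ots]]|[[[t k] s] [[[/= dt sE] _] [/= kE Ots]]]].
  by exists ((t, j), s); split.
by subst k; exists (t, s); split.
Qed.

Context {dV : measure_display} {V : measurableType dV}
  {d : measure_display} {Om : measurableType d}.
Variables (v : nat -> Om -> V) (y : Om -> hybrid_arc S).

Lemma level_measurable j : stochastic_hybrid_arc y ->
  measurable_multifun measurable (fun w => level (y w) j).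
Proof.
move=> [_ my] O oO; have := my _ (@at_level_open j _ oO).
congr measurable; apply/seteqP; split => w /=; by move/level_hits.
Qed.

(** The generators of [input_filtration], needed to turn the latter into a
    measurable type. *)
Definition filtration_gen l : set (set Om) := [set A | exists k (E : set V),
   [/\ (0 < k <= l)%N, measurable E & A = v k @^-1` E] ].

Lemma level_adapted j : adapted v y ->
  @measurable_multifun (g_sigma_algebraType (filtration_gen j))
    measurable _ (fun w => level (y w) j).
Proof.
move=> ay O oO; have := ay j _ (@at_level_open j _ oO).
rewrite [X in input_filtration _ _ X](_ : _ = [set w | level (y w) j `&` O !=set0])//.
by apply/seteqP; split => w /=; move/(level_hits_le _ _ (leqnn j)).
Qed.

End levels.

Section pathwise.
Context {R : realType} (N n n1 p0 : nat) (T eta : R) (T_gt0 : 0 < T)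
    (A : 'I_N -> 'M[R]_n) (B : 'M[R]_(n, n1))
    (L : 'M[R]_(p0, n)) (d : 'cV[R]_p0)
    (phix : 'cV[R]_n1 -> R) (phiy : 'cV[R]_p0 -> R) (lam : 'I_N -> {nonneg R})
    (P : 'I_N -> 'M[R]_n) (xs : 'cV[R]_n1) (kap gam c eps : R).
Hypotheses (gam_ge0 : 0 <= gam) (eps_gt0 : 0 < eps) (c_ge0 : 0 <= c).
Hypotheses (kap_ge0 : 0 <= kap) (kapT : kap * T <= 1 / 2).
Hypothesis rate : forall i x xi tau dx dxi dtau, 0 <= tau <= T ->
      dx = - grad phix x - (- (L *m B))^T *m grad phiy (L *m xi + d) ->
      eps *: dxi = A i *m (xi + B *m x) ->
      - eta <= eps * dtau <= 0 ->
      lyapunov_dot kap gam B (P i) xs x xi tau dx dxi dtau <=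
        - (c * lyapunov kap gam B (P i) xs x xi tau).
Let sys := switched_gradient_flow eta T_gt0 A B L d phix phiy lam eps.
Notation st := (@state R n n1).
Notation lyap := (lyap_st B P xs kap gam).

Lemma flow_segment (psi : hybrid_arc st) j (i : 'I_N) (a b : R) : a <= b ->
  (forall s, a <= s <= b -> arc_dom psi (s, j)) -> flows_along sys psi ->
  st_q (arc_val psi a j) = mode i -> 0 <= st_tau (arc_val psi a j) <= T ->
  [/\ st_q (arc_val psi b j) = mode i, 0 <= st_tau (arc_val psi b j) <= T &
    expR (c * b) * lyap i (arc_val psi b j) <= expR (c * a) * lyap i (arc_val psi a j)].
Proof.
move=> ab dom fl qa taua.
have [<-|neq] := eqVneq a b; first by split.
have lt_ab : a < b by rewrite lt_neqAle neq.
have ae := fl a b j (dom a _) (dom b _) lt_ab.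
have acy : abs_continuous a b (fun t => arc_val psi t j).
  by apply: (arc_valP (j := j)) => // t /=; rewrite in_itv/=; exact: dom.
have {}ae := ae (ltac:(by rewrite lexx)) (ltac:(by rewrite lexx ab)).
split.
- by apply: (flow_q eps_gt0 acy ae qa); rewrite ab lexx.
- by apply: (flow_tau eps_gt0 acy ae taua); rewrite ab lexx.
- exact: (lyap_st_decrease gam_ge0 eps_gt0 c_ge0 rate ab acy ae qa taua).
Qed.

Definition slow_part (p : R * st) : R := expR (c * p.1) * sqnorm2 (st_x p.2 - xs).
Definition fast_part i (p : R * st) : R := expR (c * p.1) *
  bform (P i) (st_xi p.2 + B *m st_x p.2) (st_xi p.2 + B *m st_x p.2).
(** The absolute values here and in [fast_weight] make the weights nonnegative and
    measurable on the whole line; for clocks in [[0, T]] they are the weights of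
    [lyapunov]. *)
Definition slow_weight (tau : R) : R := `|1 - kap * tau|.
Definition fast_weight (tau : R) : R := (1 + gam * `|tau|)^-1.

(** The value of [e^(c t) V] after a jump from the last point of a level with input
    [u], as a sum of products of a function of that point and a function of
    [u], so that independence applies term by term. *)
Definition after_jump (D : set st) (Phi : set (R * st)) (u : R * R) : R :=
  last_value D slow_part Phi * slow_weight u.2 +
  \sum_i last_value D (fast_part i) Phi *
    ((u.1 == mode i)%:R * fast_weight u.2).

Definition majorant_seq (D : set st) (V0 : R) (psi : hybrid_arc st)
    (u : nat -> R * R) j : R :=
  if j is k.+1 then after_jump D (level psi k) (u k.+1) else V0.

Definition good_input (u : R * R) := modes N u.1 /\ 0 <= u.2 <= T.

(** By cases on the level: it starts either at the initial point or, after a jump,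
    at the point that [after_jump] evaluates; [e^(c t) V] then decreases. *)
Lemma path_bound (psi : hybrid_arc st) (u : nat -> R * R) y0 i0 :
  flows_along sys psi -> jumps_along sys u psi ->
  arc_dom psi (0, 0%N) -> arc_val psi 0 0 = y0 ->
  st_q y0 = mode i0 -> 0 <= st_tau y0 <= T ->
  (forall k, (0 < k)%N -> good_input (u k)) ->
  forall j t, arc_dom psi (t, j) -> exists i,
    [/\ st_q (arc_val psi t j) = mode i, 0 <= st_tau (arc_val psi t j) <= T &
      expR (c * t) * lyap i (arc_val psi t j) <=
        majorant_seq (jump_set sys) (lyap i0 y0) psi u j].
Proof.
move=> fl ju d0 v0 q0 tau0 good [|j] t dt.
  have [t0 dom] := hybrid_time_domain_level0 (arc_domP psi) dt.
  have [||q1 tau1 V1] := @flow_segment psi 0 i0 0 t t0 dom fl.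
  - by rewrite v0.
  - by rewrite v0.
  - exists i0; split => //; apply: le_trans V1 _.
    by rewrite v0 mulr0 expR0 mul1r.
have [s [sle ds dsS dom last]] := hybrid_time_domain_levelS (arc_domP psi) dt.
have [Dy Gy] := ju s j ds dsS.
have [[i _ iE] utau] := good j.+1 isT.
have lp : last_point (level psi j) (s, arc_val psi s j).
  by split; [split|move=> [t' s'] [/= /last]].
have fun_lv := @level_functional R st psi j.
have yE : [/\ st_x (arc_val psi s j.+1) = st_x (arc_val psi s j),
    st_xi (arc_val psi s j.+1) = st_xi (arc_val psi s j),
    st_q (arc_val psi s j.+1) = (u j.+1).1 &
    st_tau (arc_val psi s j.+1) = (u j.+1).2].
  move: Gy; rewrite /sys/=; case: (arc_val psi s j) => x [[xi q] tau] /= ->.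
  by split.
case: yE => yx yxi yq ytau.
have [||q1 tau1 V1] := @flow_segment psi j.+1 i s t sle dom fl.
- by rewrite yq.
- by rewrite ytau.
exists i; split => //; apply: le_trans V1 _.
rewrite /majorant_seq /after_jump (last_valueE slow_part fun_lv lp Dy).
rewrite (eq_bigr (fun k => fast_part k (s, arc_val psi s j) *
    (((u j.+1).1 == mode k)%:R * fast_weight (u j.+1).2))); last first.
  by move=> k _; rewrite (last_valueE (fast_part k) fun_lv lp Dy).
rewrite (bigD1 i)//= [X in _ + (_ + X)]big1 ?addr0; last first.
  move=> k ki; rewrite -iE (inj_eq (@mode_inj R N)) eq_sym (negbTE ki).
  by rewrite mul0r mulr0.
rewrite -iE eqxx mul1r /lyap_st /lyapunov yx yxi ytau.
have /andP[u0 u1] := utau.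
rewrite /slow_weight /fast_weight (ger0_norm u0) ger0_norm; last first.
  by rewrite subr_ge0 (le_trans (ler_wpM2l kap_ge0 u1))// (le_trans kapT)//; lra.
by rewrite /slow_part /fast_part/= le_eqVlt; apply/orP; left; apply/eqP; ring.
Qed.

End pathwise.

(** * The law of the inputs *)

Section weights.
Context {R : realType} (T : R) (T_gt0 : 0 < T).

Lemma integral_uniform_FTC (f g F : R -> R) :
  measurable_fun setT g -> (forall x, 0 <= g x) ->
  (forall x, 0 <= x <= T -> g x = f x) ->
  (forall x, 0 <= x <= T -> is_derive x 1 F (f x)) -> continuous f ->
  (\int[uniform_prob T_gt0]_x (g x)%:E = ((F T - F 0) / T)%:E)%E.
Proof.
move=> mg g0 gf dF cf.
have mg' : measurable_fun setT (fun x => (g x)%:E) by exact/measurable_EFinP.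
have g0' x : (0 <= (g x)%:E)%E by rewrite lee_fin.
rewrite (integral_uniform T_gt0 mg' g0') subr0.
have -> : (\int[lebesgue_measure]_(x in `[0%R, T]) (g x)%:E =
      \int[lebesgue_measure]_(x in `[0%R, T]) (f x)%:E)%E.
    by apply: eq_integral => x; rewrite inE/= in_itv/= => /gf ->.
  rewrite (@continuous_FTC2 _ f F)//.
  - by rewrite -EFinB -EFinM mulrC.
  - exact: continuous_subspaceT.
  - have cF x : 0 <= x <= T -> {for x, continuous F}.
      move=> /dF dFx; have /derivable1_diffP := @ex_derive _ _ _ _ _ _ _ dFx.
      exact: differentiable_continuous.
    split.
    + move=> x; rewrite in_itv/= => /andP[x0 xT].
      by have := dF x; rewrite !ltW// => /(_ isT) dFx; exact: ex_derive.
    + by apply: cvg_at_right_filter; apply: cF; rewrite lexx ltW.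
    + by apply: cvg_at_left_filter; apply: cF; rewrite lexx ltW.
  - move=> x; rewrite in_itv/= => /andP[x0 xT].
    have := dF x; rewrite !ltW// => /(_ isT) dFx.
    by rewrite derive1E derive_val.
Qed.

Lemma measurable_slow_weight kap : measurable_fun setT (@slow_weight R kap).
Proof.
apply: continuous_measurable_fun => x.
apply: cvg_norm.
by apply: cvgB; [exact: cvg_cst|apply: cvgM; [exact: cvg_cst|exact: cvg_id]].
Qed.

Lemma fast_weight_den (gam x : R) : 0 <= gam -> 0 < 1 + gam * `|x|.
Proof. by move=> g0; rewrite ltr_pwDl// mulr_ge0. Qed.

Lemma measurable_fast_weight gam : 0 <= gam ->
  measurable_fun setT (@fast_weight R gam).
Proof.
move=> g0; apply: continuous_measurable_fun => x.
apply: cvgV; first by rewrite gt_eqF// fast_weight_den.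
apply: cvgD; first exact: cvg_cst.
by apply: cvgM; [exact: cvg_cst|apply: cvg_norm; exact: cvg_id].
Qed.

Lemma slow_weight_ge0 kap (x : R) : 0 <= slow_weight kap x.
Proof. exact: normr_ge0. Qed.

Lemma fast_weight_ge0 gam (x : R) : 0 <= gam -> 0 <= fast_weight gam x.
Proof. by move=> g0; rewrite invr_ge0 ltW// fast_weight_den. Qed.

Lemma integral_slow_weight kap : 0 <= kap -> kap * T <= 1 / 2 ->
  (\int[uniform_prob T_gt0]_x (slow_weight kap x)%:E = (1 - kap * T / 2)%:E)%E.
Proof.
move=> k0 kT.
pose F x := x + (- kap / 2) * (x * x).
have -> : 1 - kap * T / 2 = (F T - F 0) / T by rewrite /F; field; rewrite gt_eqF.
apply: (@integral_uniform_FTC (fun x => 1 - kap * x) _ F).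
- exact: measurable_slow_weight.
- exact: slow_weight_ge0.
- move=> x /andP[x0 xT]; rewrite /slow_weight ger0_norm// subr_ge0.
  by rewrite (le_trans (ler_wpM2l k0 xT))// (le_trans kT)//; lra.
- move=> x _; have did := is_derive_id x (1 : R).
  have h := is_derive1D did (is_derive1M (is_derive1_cst x (- kap / 2)) (is_derive1M did did)).
  by apply: (is_derive_eq h); field.
- by move=> x; apply: cvgB; [exact: cvg_cst|apply: cvgM; [exact: cvg_cst|exact: cvg_id]].
Qed.

Lemma integral_fast_weight sigma : 0 < sigma ->
  (\int[uniform_prob T_gt0]_x (fast_weight (sigma / T) x)%:E =
   (sigma^-1 * ln (1 + sigma))%:E)%E.
Proof.
move=> s0; set gam := sigma / T.
have g0 : 0 < gam by rewrite divr_gt0.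
pose F x := gam^-1 * ln (1 + gam * x).
have -> : sigma^-1 * ln (1 + sigma) = (F T - F 0) / T.
  rewrite /F mulr0 addr0 ln1 mulr0 subr0 /gam mulfVK ?gt_eqF//.
  by field; rewrite (gt_eqF T_gt0) (gt_eqF s0).
apply: (@integral_uniform_FTC (fast_weight gam) _ F).
- exact: measurable_fast_weight (ltW g0).
- by move=> x; exact: fast_weight_ge0 (ltW g0).
- by [].
- move=> x /andP[x0 xT]; have did := is_derive_id x (1 : R).
  have gx : 0 < 1 + gam * x by rewrite ltr_pwDl// mulr_ge0// ltW.
  have h1 := is_derive1D (is_derive1_cst x 1) (is_derive1M (is_derive1_cst x gam) did).
  have h2 := @is_derive1_comp _ (@ln R) _ x _ _ (is_derive1_ln gx) h1.
  have h := is_derive1M (is_derive1_cst x gam^-1) h2.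
  apply: (is_derive_eq h); rewrite /fast_weight ger0_norm// /GRing.scale/=.
  by field; rewrite !gt_eqF.
- move=> x; apply: cvgV; first by rewrite gt_eqF// fast_weight_den// ltW.
  apply: cvgD; first exact: cvg_cst.
  by apply: cvgM; [exact: cvg_cst|apply: cvg_norm; exact: cvg_id].
Qed.

Lemma uniform_prob_itv : uniform_prob T_gt0 `[0, T]%classic = 1%:E.
Proof. by rewrite /uniform_prob integral_uniform_pdf1. Qed.

End weights.

Section law.
Context {R : realType} (N : nat) (T : R) (T_gt0 : 0 < T) (lam : 'I_N -> {nonneg R}).
Hypothesis lam_sum : \sum_(q < N) (lam q)%:num = 1.
Let mu := (mode_law lam \x uniform_prob T_gt0)%E.

Lemma modes_measurable : measurable (modes N : set (measurableTypeR R)).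
Proof.
rewrite (_ : modes N = \bigcup_(i in [set: 'I_N]) [set mode i]); last first.
  by apply/seteqP; split => x [i _ xi]; exists i; rewrite ?xi.
by apply: fin_bigcup_measurable => [|i _]; [exact: finite_finset|exact: measurable_set1].
Qed.

Lemma mode_lawT (E : set (measurableTypeR R)) : modes N `<=` E -> mode_law lam E = 1%E.
Proof.
move=> mE; rewrite /mode_law (eq_bigr (fun q => (lam q)%:num%:E)).
  by rewrite sumEFin lam_sum.
move=> q _; rewrite diracE mem_set ?mule1//; apply: mE; by exists q.
Qed.

Lemma mode_law1 i : mode_law lam [set mode i] = (lam i)%:num%:E.
Proof.
rewrite /mode_law (bigD1 i)//= diracE mem_set// mule1 big1 ?adde0// => q qi.
rewrite diracE memNset ?mule0// => /= /(@mode_inj R N) qE.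
by rewrite qE eqxx in qi.
Qed.

Context {d : measure_display} {Om : measurableType d} (Pr : probability Om R)
  (v : nat -> Om -> @input_space R).
Hypothesis iid : iid_input Pr mu v.

Variable k : nat.
Hypothesis k_gt0 : (0 < k)%N.

Lemma input_rect (E F : set (measurableTypeR R)) : measurable E -> measurable F ->
  Pr (v k @^-1` (E `*` F)) = (mode_law lam E * uniform_prob T_gt0 F)%E.
Proof.
move=> mE mF; case: iid => mv law _; rewrite law//; last exact: measurableX.
exact: product_measure1E.
Qed.

Lemma measurable_input1 : measurable_fun setT (fun w => (v k w).1).
Proof. by case: iid => mv _ _; apply: (measurableT_comp measurable_fst); exact: mv. Qed.

Lemma measurable_input2 : measurable_fun setT (fun w => (v k w).2).
Proof. by case: iid => mv _ _; apply: (measurableT_comp measurable_snd); exact: mv. Qed.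

Lemma input1E (E : set (measurableTypeR R)) : measurable E ->
  Pr ((fun w => (v k w).1) @^-1` E) = mode_law lam E.
Proof.
move=> mE; have := input_rect mE measurableT.
rewrite probability_setT mule1 => <-; congr (Pr _).
by apply/seteqP; split => w //= [].
Qed.

Lemma input2E (F : set (measurableTypeR R)) : measurable F ->
  Pr ((fun w => (v k w).2) @^-1` F) = uniform_prob T_gt0 F.
Proof.
move=> mF; have := input_rect measurableT mF.
rewrite mode_lawT// mul1e => <-; congr (Pr _).
by apply/seteqP; split => w //= [].
Qed.

Lemma integral_input2 (g : R -> R) : measurable_fun setT g -> (forall x, 0 <= g x) ->
  (\int[Pr]_w (g (v k w).2)%:E = \int[uniform_prob T_gt0]_x (g x)%:E)%E.
Proof.
move=> mg g0.
pose X : {mfun Om >-> measurableTypeR R} :=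
  HB.pack (fun w => (v k w).2) (isMeasurableFun.Build _ _ _ _ _ measurable_input2).
transitivity (\int[distribution Pr X]_x (g x)%:E)%E.
  rewrite ge0_integral_distribution//; first exact/measurable_EFinP.
by apply: eq_measure_integral => F mF _; exact: input2E.
Qed.

Lemma integral_input_mode i (g : R -> R) : measurable_fun setT g ->
  (forall x, 0 <= g x) ->
  (\int[Pr]_w (((v k w).1 == mode i)%:R * g (v k w).2)%:E =
   (lam i)%:num%:E * \int[uniform_prob T_gt0]_x (g x)%:E)%E.
Proof.
move=> mg g0.
have m1 : measurable ([set mode i] : set (measurableTypeR R)) by exact: measurable_set1.
have eqE w : (((v k w).1 == mode i)%:R * g (v k w).2)%:E =
   ((\1_[set mode i] (v k w).1)%:E * (g (v k w).2)%:E)%E.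
  rewrite -EFinM indicE.
  have -> // : ((v k w).1 \in [set mode i]) = ((v k w).1 == mode i).
  by apply/idP/eqP => [|->]; rewrite ?inE// mem_set.
under eq_integral do rewrite eqE.
have := @integral_indep _ _ _ Pr _ _ _ _ _ _ (fun x => (\1_[set mode i] x)%:E)
   (fun x => (g x)%:E) measurable_input1 measurable_input2.
move=> ->.
- rewrite integral_input2//; congr (_ * _)%E.
  rewrite (_ : (fun _ => _) = (fun w => (\1_((fun w => (v k w).1) @^-1` [set mode i]) w)%:E)).
    rewrite integral_indic//; last first.
      rewrite -[X in measurable X]setTI; exact: measurable_input1.
    by rewrite setIT; exact: etrans (input1E m1) (mode_law1 i).
  by apply/funext => w; rewrite !indicE.
- move=> E F mE mF; apply: etrans (input_rect mE mF) _.
  by congr (_ * _)%E; [exact: esym (input1E mE)|exact: esym (input2E mF)].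
- exact/measurable_EFinP/measurable_indic.
- exact/measurable_EFinP.
- by move=> x; rewrite lee_fin indicE.
- by move=> x; rewrite lee_fin.
Qed.

Lemma input_good : Pr (v k @^-1` (modes N `*` `[0, T]%classic)) = 1%E.
Proof.
rewrite input_rect//; last exact: modes_measurable.
by rewrite mode_lawT// uniform_prob_itv mule1.
Qed.

End law.

(** * Decay in expectation and in probability *)

Section markov_union.
Context {R : realType} {d : measure_display} {Om : measurableType d}
  (Pr : probability Om R).

Lemma markov_ineq (g : Om -> R) (a : R) : measurable_fun setT g -> (forall w, 0 <= g w) ->
  0 < a -> (a%:E * Pr [set w | (a <= g w)%R] <= \int[Pr]_w (g w)%:E)%E.
Proof.
move=> mg g0 a0.
have mB : measurable [set w | a <= g w].
  rewrite (_ : [set _ | _] = g @^-1` `[a, +oo[%classic); last first.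
    by apply/seteqP; split => w /=; rewrite in_itv/= andbT.
  by rewrite -[X in measurable X]setTI; apply: mg => //; exact: measurable_itv.
rewrite -[X in (_ * Pr X)%E]setIT -integral_indic// -ge0_integralZl//.
- apply: ge0_le_integral => //.
  + by move=> w _; rewrite mule_ge0// lee_fin// ltW.
  + by apply: emeasurable_funM => //; exact/measurable_EFinP/measurable_indic.
  + exact/measurable_EFinP.
  + move=> w _; rewrite -EFinM lee_fin indicE; have [|_] := boolP (w \in [set w | a <= g w]).
      by rewrite inE/= mulr1.
    by rewrite mulr0.
- exact/measurable_EFinP/measurable_indic.
- by rewrite lee_fin ltW.
Qed.

(** The partial sums of the geometric series stay below [C / (1 - r)]. *)
Lemma geometric_union_bound (B : nat -> set Om) (C r : R) :
  (forall j, measurable (B j)) -> 0 <= C -> 0 < r < 1 ->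
  (forall j, Pr (B j) <= (C * r ^+ j)%:E)%E ->
  (Pr (\bigcup_j B j) <= (C / (1 - r))%:E)%E.
Proof.
move=> mB C0 /andP[r0 r1] HB.
have mU : measurable (\bigcup_j B j) by exact: bigcupT_measurable.
apply: le_trans (measure_sigma_subadditive Pr mB mU (@subset_refl _ _)) _.
apply: lime_le; first by apply: is_cvg_nneseries => j _ _; exact: measure_ge0.
apply: nearW => n.
apply: (@le_trans _ _ (\sum_(0 <= j < n) (C * r ^+ j)%:E)%E).
  by apply: lee_sum => j _; exact: HB.
rewrite sumEFin lee_fin -mulr_sumr.
apply: ler_wpM2l => //.
rewrite -[leRHS]mul1r ler_pdivlMr ?subr_gt0//.
rewrite big_mkord mulrC -[1 - r]opprB mulNr -subrX1 opprB.
by rewrite gerBl exprn_ge0// ltW.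
Qed.

End markov_union.

Section expectation.
Context {R : realType} (N n n1 p0 : nat) (T eta : R) (T_gt0 : 0 < T)
    (A : 'I_N -> 'M[R]_n) (B : 'M[R]_(n, n1))
    (L : 'M[R]_(p0, n)) (dv : 'cV[R]_p0)
    (phix : 'cV[R]_n1 -> R) (phiy : 'cV[R]_p0 -> R) (lam : 'I_N -> {nonneg R}).
Hypothesis lam_sum : \sum_(q < N) (lam q)%:num = 1.
Context (P : 'I_N -> 'M[R]_n) (xs : 'cV[R]_n1) (kap sigma c eps rho : R).
Let gam := sigma / T.
Hypotheses (sigma_gt0 : 0 < sigma) (eps_gt0 : 0 < eps) (c_ge0 : 0 <= c).
Hypotheses (kap_ge0 : 0 <= kap) (kapT : kap * T <= 1 / 2).
Hypothesis P_ge0 : forall i u, 0 <= bform (P i) u u.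
Hypothesis rate : forall i x xi tau dx dxi dtau, 0 <= tau <= T ->
      dx = - grad phix x - (- (L *m B))^T *m grad phiy (L *m xi + dv) ->
      eps *: dxi = A i *m (xi + B *m x) ->
      - eta <= eps * dtau <= 0 ->
      lyapunov_dot kap gam B (P i) xs x xi tau dx dxi dtau <=
        - (c * lyapunov kap gam B (P i) xs x xi tau).
Hypothesis rho01 : 0 < rho < 1.
Hypothesis jump : forall i x xi,
    (1 - kap * T / 2) * sqnorm2 (x - xs) +
    sigma^-1 * ln (1 + sigma) *
      (\sum_q (lam q)%:num * bform (P q) (xi + B *m x) (xi + B *m x)) <=
    rho * lyapunov kap gam B (P i) xs x xi 0.
Let sys := switched_gradient_flow eta T_gt0 A B L dv phix phiy lam eps.
Notation st := (@state R n n1).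
Notation lyap := (lyap_st B P xs kap gam).

Context {d : measure_display} {Om : measurableType d} (Pr : probability Om R)
  (v : nat -> Om -> @input_space R).
Hypothesis iid : iid_input Pr (input_law sys) v.
Variables (y0 : st) (i0 : 'I_N) (y : Om -> hybrid_arc st).
Hypotheses (q0 : st_q y0 = mode i0) (tau0 : 0 <= st_tau y0 <= T).
Hypothesis sol : random_solution sys v y0 y.

Let D := jump_set sys.
Let slow := slow_part xs c : R * st -> R.
Let fast i := fast_part B P c i : R * st -> R.

Let gam_ge0 : 0 <= gam.
Proof. by rewrite divr_ge0 ?ltW. Qed.

Let slow_ge0 p : 0 <= slow p.
Proof. by rewrite mulr_ge0 ?expR_ge0 ?sqnorm2_ge0. Qed.

Let fast_ge0 i p : 0 <= fast i p.
Proof. by rewrite mulr_ge0 ?expR_ge0. Qed.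

Lemma jump_set_closed : closed D.
Proof.
rewrite (_ : D = st_q @^-1` (modes N) `&` st_tau @^-1` [set 0]); last first.
  by apply/seteqP; split => -[x [[xi q] tau]].
apply: closedI; apply: closed_comp => [x _|].
- exact: st_q_continuous.
- apply: compact_closed; first exact: Rhausdorff.
  by apply: finite_compact; apply: finite_image; exact: finite_finset.
- exact: st_tau_continuous.
- exact: closed_eq.
Qed.

Let continuous_growth : continuous (fun p : R * st => expR (c * p.1)).
Proof.
move=> p; have c1 : (fun p : R * st => p.1) @ p --> p.1 by exact: cvg_fst.
have c2 : (fun p : R * st => c * p.1) @ p --> c * p.1.
  by apply: cvgM; [exact: cvg_cst|exact: c1].
exact: (cvg_comp _ _ c2 (@continuous_expR R _)).
Qed.

Let continuous_stx : continuous (fun p : R * st => st_x p.2).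
Proof.
move=> p; have c1 : (fun p : R * st => p.2) @ p --> p.2 by exact: cvg_snd.
exact: (cvg_comp _ _ c1 (@st_x_continuous _ _ _ _)).
Qed.

Let continuous_stxi : continuous (fun p : R * st => st_xi p.2).
Proof.
move=> p; have c1 : (fun p : R * st => p.2) @ p --> p.2 by exact: cvg_snd.
exact: (cvg_comp _ _ c1 (@st_xi_continuous _ _ _ _)).
Qed.

Lemma slow_continuous : continuous slow.
Proof.
rewrite (_ : slow = (fun p => expR (c * p.1) * bform 1%:M (st_x p.2 - xs) (st_x p.2 - xs))).
  have cz : continuous (fun p : R * st => st_x p.2 - xs).
    by move=> p; apply: cvgB; [exact: continuous_stx|exact: cvg_cst].
  have c1 := continuous_bform (M := (1%:M : 'M[R]_n1)) cz cz.
  by move=> p; apply: cvgM; [exact: continuous_growth|exact: c1].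
by apply/funext => p; rewrite -sqnorm2E.
Qed.

Lemma fast_continuous i : continuous (fast i).
Proof.
rewrite (_ : fast i = (fun p => expR (c * p.1) *
   ((bform (P i) (st_xi p.2) (st_xi p.2) + bform (P i *m B) (st_xi p.2) (st_x p.2)) +
    (bform (B^T *m P i) (st_x p.2) (st_xi p.2) +
     bform (B^T *m (P i *m B)) (st_x p.2) (st_x p.2))))).
  have c1 := continuous_bform (M := P i) continuous_stxi continuous_stxi.
  have c2 := continuous_bform (M := P i *m B) continuous_stxi continuous_stx.
  have c3 := continuous_bform (M := B^T *m P i) continuous_stx continuous_stxi.
  have c4 := continuous_bform (M := B^T *m (P i *m B)) continuous_stx continuous_stx.
  move=> p; apply: cvgM; first exact: continuous_growth.
  apply: cvgD; [exact: (cvgD (c1 p) (c2 p))|exact: (cvgD (c3 p) (c4 p))].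
apply/funext => p; rewrite /fast /fast_part bformDl !bformDr.
by rewrite !bform_mull !bform_mulr mulmxA.
Qed.

Let slow_last j w := last_value D slow (level (y w) j).
Let fast_last i j w := last_value D (fast i) (level (y w) j).

Let slow_last_ge0 j w : 0 <= slow_last j w.
Proof. exact: last_value_ge0. Qed.

Let fast_last_ge0 i j w : 0 <= fast_last i j w.
Proof. exact: last_value_ge0. Qed.

Lemma measurable_last_level (F : R * st -> R) j d' (Om' : measurableType d')
    (y' : Om' -> hybrid_arc st) :
  continuous F -> (forall p, 0 <= F p) ->
  measurable_multifun measurable (fun w => level (y' w) j) ->
  (forall w, closed (arc_graph (y' w))) ->
  measurable_fun setT (fun w => last_value D F (level (y' w) j)).
Proof.
move=> cF F0 my closed_graph.
apply: (@measurable_last_value R st _ (@state_cover_compact R n n1)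
  (@state_coverT R n n1)) => //.
- exact: jump_set_closed.
- by move=> w t s1 s2; exact: level_functional.
- by move=> w; apply: level_closed.
Qed.

Let closed_graph w : closed (arc_graph (y w)).
Proof. by case: sol => -[]. Qed.

Lemma measurable_adapted (F : R * st -> R) j : continuous F -> (forall p, 0 <= F p) ->
  @measurable_fun _ _ (g_sigma_algebraType (filtration_gen v j)) _ setT
    (fun w => last_value D F (level (y w) j)).
Proof.
move=> cF F0; apply: measurable_last_level => //.
by apply: level_adapted; case: sol.
Qed.

Lemma measurable_last (F : R * st -> R) j : continuous F -> (forall p, 0 <= F p) ->
  measurable_fun setT (fun w => last_value D F (level (y w) j)).
Proof.
move=> cF F0; apply: measurable_last_level => //.
by apply: level_measurable; case: sol.
Qed.

(** The last point of level [j] is measurable with respect to the inputs 1, .., j,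
    of which the next input is independent. *)
Lemma integral_last_indep (F : R * st -> R) (g : @input_space R -> R) j :
  continuous F -> (forall p, 0 <= F p) -> measurable_fun setT g -> (forall u, 0 <= g u) ->
  (\int[Pr]_w (last_value D F (level (y w) j) * g (v j.+1 w))%:E =
   \int[Pr]_w (last_value D F (level (y w) j))%:E * \int[Pr]_w (g (v j.+1 w))%:E)%E.
Proof.
move=> cF F0 mg g0.
under eq_integral do rewrite EFinM.
have [mv _ _] := iid.
have mid : @measurable_fun _ _ Om (g_sigma_algebraType (filtration_gen v j)) setT id.
  by move=> _ E mE; rewrite setTI preimage_id; exact: (filtration_measurable iid mE).
apply: (@integral_indep _ _ _ Pr _ _ _ _ (id : Om -> g_sigma_algebraType (filtration_gen v j))
  (v j.+1) (fun w => (last_value D F (level (y w) j))%:E) (fun u => (g u)%:E)) => //.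
- exact: mv.
- by move=> E F' mE mF'; exact: (filtration_independent iid).
- by apply/measurable_EFinP; exact: measurable_adapted.
- exact/measurable_EFinP.
- by move=> w; rewrite lee_fin last_value_ge0.
Qed.

Let majorant j w := majorant_seq B P xs kap gam c D (lyap i0 y0) (y w) (fun k => v k w) j.

Let lyap_ge0 i s : 0 <= st_tau s <= T -> 0 <= lyap i s.
Proof.
move=> /andP[s0 sT]; apply: addr_ge0; apply: mulr_ge0 => //.
- by rewrite subr_ge0 (le_trans (ler_wpM2l kap_ge0 sT))// (le_trans kapT)//; lra.
- exact: sqnorm2_ge0.
- by rewrite invr_ge0 addr_ge0// mulr_ge0.
Qed.

Let slow_weight_input_ge0 (u : @input_space R) : 0 <= slow_weight kap u.2.
Proof. exact: slow_weight_ge0. Qed.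

Let fast_weight_input_ge0 (i : 'I_N) (u : @input_space R) :
  0 <= (u.1 == mode i)%:R * fast_weight gam u.2.
Proof. by rewrite mulr_ge0// fast_weight_ge0. Qed.

Let measurable_slow_input : measurable_fun setT
  (fun u : @input_space R => slow_weight kap u.2).
Proof. exact: (measurableT_comp (measurable_slow_weight _) measurable_snd). Qed.

Let measurable_fast_input (i : 'I_N) : measurable_fun setT
  (fun u : @input_space R => (u.1 == mode i)%:R * fast_weight gam u.2).
Proof.
apply: measurable_funM; last first.
  exact: (measurableT_comp (measurable_fast_weight gam_ge0) measurable_snd).
rewrite (_ : (fun _ => _) = \1_[set mode i] \o fst); last first.
  apply/funext => u /=; rewrite indicE.
  have -> // : (u.1 \in [set mode i]) = (u.1 == mode i).
  by apply/idP/eqP => [|->]; rewrite ?inE// mem_set.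
apply: measurableT_comp; last exact: measurable_fst.
by apply: measurable_indic; exact: measurable_set1.
Qed.

Lemma majorant_ge0 j w : 0 <= majorant j w.
Proof.
case: j => [|j]; first exact: lyap_ge0.
rewrite /majorant/= /after_jump addr_ge0//.
  by rewrite mulr_ge0 ?last_value_ge0// slow_weight_ge0.
by apply: sumr_ge0 => i _; rewrite mulr_ge0 ?last_value_ge0.
Qed.

Lemma measurable_majorant j : measurable_fun setT (majorant j).
Proof.
case: j => [|j]; first exact: measurable_cst.
have [mv _ _] := iid.
apply: measurable_funD.
  apply: measurable_funM; first by apply: measurable_last => //; exact: slow_continuous.
  exact: (measurableT_comp measurable_slow_input (mv j.+1 isT)).
apply: measurable_sum => i.
apply: measurable_funM; first by apply: measurable_last => //; exact: fast_continuous.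
exact: (measurableT_comp (measurable_fast_input i) (mv j.+1 isT)).
Qed.

Lemma almost_all_good :
  {ae Pr, forall w, forall k, (0 < k)%N -> good_input N T (v k w)}.
Proof.
pose Bad k := if (0 < k)%N then ~` (v k @^-1` (modes N `*` `[0, T]%classic)) else set0.
have mR : measurable ((modes N : set (measurableTypeR R)) `*` (`[0, T]%classic : set (measurableTypeR R))).
  by apply: measurableX; [exact: modes_measurable|exact: measurable_itv].
exists (\bigcup_k Bad k); split.
- apply: bigcupT_measurable => k; rewrite /Bad; case: ifP => // k0.
  by apply: measurableC; exact: (measurable_preimage_input iid).
- apply/eqP; rewrite eq_le measure_ge0 andbT.
  have mB k : measurable (Bad k).
    rewrite /Bad; case: ifP => // k0.
    by apply: measurableC; exact: (measurable_preimage_input iid).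
  apply: le_trans (measure_sigma_subadditive Pr mB (bigcupT_measurable _ mB) (@subset_refl _ _)) _.
  rewrite eseries0// => k _ _; rewrite /Bad; case: ifP => k0; last exact: measure0.
  apply: etrans (probability_setC Pr (measurable_preimage_input iid k0 mR)) _.
  by rewrite (input_good lam_sum iid k0) subee.
- move=> w /= /existsNP[k /not_implyP[k0 bad]]; exists k => //.
  by rewrite /Bad k0 => -[m t]; apply: bad; split; rewrite // -in_itv.
Qed.

Lemma path_bound_good w : (forall k, (0 < k)%N -> good_input N T (v k w)) ->
  forall j t, arc_dom (y w) (t, j) -> exists i,
    [/\ st_q (arc_val (y w) t j) = mode i, 0 <= st_tau (arc_val (y w) t j) <= T &
      expR (c * t) * lyap i (arc_val (y w) t j) <= majorant j w].
Proof.
move=> good j t dt; case: sol => _ _ ini fl ju.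
have [d0 v0] := ini w.
exact: (path_bound gam_ge0 eps_gt0 c_ge0 kap_ge0 kapT rate (fl w) (ju w) d0 v0 q0 tau0 good dt).
Qed.

(** The left side is the conditional mean of the next majorant.  Where level [j] has
    a last point in the jump set, [jump] applies to it. *)
Lemma jump_bound_good j w : (forall k, (0 < k)%N -> good_input N T (v k w)) ->
  slow_last j w * (1 - kap * T / 2) +
    \sum_i fast_last i j w * ((lam i)%:num * (sigma^-1 * ln (1 + sigma))) <=
    rho * majorant j w.
Proof.
move=> good; have /andP[rho0 _] := rho01.
have [[[s x] lp Dx]|no] := pselect (exists2 p, last_point (level (y w) j) p & D p.2); last first.
  rewrite /slow_last last_value_out// mul0r add0r big1; last first.
    by move=> i _; rewrite /fast_last last_value_out// mul0r.
  by rewrite mulr_ge0 ?majorant_ge0// ltW.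
have lvl := @level_functional R st (y w) j.
rewrite /slow_last (last_valueE _ lvl lp Dx).
rewrite (eq_bigr (fun i => fast i (s, x) * ((lam i)%:num * (sigma^-1 * ln (1 + sigma))))); last first.
  by move=> i _; rewrite /fast_last (last_valueE _ lvl lp Dx).
have [[/= ds xE] _] := lp.
have [i [qi taui Vi]] := path_bound_good good ds; rewrite -xE in qi taui Vi.
have tau_0 : st_tau x = 0 by move: Dx; rewrite /D/=; case: (x) => ? [[? ?] ?] /= [].
apply: le_trans (ler_wpM2l (ltW rho0) Vi).
rewrite mulrCA /lyap_st tau_0.
apply: le_trans (ler_wpM2l (expR_ge0 (c * s)) (jump i (st_x x) (st_xi x))).
rewrite /slow /slow_part /fast /fast_part /= [leRHS]mulrDr.
apply: lerD; first by rewrite le_eqVlt; apply/orP; left; apply/eqP; ring.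
rewrite !mulr_sumr; apply: ler_sum => q _.
by rewrite le_eqVlt; apply/orP; left; apply/eqP; ring.
Qed.

(** Independence turns the mean of the next majorant into the mean of its
    conditional mean. *)
Lemma expectation_step j :
  (\int[Pr]_w (majorant j.+1 w)%:E <= rho%:E * \int[Pr]_w (majorant j w)%:E)%E.
Proof.
have /andP[rho0 _] := rho01.
have cS := slow_continuous; have cF := fast_continuous.
have k1 : 0 <= 1 - kap * T / 2 by move: kapT; lra.
have k2 : 0 <= sigma^-1 * ln (1 + sigma).
  by rewrite mulr_ge0 ?invr_ge0 ?ln_ge0 ?lerDl ?ltW.
have [mv _ _] := iid.
have mvS : measurable_fun setT (fun w => slow_weight kap (v j.+1 w).2).
  exact: (measurableT_comp measurable_slow_input (mv j.+1 isT)).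
have mvF (i : 'I_N) : measurable_fun setT
    (fun w => ((v j.+1 w).1 == mode i)%:R * fast_weight gam (v j.+1 w).2).
  exact: (measurableT_comp (measurable_fast_input i) (mv j.+1 isT)).
have mlS : measurable_fun setT (slow_last j) by exact: measurable_last.
have mlF i : measurable_fun setT (fast_last i j) by exact: measurable_last.
have mlS' : measurable_fun setT (fun w => (slow_last j w)%:E) by exact/measurable_EFinP.
have mlF' i : measurable_fun setT (fun w => (fast_last i j w)%:E) by exact/measurable_EFinP.
have E1 : (\int[Pr]_w (majorant j.+1 w)%:E =
  \int[Pr]_w (slow_last j w)%:E * (1 - kap * T / 2)%:E +
  \sum_i \int[Pr]_w (fast_last i j w)%:E * ((lam i)%:num * (sigma^-1 * ln (1 + sigma)))%:E)%E.
  transitivity (\int[Pr]_w ((slow_last j w * slow_weight kap (v j.+1 w).2)%:E +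
     \sum_i (fast_last i j w * (((v j.+1 w).1 == mode i)%:R * fast_weight gam (v j.+1 w).2))%:E))%E.
    by apply: eq_integral => w _; rewrite sumEFin -EFinD.
  rewrite ge0_integralD//=; first last.
  - apply: emeasurable_sum => i; apply/measurable_EFinP; exact: measurable_funM.
  - by move=> w _; apply: sume_ge0 => i _; rewrite lee_fin mulr_ge0.
  - by apply/measurable_EFinP; exact: measurable_funM.
  - by move=> w _; rewrite lee_fin mulr_ge0.
  congr (_ + _)%E.
    rewrite (@integral_last_indep slow (fun u => slow_weight kap u.2))//.
    congr (_ * _)%E; rewrite (integral_input2 lam_sum iid)//.
    - exact: integral_slow_weight.
    - exact: measurable_slow_weight.
    - exact: slow_weight_ge0.
  rewrite ge0_integral_sum//; first last.
  - by move=> i w _; rewrite lee_fin mulr_ge0.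
  - by move=> i; apply/measurable_EFinP; exact: measurable_funM.
  apply: eq_bigr => i _.
  rewrite (@integral_last_indep (fast i) (fun u => (u.1 == mode i)%:R * fast_weight gam u.2))//.
  congr (_ * _)%E; rewrite (integral_input_mode lam_sum iid)//.
  - by rewrite integral_fast_weight// EFinM.
  - exact: measurable_fast_weight.
  - by move=> x; exact: fast_weight_ge0.
rewrite E1.
have -> : (\int[Pr]_w (slow_last j w)%:E * (1 - kap * T / 2)%:E +
  \sum_i \int[Pr]_w (fast_last i j w)%:E * ((lam i)%:num * (sigma^-1 * ln (1 + sigma)))%:E =
  \int[Pr]_w (slow_last j w * (1 - kap * T / 2) +
    \sum_i fast_last i j w * ((lam i)%:num * (sigma^-1 * ln (1 + sigma))))%:E)%E.
  apply/esym.
  transitivity (\int[Pr]_w ((slow_last j w)%:E * (1 - kap * T / 2)%:E +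
     \sum_i (fast_last i j w)%:E * ((lam i)%:num * (sigma^-1 * ln (1 + sigma)))%:E))%E.
    by apply: eq_integral => w _; rewrite EFinD EFinM -sumEFin.
  rewrite ge0_integralD//=; first last.
  - apply: emeasurable_sum => i; apply/measurable_EFinP; exact: measurable_funM.
  - by move=> w _; apply: sume_ge0 => i _; rewrite -EFinM lee_fin mulr_ge0// mulr_ge0.
  - by apply/measurable_EFinP; exact: measurable_funM.
  - by move=> w _; rewrite -EFinM lee_fin mulr_ge0.
  congr (_ + _)%E.
    by rewrite ge0_integralZr// => w _; rewrite lee_fin.
  rewrite ge0_integral_sum//; first last.
  - by move=> i w _; rewrite -EFinM lee_fin mulr_ge0// mulr_ge0.
  - by move=> i; apply/measurable_EFinP; exact: measurable_funM.
  apply: eq_bigr => i _; rewrite ge0_integralZr//.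
  - by move=> w _; rewrite lee_fin.
  - by rewrite lee_fin mulr_ge0.
rewrite -ge0_integralZl//; first last.
- by rewrite lee_fin ltW.
- by move=> w _; rewrite lee_fin majorant_ge0.
- by apply/measurable_EFinP; exact: measurable_majorant.
apply: ae_ge0_le_integral => //.
- move=> w _; rewrite lee_fin addr_ge0 ?mulr_ge0// sumr_ge0// => i _.
  by rewrite mulr_ge0// mulr_ge0.
- apply/measurable_EFinP; apply: measurable_funD; first exact: measurable_funM.
  by apply: measurable_sum => i; exact: measurable_funM.
- by move=> w _; rewrite -EFinM lee_fin mulr_ge0 ?majorant_ge0// ltW.
- apply/measurable_EFinP; apply: measurable_funM => //; exact: measurable_majorant.
- have := almost_all_good; apply: negligibleS => w /=; apply: contra_not => good _.
  by rewrite -EFinM lee_fin; exact: jump_bound_good.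
Qed.

Lemma expectation_bound j :
  (\int[Pr]_w (majorant j w)%:E <= (rho ^+ j * lyap i0 y0)%:E)%E.
Proof.
have /andP[rho0 _] := rho01.
elim: j => [|j IH].
  by rewrite /majorant/= integral_cst//= probability_setT mule1 mul1r.
apply: le_trans (expectation_step j) _.
rewrite exprS -mulrA EFinM; apply: lee_wpmul2l => //.
by rewrite lee_fin ltW.
Qed.

Lemma exponential_bound (r K : R) : 0 < r < 1 -> r ^+ 2 = rho -> 0 < K ->
  exists E : set Om, [/\ measurable E,
    ((1 - lyap i0 y0 / K / (1 - r))%:E <= Pr E)%E &
    forall w, E w -> forall t j, arc_dom (y w) (t, j) -> exists i,
      [/\ st_q (arc_val (y w) t j) = mode i, 0 <= st_tau (arc_val (y w) t j) <= T &
        lyap i (arc_val (y w) t j) <= K * (r ^+ j * expR (- (c * t)))]].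
Proof.
move=> r01 rE K0; have /andP[r0 r1] := r01.
(* The threshold decreases more slowly than the mean [rho ^+ j], so that the
   probabilities are summable. *)
pose Bd j := [set w | K * r ^+ j <= majorant j w].
have Kr j : 0 < K * r ^+ j by rewrite mulr_gt0// exprn_gt0.
have mBd j : measurable (Bd j).
  rewrite (_ : Bd j = majorant j @^-1` `[K * r ^+ j, +oo[%classic); last first.
    by apply/seteqP; split => w /=; rewrite in_itv/= andbT.
  rewrite -[X in measurable X]setTI; apply: measurable_majorant => //; exact: measurable_itv.
have V0 : 0 <= lyap i0 y0 by exact: lyap_ge0.
have PB j : (Pr (Bd j) <= (lyap i0 y0 / K * r ^+ j)%:E)%E.
  have := le_trans (markov_ineq Pr (measurable_majorant j) (majorant_ge0 j) (Kr j)) (expectation_bound j).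
  rewrite -(fineK (fin_num_measure Pr _ (mBd j))) -EFinM !lee_fin mulrC -ler_pdivlMr//.
  move/le_trans; apply; rewrite -rE -exprM mulnC exprM le_eqVlt; apply/orP; left.
  apply/eqP; rewrite expr2 -/(Bd j); have rj : r ^+ j != 0 by rewrite gt_eqF// exprn_gt0.
  by field; rewrite rj gt_eqF.
have PU := geometric_union_bound (Pr := Pr) mBd (divr_ge0 V0 (ltW K0)) r01 PB.
have [N0 [mN PN NH]] := almost_all_good.
pose Z := \bigcup_j Bd j `|` N0.
have mU : measurable (\bigcup_j Bd j) by exact: bigcupT_measurable.
have mZ : measurable Z by exact: measurableU.
exists (~` Z); split; first exact: measurableC.
  have PZ : (Pr Z <= (lyap i0 y0 / K / (1 - r))%:E)%E.
    apply: le_trans PU; rewrite -[leRHS]adde0 -PN.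
    exact: measureU2.
  apply: le_trans (_ : (1 - Pr Z)%E <= _)%E; last first.
    by rewrite (probability_setC Pr mZ).
  by rewrite EFinB; apply: leeB.
move=> w nZ t j dt.
have good : forall k, (0 < k)%N -> good_input N T (v k w).
  by apply: contrapT => bad; apply: nZ; right; exact: NH.
have [i [qi taui Vi]] := path_bound_good good dt.
exists i; split => //.
have lt1 : majorant j w < K * r ^+ j.
  by rewrite ltNge; apply/negP => h; apply: nZ; left; exists j.
rewrite expRN mulrA ler_pdivlMr ?expR_gt0// mulrC.
exact: le_trans Vi (ltW lt1).
Qed.

End expectation.

(** * The target set and the three properties *)

Section target.
Context {R : realType} (N n n1 : nat) (T : R) (B : 'M[R]_(n, n1)) (xs : 'cV[R]_n1).
Notation st := (@state R n n1).
Let tgt := target_set N T B xs.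

Lemma state_normE (y : st) : state_norm y =
  Num.sqrt (sqnorm2 (st_x y) + sqnorm2 (st_xi y) + st_q y ^+ 2 + st_tau y ^+ 2).
Proof. by case: y => x [[xi q] tau]. Qed.

(** The squared distance to the target of a state whose mode and clock are
    admissible: the nearest point of the target has the same mode and clock. *)
Definition gap (y : st) : R := sqnorm2 (st_x y - xs) + sqnorm2 (st_xi y + B *m xs).

Lemma gap_ge0 y : 0 <= gap y.
Proof. by rewrite addr_ge0 ?sqnorm2_ge0. Qed.

Lemma target_setP (s : st) : tgt s ->
  [/\ st_x s = xs, st_xi s = - (B *m xs), modes N (st_q s) & 0 <= st_tau s <= T].
Proof. by case: s => x [[xi q] tau]. Qed.

Lemma gap_le_norm (y s : st) : tgt s -> Num.sqrt (gap y) <= state_norm (y - s).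
Proof.
move=> /target_setP[sx sxi _ _]; rewrite state_normE ler_wsqrtr//.
have -> : st_x (y - s) = st_x y - xs by rewrite -sx.
have -> : st_xi (y - s) = st_xi y + B *m xs by rewrite -[B *m xs]opprK -sxi.
by rewrite -addrA lerDl addr_ge0 ?sqr_ge0.
Qed.

Lemma gap_le_dist (y : st) (r : R) : modes N (st_q y) -> 0 <= st_tau y <= T ->
  0 <= r -> set_dist (@state_norm R n n1) tgt y <= r -> gap y <= r ^+ 2.
Proof.
move=> my ty r0 dr.
have h : Num.sqrt (gap y) <= r.
  apply: le_trans dr; apply: lb_le_inf.
    exists (state_norm (y - (xs, (- (B *m xs), st_q y, st_tau y)))).
    by exists (xs, (- (B *m xs), st_q y, st_tau y)).
  by move=> _ [s ts <-]; exact: gap_le_norm.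
by rewrite -(sqr_sqrtr (gap_ge0 y)) ler_sqr ?nnegrE ?sqrtr_ge0.
Qed.

Lemma gap_enlarge (y : st) (e : R) : modes N (st_q y) -> 0 <= st_tau y <= T ->
  0 < e -> gap y < e ^+ 2 -> enlarge (@state_norm R n n1) tgt e y.
Proof.
move=> my ty e0 ge.
exists (xs, (- (B *m xs), st_q y, st_tau y)); first by [].
rewrite state_normE.
have -> : st_q (y - (xs, (- (B *m xs), st_q y, st_tau y))) = 0 by exact: subrr.
have -> : st_tau (y - (xs, (- (B *m xs), st_q y, st_tau y))) = 0 by exact: subrr.
have -> : st_x (y - (xs, (- (B *m xs), st_q y, st_tau y))) = st_x y - xs by [].
have -> : st_xi (y - (xs, (- (B *m xs), st_q y, st_tau y))) = st_xi y + B *m xs.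
  by rewrite -[in RHS](opprK (B *m xs)).
rewrite expr0n/= !addr0 -[ltRHS](ger0_norm (ltW e0)) -sqrtr_sqr.
by rewrite ltr_sqrt// exprn_gt0.
Qed.

Lemma continuous_sqnorm2 (X : topologicalType) k (f : X -> 'cV[R]_k) : continuous f ->
  continuous (fun y => sqnorm2 (f y)).
Proof.
move=> cf; rewrite (_ : (fun y => _) = (fun y => bform 1%:M (f y) (f y))).
  exact: continuous_bform.
by apply/funext => y; rewrite sqnorm2E.
Qed.

Lemma state_norm_continuous : continuous (@state_norm R n n1).
Proof.
have cx := continuous_sqnorm2 (@st_x_continuous R n n1).
have cxi := continuous_sqnorm2 (@st_xi_continuous R n n1).
rewrite (_ : @state_norm R n n1 = fun y => Num.sqrt (sqnorm2 (st_x y) +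
  sqnorm2 (st_xi y) + st_q y * st_q y + st_tau y * st_tau y)); last first.
  by apply/funext => y; rewrite state_normE !expr2.
move=> y.
have c1 : (fun y : st => sqnorm2 (st_x y) + sqnorm2 (st_xi y) + st_q y * st_q y +
   st_tau y * st_tau y) @ y --> sqnorm2 (st_x y) +
  sqnorm2 (st_xi y) + st_q y * st_q y + st_tau y * st_tau y.
  apply: cvgD; last by apply: cvgM; exact: st_tau_continuous.
  apply: cvgD; last by apply: cvgM; exact: st_q_continuous.
  by apply: cvgD; [exact: cx|exact: cxi].
exact: (cvg_comp _ _ c1 (@sqrt_continuous R _)).
Qed.

Lemma enlarge_open (e : R) : open (enlarge (@state_norm R n n1) tgt e).
Proof.
rewrite (_ : enlarge _ _ _ = \bigcup_(a in tgt) [set y | state_norm (y - a) < e]); last first.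
  by apply/seteqP; split => y [a ? ?]; exists a.
apply: bigcup_open => a _.
rewrite (_ : [set y | _] = (fun y => state_norm (y - a)) @^-1` [set t | t < e])//.
apply: open_comp; last exact: open_lt.
move=> y _; have c1 : (fun y : st => y - a) @ y --> y - a.
  by apply: cvgB; [exact: cvg_id|exact: cvg_cst].
exact: (cvg_comp _ _ c1 (@state_norm_continuous _)).
Qed.

Context {d : measure_display} {Om : measurableType d} (y : Om -> hybrid_arc st).
Hypothesis sy : stochastic_hybrid_arc y.

(** An arc avoids [K] when none of its countably many levels meets [K]. *)
Lemma measurable_avoid (K : nat -> set (R * st)) : (forall j, closed (K j)) ->
  measurable [set w | forall t j, arc_dom (y w) (t, j) -> ~ K j (t, arc_val (y w) t j)].
Proof.
move=> cK.
rewrite (_ : [set w | _] = \bigcap_j ~` [set w | level (y w) j `&` K j !=set0]).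
  apply: bigcapT_measurable => j; apply: measurableC.
  apply: (hits_closed (@state_cover_compact R n n1) (@state_coverT R n n1)) => //.
    exact: level_measurable.
  by move=> w; apply: level_closed; case: sy.
apply/seteqP; split => w /= H.
  by move=> j _ [[t s] [[/= dt ->]]]; exact: H.
by move=> t j dt Kt; apply: (H j I); exists (t, arc_val (y w) t j).
Qed.

Lemma closed_out (e : R) :
  closed [set p : R * st | ~ enlarge (@state_norm R n n1) tgt e p.2].
Proof.
rewrite (_ : [set p | _] = snd @^-1` (~` enlarge (@state_norm R n n1) tgt e))//.
apply: closed_comp => [p _|]; first exact: cvg_snd.
by apply: open_closedC; exact: enlarge_open.
Qed.

Lemma measurable_stay_in (e : R) : measurable (stay_in (@state_norm R n n1) tgt y e).
Proof.
have := measurable_avoid (fun=> @closed_out e); congr measurable.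
apply/seteqP; split => w /= H t j dt; first by apply: contrapT => h; exact: (H t j dt).
by move=> h; apply: h; exact: H.
Qed.

Lemma measurable_stay_in_after (Tb e : R) :
  measurable (stay_in_after (@state_norm R n n1) tgt Tb y e).
Proof.
have cK j : closed ([set p : R * st | Tb <= p.1 + j%:R] `&`
    [set p | ~ enlarge (@state_norm R n n1) tgt e p.2]).
  apply: closedI (@closed_out e).
  rewrite (_ : [set p | _] = (fun p : R * st => p.1 + j%:R) @^-1` [set t | Tb <= t])//.
  apply: closed_comp => [p _|]; last exact: closed_ge.
  by apply: cvgD; [exact: cvg_fst|exact: cvg_cst].
have := measurable_avoid cK; congr measurable.
apply/seteqP; split => w /= H t j dt.
  by move=> Tt; apply: contrapT => h; exact: (H t j dt).
by move=> [/= Tt h]; apply: h; exact: H.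
Qed.

End target.

Section rates.
Context {R : realType}.

Lemma hybrid_time_domain_ge0 (E : set (R * nat)) : hybrid_time_domain E ->
  forall j t, E (t, j) -> 0 <= t.
Proof.
move=> hE; elim => [|j IH] t Et; first by case: (hybrid_time_domain_level0 hE Et).
by have [s [st /IH s0 _ _ _]] := hybrid_time_domain_levelS hE Et; exact: le_trans st.
Qed.

Lemma decay_le1 (r c t : R) j : 0 < r < 1 -> 0 <= c -> 0 <= t ->
  r ^+ j * expR (- (c * t)) <= 1.
Proof.
move=> /andP[r0 r1] c0 t0; apply: mulr_ile1.
- by rewrite exprn_ge0// ltW.
- exact: expR_ge0.
- by apply: exprn_ile1; exact: ltW.
- by rewrite expR_le1 oppr_le0 mulr_ge0.
Qed.

(** From [r <= e^(- (1 - r))], the decay in [j] and in [t] is a decay in [t + j] at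
    the rate [min(c, 1 - r)]; then [e^x >= 1 + x]. *)
Lemma decay_lt (r c M e2 : R) : 0 < r < 1 -> 0 < c -> 0 < M -> 0 < e2 ->
  exists2 Tb : R, 0 <= Tb & forall t j, 0 <= t -> Tb <= t + j%:R ->
    M * (r ^+ j * expR (- (c * t))) < e2.
Proof.
move=> /andP[r0 r1] c0 M0 e0.
pose m := Num.min c (1 - r).
have m0 : 0 < m by rewrite lt_min c0 subr_gt0.
exists (M / (m * e2)); first by rewrite divr_ge0 ?mulr_ge0 ?ltW.
move=> t j t0 Tb.
have rj : r ^+ j <= expR (- (m * j%:R)).
  have -> : - (m * j%:R) = j%:R * - m by ring.
  rewrite expRM_natl; apply: lerXn2r; rewrite ?nnegrE ?expR_ge0 ?(ltW r0)//.
  apply: le_trans (expR_ge1Dx _); have : m <= 1 - r by rewrite ge_min lexx orbT.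
  lra.
have ct : expR (- (c * t)) <= expR (- (m * t)).
  by rewrite ler_expR lerN2 ler_wpM2r// ge_min lexx.
have h : r ^+ j * expR (- (c * t)) <= expR (- (m * (t + j%:R))).
  rewrite mulrDr opprD addrC expRD; apply: ler_pM; rewrite ?expR_ge0//.
  by rewrite exprn_ge0// ltW.
apply: le_lt_trans (ler_wpM2l (ltW M0) h) _.
rewrite expRN ltr_pdivrMr ?expR_gt0//.
have h1 : 1 + m * (t + j%:R) <= expR (m * (t + j%:R)) by exact: expR_ge1Dx.
have h2 : M <= e2 * (m * (t + j%:R)).
  have := ler_wpM2l (ltW m0) Tb; rewrite -(ler_pM2l e0); apply: le_trans.
  by rewrite le_eqVlt; apply/orP; left; apply/eqP; field; rewrite !gt_eqF.
apply: le_lt_trans h2 _; rewrite ltr_pM2l//.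
by apply: lt_le_trans h1; rewrite ltrDr.
Qed.

End rates.

Unset Implicit Arguments.

Theorem proposition3 (R : realType) (N n n1 p0 : nat)
    (T eta : R) (T_gt0 : 0 < T) (eta_ge0 : 0 <= eta)
    (A : 'I_N -> 'M[R]_n) (B : 'M[R]_(n, n1))
    (L : 'M[R]_(p0, n)) (d : 'cV[R]_p0)
    (phix : 'cV[R]_n1 -> R) (phiy : 'cV[R]_p0 -> R)
    (phix_C1 : C1fun phix) (phiy_C1 : C1fun phiy)
    (lam : 'I_N -> {nonneg R}) (lam_sum : \sum_(q < N) (lam q)%:num = 1)
    (sigma : R) (sigma_gt0 : 0 < sigma)
    (P : 'I_N -> 'M[R]_n) (P_posdef : forall q, posdefmx (P q))
    (flow_lmi : forall q, negdefmx
       ((A q)^T *m P q + P q *m A q + (sigma * eta * T^-1) *: P q))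
    (jump_lmi : forall q, negdefmx
       ((sigma^-1 * ln (1 + sigma)) *: (\sum_(i < N) (lam i)%:num *: P i) - P q))
    (m_phi L_phi L_phiy : R)
    (m_phi_gt0 : 0 < m_phi) (L_phi_gt0 : 0 < L_phi) (L_phiy_gt0 : 0 < L_phiy)
    (phi_smooth : smooth_with L_phi (total_cost B L d phix phiy))
    (phi_convex : strongly_convex m_phi (total_cost B L d phix phiy))
    (phiy_smooth : smooth_with L_phiy phiy)
    (xs : 'cV[R]_n1)
    (xs_min : unique (minimizer (total_cost B L d phix phiy)) xs) :
  exists2 eps_star : R, 0 < eps_star &
    forall eps : R, 0 < eps < eps_star ->
      UGASp (@state_norm R n n1)
        (switched_gradient_flow eta T_gt0 A B L d phix phiy lam eps)
        (target_set N T B xs).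
Proof.
have [kap0 [c [eps0 [kap00 c0 eps00 kapT rate]]]] := lyapunov_flow_rate T_gt0 eta_ge0
  phix_C1 phiy_C1 sigma_gt0 P_posdef flow_lmi m_phi_gt0 L_phi_gt0 L_phiy_gt0
  phi_smooth phi_convex phiy_smooth xs_min.
exists eps0 => // eps /[dup] epsI /andP[eps_gt0 _].
pose kap := kap0 * eps; pose gam := sigma / T.
have kap_gt0 : 0 < kap by rewrite mulr_gt0.
have {}kapT : kap * T <= 1 / 2 := kapT eps epsI.
have {}rate i x xi tau dx dxi dtau := rate eps i x xi tau dx dxi dtau epsI.
have [rho rho01 jump] := lyapunov_jump_rate T_gt0 B P_posdef jump_lmi xs kap_gt0.
have [al [be [al0 be0 bounds]]] :=
  lyapunov_bounds T_gt0 B sigma_gt0 P_posdef xs (ltW kap_gt0) kapT.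
have P_ge0 i u : 0 <= bform (P i) u u.
  have [a a0 Ha] := posdef_coercive (P_posdef i).
  by apply: le_trans (Ha u); rewrite mulr_ge0 ?sqnorm2_ge0// ltW.
have /andP[rho0 rho1] := rho01.
pose r := Num.sqrt rho.
have r01 : 0 < r < 1.
  by rewrite sqrtr_gt0 rho0/= -[ltRHS]sqrtr1 ltr_sqrt.
have r2 : r ^+ 2 = rho by rewrite sqr_sqrtr// ltW.
have /andP[r0 r1] := r01.
have r1' : 0 < 1 - r by rewrite subr_gt0.
set sys := switched_gradient_flow _ _ _ _ _ _ _ _ _ _.
set tgt := target_set _ _ _ _.
move=> dO Om Pr v iid.
have key (K del rh : R) : 0 < K -> 0 <= del -> be * del ^+ 2 / K / (1 - r) <= rh ->
  forall y0 y, initial_in (@state_norm R n n1) sys tgt del y0 ->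
    random_solution sys v y0 y ->
  exists E : set Om, [/\ measurable E, ((1 - rh)%:E <= Pr E)%E &
    forall w, E w -> forall t j, arc_dom (y w) (t, j) ->
      [/\ modes N (st_q (arc_val (y w) t j)), 0 <= st_tau (arc_val (y w) t j) <= T &
        gap B xs (arc_val (y w) t j) <= K / al * (r ^+ j * expR (- (c * t)))]].
  move=> K0 del0 hrh y0 y [CD0 dist0] sol.
  have [[i0 _ q0] tau0] : modes N (st_q y0) /\ 0 <= st_tau y0 <= T.
    case: CD0; case: (y0) => x [[xi q] tau] //= [mq ->].
    by rewrite lexx ltW.
  have gap0 : gap B xs y0 <= del ^+ 2.
    by apply: (gap_le_dist (N := N) (T := T)) => //; exists i0.
  have V0 : lyap_st B P xs kap gam i0 y0 <= be * del ^+ 2.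
    have /andP[_ h] := bounds i0 (st_x y0) (st_xi y0) (st_tau y0) tau0.
    by apply: le_trans h _; rewrite ler_pM2l.
  have [E [mE PE HE]] := exponential_bound lam_sum sigma_gt0 eps_gt0 (ltW c0)
    (ltW kap_gt0) kapT P_ge0 rate rho01 jump iid (esym q0) tau0 sol r01 r2 K0.
  exists E; split => //.
    apply: le_trans PE; rewrite lee_fin lerD2l lerN2; apply: le_trans hrh.
    by rewrite !ler_pM2r ?invr_gt0.
  move=> w Ew t j dt; have [i [qi taui Vi]] := HE w Ew t j dt.
  split => //; first by exists i.
  have /andP[h _] := bounds i (st_x (arc_val (y w) t j))
    (st_xi (arc_val (y w) t j)) (st_tau (arc_val (y w) t j)) taui.
  by rewrite mulrAC ler_pdivlMr// mulrC; exact: le_trans h Vi.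
have time_ge0 (psi : hybrid_arc (@state R n n1)) t j : arc_dom psi (t, j) -> 0 <= t.
  by move=> dt; exact: hybrid_time_domain_ge0 (arc_domP psi) _ _ dt.
split.
- move=> e rh e0 rh0.
  pose K := al * e ^+ 2 / 2.
  have K0 : 0 < K by rewrite divr_gt0// mulr_gt0// exprn_gt0.
  pose del := Num.sqrt (rh * K * (1 - r) / be).
  have q0 : 0 < rh * K * (1 - r) / be by rewrite divr_gt0// mulr_gt0// mulr_gt0.
  exists del; first by rewrite sqrtr_gt0.
  move=> y0 y ini [sol _].
  have hrh : be * del ^+ 2 / K / (1 - r) <= rh.
    rewrite sqr_sqrtr; last exact: ltW.
    by rewrite le_eqVlt; apply/orP; left; apply/eqP; field; rewrite !gt_eqF.
  have [E [mE PE HE]] := key K del rh K0 (sqrtr_ge0 _) hrh y0 y ini sol.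
  apply: le_trans PE _; apply: le_measure; rewrite ?inE//.
    by apply: measurable_stay_in; case: sol.
  move=> w Ew t j dt; have [mq tq gq] := HE w Ew t j dt.
  apply: gap_enlarge => //; apply: le_lt_trans gq _.
  have le1 := decay_le1 j r01 (ltW c0) (time_ge0 _ _ _ dt).
  have -> : K / al = e ^+ 2 / 2 by rewrite /K; field; rewrite gt_eqF.
  have e20 : 0 < e ^+ 2 by rewrite exprn_gt0.
  have := ler_wpM2l (ltW e20) le1; lra.
- move=> del rh del0 rh0.
  pose K := be * del ^+ 2 / (rh * (1 - r)).
  have K0 : 0 < K by rewrite divr_gt0 ?mulr_gt0// exprn_gt0.
  exists (1 + K / al); first by rewrite addr_gt0// divr_gt0.
  move=> y0 y ini [sol _].
  have hrh : be * del ^+ 2 / K / (1 - r) <= rh.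
    by rewrite le_eqVlt; apply/orP; left; apply/eqP; rewrite /K; field; rewrite !gt_eqF.
  have [E [mE PE HE]] := key K del rh K0 (ltW del0) hrh y0 y ini sol.
  apply: le_trans PE _; apply: le_measure; rewrite ?inE//.
    by apply: measurable_stay_in; case: sol.
  move=> w Ew t j dt; have [mq tq gq] := HE w Ew t j dt.
  have M0 : 0 < K / al by rewrite divr_gt0.
  apply: gap_enlarge => //; first by rewrite addr_gt0.
  apply: le_lt_trans gq _.
  have le1 := decay_le1 j r01 (ltW c0) (time_ge0 _ _ _ dt).
  have := ler_wpM2l (ltW M0) le1; nra.
- move=> e rh del e0 rh0 del0.
  pose K := be * del ^+ 2 / (rh * (1 - r)).
  have K0 : 0 < K by rewrite divr_gt0 ?mulr_gt0// exprn_gt0.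
  have M0 : 0 < K / al by rewrite divr_gt0.
  have e20 : 0 < e ^+ 2 by rewrite exprn_gt0.
  have [Tb Tb0 HTb] := decay_lt r01 c0 M0 e20.
  exists Tb => // y0 y ini sol.
  have hrh : be * del ^+ 2 / K / (1 - r) <= rh.
    by rewrite le_eqVlt; apply/orP; left; apply/eqP; rewrite /K; field; rewrite !gt_eqF.
  have [E [mE PE HE]] := key K del rh K0 (ltW del0) hrh y0 y ini sol.
  apply: le_trans PE _; apply: le_measure; rewrite ?inE//.
    by apply: measurable_stay_in_after; case: sol.
  move=> w Ew t j dt Tt; have [mq tq gq] := HE w Ew t j dt.
  apply: gap_enlarge => //; apply: le_lt_trans gq _.
  exact: HTb (time_ge0 _ _ _ dt) Tt.
Qed.
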